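(* Let $s\in\mathbb N$, let $\{\xi_l\}_{l\in\mathbb Z}$ be i.i.d. zero-mean real random variables and $\{c_l\}_{l\in\mathbb Z}$ real numbers. Assume: (reg) $E[|\xi_1|^2]<\infty$; (tail) $\sup_{t\ge1}t^{\alpha}P(|\xi_1|^s>t)<\infty$ for some $\alpha>1$; (decay) $\sup_{l\in\mathbb Z}|l|^{\sigma}|c_l|<\infty$ for some $\sigma\in(\frac12,1]$. Define $x_k=\sum_{l=-\infty}^{\infty}c_{k-l}\xi_l$ for $k\in\mathbb Z$. Then $$\lim_{n\to\infty}n^{-\frac1p}\sum_{k=1}^n\big((x_k)^s-E[(x_k)^s]\big)=0\quad\text{a.s.}$$ for all $p$ with $$0<p<\begin{cases}\dfrac{2}{3-2\sigma},&s=1,\\[2mm]2\wedge\alpha\wedge\dfrac{1}{2-2\sigma},&s=2,\\[2mm]\alpha\wedge\dfrac{2}{3-2\sigma},&s>2.\end{cases}$$ Furthermore, if $\xi_1$ is a symmetric random variable and $s$ is even, then the same convergence holds for all $p$ with $0<p<2\wedge\alpha\wedge\frac{1}{2-2\sigma}$.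
   Context: $a\wedge b=\min\{a,b\}$. Convention: in an expression $a\wedge\frac1x$ with $a>0$ and $x=0$, $\frac1x$ is read as $+\infty$ (so for $\sigma=1$, $2\wedge\alpha\wedge\frac1{2-2\sigma}=2\wedge\alpha$). Under the hypotheses the two-sided series defining $x_k$ converges almost surely. A random variable $X$ is symmetric if $X$ and $-X$ have the same distribution. *)

(* Defs.v *)
From HB Require Import structures.
From mathcomp Require Import all_boot all_order all_algebra finmap.
From mathcomp Require Import all_classical all_reals all_analysis.
Import Order.TTheory GRing.Theory Num.Theory.
Import numFieldNormedType.Exports.

Set Implicit Arguments.
Unset Strict Implicit.
Unset Printing Implicit Defensive.

Local Open Scope classical_set_scope.
Local Open Scope ring_scope.

(* The law of a variable is tested on measurable sets only: the values of a
   measure on non-measurable sets carry no information. *)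
Definition same_distribution (d : measure_display) (T : measurableType d)
    (R : realType) (P : probability T R) (X Y : T -> R) : Prop :=
  forall A : set R, measurable A -> P (X @^-1` A) = P (Y @^-1` A).

Definition identically_distributed (d : measure_display) (T : measurableType d)
    (R : realType) (P : probability T R) (I : Type) (X : I -> T -> R) : Prop :=
  forall i j : I, same_distribution P (X i) (X j).

Definition mutually_independent (d : measure_display) (T : measurableType d)
    (R : realType) (P : probability T R) (I : choiceType) (X : I -> T -> R) :
    Prop :=
  forall (J : {fset I}) (A : I -> set R), (forall i, measurable (A i)) ->
    P (\bigcap_(i in [set` J]) (X i @^-1` A i)) =
    (\prod_(i <- J) P (X i @^-1` A i))%E.

Definition iid (d : measure_display) (T : measurableType d)
    (R : realType) (P : probability T R) (I : choiceType) (X : I -> T -> R) :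
    Prop :=
  mutually_independent P X /\ identically_distributed P X.

Definition symmetric_rv (d : measure_display) (T : measurableType d)
    (R : realType) (P : probability T R) (X : T -> R) : Prop :=
  same_distribution P X (\- X).

(* The sum over l : int of u l, as the sum over l >= 0 plus the sum over
   l = - n.+1 < 0. [lim] is total, so where one of the halves diverges that
   half has a default value. *)
Definition two_sided_sum (R : realType) (u : int -> R) : R :=
  limn (fun N => \sum_(0 <= n < N) u n%:Z) +
  limn (fun N => \sum_(0 <= n < N) u (- n.+1%:Z)).

Definition linear_process (R : realType) (T : Type) (c : int -> R)
    (xi : int -> T -> R) (k : int) (w : T) : R :=
  two_sided_sum (fun l => c (k - l) * xi l w).

(* Centred partial sums are taken in \bar R, so that a non-finite expectation
   would not be silently replaced by a real number. *)
Definition power_slln (d : measure_display) (T : measurableType d)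
    (R : realType) (P : probability T R) (x : int -> T -> R) (s : nat) (p : R) :
    Prop :=
  {ae P, forall w,
    (fun n : nat => ((n%:R `^ (- p^-1))%:E *
       \sum_(1 <= k < n.+1)
         ((x k%:Z w ^+ s)%R%:E - 'E_P[fun w' => (x k%:Z w' ^+ s)%R]))%E)
    @ \oo --> 0%E}.

(* min(2, alpha, 1 / (2 - 2 sigma)); the inverse is the one of \bar R, where
   0^-1 = +oo, which is the intended reading for sigma = 1. *)
Definition rate_bound2 (R : realType) (alpha sigma : R) : \bar R :=
  Order.min (Order.min 2%:E alpha%:E) ((2 - 2 * sigma)%:E^-1)%E.

(* Only meant for s >= 1. *)
Definition rate_bound (R : realType) (s : nat) (alpha sigma : R) : \bar R :=
  if s == 1%N then (2 / (3 - 2 * sigma))%:E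
  else if s == 2%N then rate_bound2 alpha sigma
  else Order.min alpha%:E (2 / (3 - 2 * sigma))%:E.

(* Main.v *)
(** Truncate the linear process to a finite window of innovations. Its s-th power
    expands into sums of products over distinct indices, where each factor is a
    power of one innovation; the powers of exponent at least 2 are split into a
    centred part and a mean. Terms with a centred factor are, after averaging
    over random splittings of the index set (decoupling), martingale transforms
    with coefficients summable along the block, so the inequality of von Bahr and
    Esseen bounds their sum over a block of length N by N^(1/q) in L^q, where
    q < min(alpha, 2). Terms with means and r linear factors are uncorrelated for
    different index sets and their covariance at lag h is at most the r-th power
    of the correlation of the absolute coefficients, of order h^(1 - 2 sigma);
    this gives N^(1 - e/2) in L^2. Both bounds are uniform in the window and pass
    to the limit by Fatou's lemma, and dyadic chaining turns them into the almost
    sure bound N^b for every b above both exponents. *)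

Require Import Defs.
From HB Require Import structures.
From mathcomp Require Import all_boot all_order all_algebra finmap.
From mathcomp Require Import all_classical all_reals all_analysis measurable_realfun.
From mathcomp Require Import ring lra zify.
Import Order.TTheory GRing.Theory Num.Theory.
Import numFieldNormedType.Exports.

Set Implicit Arguments.
Unset Strict Implicit.
Unset Printing Implicit Defensive.

Local Open Scope classical_set_scope.
Local Open Scope ring_scope.

(** * Sums over distinct indices *)

(** The obstacle is that the decay makes the coefficients square summable, but in general not
    summable. A factor of exponent at least 2 has summable coefficients and can be estimated index
    by index, but only its moments of order below [alpha] are controlled; a linear factor has a
    second moment, but its sum over the indices converges only through cancellation. The thresholds
    count linear factors. Means and [r] linear factors lead to the exponent 1 - (2 sigma - 1) r / 2,
    to be compared with 1 / p: r = 1 gives p < 2 / (3 - 2 sigma), r = 2 gives p < 1 / (2 - 2 sigma).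
    The parameter [r0] is the least positive [r] to be faced: 2 if s = 2, or if s is even and the
    odd moments vanish, and 1 in the other cases. As the bounds on [p] are strict, [sigma] gives way
    to a slightly smaller [g0] < 1 and the covariance exponent [e] stays below 1, so that no
    borderline logarithm appears. On windows the sums are centred at an unspecified constant; it is
    replaced by the expectation only after the limit, so no convergence of moments has to be proved
    beforehand. *)

Section InjSum.
Variables (R : comPzRingType) (I : finType).
Implicit Types (f g y : I -> R) (s : seq (I -> R)) (A B : {set I}) (a : seq nat).

(** This is the sum over tuples of pairwise distinct indices. The tuples are ordered: [r] copies of
    one function give r! times an elementary symmetric polynomial. *)
Fixpoint injsum s A : R :=
  if s is f :: s' then \sum_(i in A) f i * injsum s' (A :\ i)%SET else 1.

Lemma injsum_cons f s A :
  injsum (f :: s) A = \sum_(i in A) f i * injsum s (A :\ i)%SET.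
Proof. by []. Qed.

Lemma injsum_swap f g s A : injsum (f :: g :: s) A = injsum (g :: f :: s) A.
Proof.
rewrite /=; under eq_bigr do rewrite big_distrr /=.
under [RHS]eq_bigr do rewrite big_distrr /=.
rewrite (exchange_big_dep (fun j => j \in A)) /=; last first.
  by move=> i j iA; rewrite !inE => /andP[].
apply: eq_bigr => j jA; apply: eq_big => [i|i /andP[iA]].
  by rewrite !inE jA andbT andbC eq_sym.
rewrite mulrCA => _; congr (_ * (_ * injsum s _)).
by rewrite !finset.setDDl finset.setUC.
Qed.

(** Any factor can thus be moved to the front, where the recursion and the estimates act. *)
Lemma injsum_mid s1 f s2 A : injsum (s1 ++ f :: s2) A = injsum (f :: s1 ++ s2) A.
Proof.
elim: s1 A => // g s1 IH A; rewrite cat_cons injsum_cons.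
under eq_bigr do rewrite IH.
by rewrite -injsum_cons injsum_swap.
Qed.

Definition powers y a : seq (I -> R) := [seq (fun i => y i ^+ n) | n <- a].

(* [compositions n] lists, with multiplicity, the block sizes of the partitions
   of {1, ..., n}: the element n.+1 joins an existing block or forms a new one. *)
Fixpoint enlargements a : seq (seq nat) :=
  if a is n :: a' then (n.+1 :: a') :: [seq n :: b | b <- enlargements a']
  else [:: [:: 1%N]].

Fixpoint compositions n : seq (seq nat) :=
  if n is n'.+1 then flatten [seq enlargements a | a <- compositions n']
  else [:: [::]].

(** The index of the extra factor either coincides with one already chosen, which raises that
    exponent by one, or is new, which adds a block of size 1. *)
Lemma injsumM y a A : (\sum_(i in A) y i) * injsum (powers y a) A =
  \sum_(b <- enlargements a) injsum (powers y b) A.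
Proof.
elim: a A => [|n a IH] A.
  rewrite /= big_seq1 /= mulr1; apply: eq_bigr => i _; by rewrite expr1 mulr1.
rewrite /= big_cons big_map /= big_distrr /=.
rewrite exchange_big -big_split /=; apply: eq_bigr => i iA.
rewrite (big_setD1 i iA) /= -big_distrr -IH /= exprS; ring.
Qed.

Lemma expr_injsum y n A :
  (\sum_(i in A) y i) ^+ n = \sum_(a <- compositions n) injsum (powers y a) A.
Proof.
elim: n => [|n IH]; first by rewrite expr0 big_seq1.
rewrite exprS IH big_distrr /= big_flatten big_map; apply: eq_bigr => a _.
exact: injsumM.
Qed.

(** A tuple of distinct indices uses [i] at most once, and then in one of [r.+1] positions. *)
Lemma injsum_nseqD1 f r i A : i \in A ->
  injsum (nseq r.+1 f) A = injsum (nseq r.+1 f) (A :\ i)%SET +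
    r.+1%:R * (f i * injsum (nseq r f) (A :\ i)%SET).
Proof.
elim: r A => [|r IH] A iA.
  by rewrite /= mul1r (big_setD1 i iA) /= addrC !mulr1.
rewrite [LHS]injsum_cons (big_setD1 i iA) [in RHS]injsum_cons.
under [X in _ + X = _]eq_bigr => j jA.
  rewrite IH; last by move: jA; rewrite !inE iA andbT eq_sym => /andP[].
  rewrite finset.setDDl finset.setUC -finset.setDDl mulrDr.
  rewrite [X in _ + X](_ : _ = r.+1%:R * f i *
    (f j * injsum (nseq r f) (A :\ i :\ j)%SET)); last by ring.
  over.
rewrite big_split /= -big_distrr /= -[r.+2%:R]natr1.
by ring.
Qed.

(** A tuple of [size s] distinct elements of [A] lies in 2 ^ (#|A| - size s) subsets of [A]. The
    powers are multiplied out because the ring has no division. *)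
Lemma injsum_powerset s A :
  2 ^+ size s * \sum_(B in powerset A) injsum s B = 2 ^+ #|A| * injsum s A.
Proof.
elim: s A => [|f s IH] A.
  by rewrite /= mul1r sumr_const card_powerset mulr1 natrX.
rewrite /= (exchange_big_dep (fun i => i \in A)) /=; last first.
  by move=> B i; rewrite powersetE => /fintype.subsetP; apply.
rewrite !big_distrr /=; apply: eq_bigr => i iA.
rewrite -big_distrr /=.
have -> : \sum_(B in powerset A | i \in B) injsum s (B :\ i)%SET =
          \sum_(B in powerset (A :\ i)%SET) injsum s B.
  rewrite (reindex_onto (fun B => i |: B)%SET (fun B => B :\ i)%SET) /=; last first.
    by move=> B /andP[_ iB]; rewrite finset.setD1K.
  apply: eq_big => [B|B /andP[_ /eqP->]//].
  rewrite !powersetE !inE eqxx /= andbT finset.subUset finset.sub1set iA /=.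
  rewrite finset.subsetD1; congr (_ && _); apply/eqP/idP => [<-|iB].
    by rewrite !inE eqxx.
  by rewrite finset.setU1K.
by rewrite mulrCA [RHS]mulrCA (cardsD1 i A) iA add1n !exprS -!mulrA IH.
Qed.

(** Requiring the first index in [B] and the others outside fixes the side of [(size s).+1] elements
    and leaves the rest of [A] free. So, up to a factor independent of [A], a sum over distinct
    tuples is an average of sums whose first index and remaining indices range over disjoint
    sets. *)
Lemma injsum_decouple f s A :
  2 ^+ (size s).+1 *
    \sum_(B in powerset A) \sum_(i in B) f i * injsum s (A :\: B)%SET =
  2 ^+ #|A| * injsum (f :: s) A.
Proof.
rewrite (exchange_big_dep (fun i => i \in A)) /=; last first.
  by move=> B i; rewrite powersetE => /fintype.subsetP; apply.
rewrite !big_distrr /=; apply: eq_bigr => i iA.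
rewrite -big_distrr /=.
have -> : \sum_(B in powerset A | i \in B) injsum s (A :\: B)%SET =
          \sum_(B in powerset (A :\ i)%SET) injsum s B.
  rewrite (reindex_onto (fun B => A :\: B)%SET (fun B => A :\: B)%SET) /=; last first.
    move=> B /andP[]; rewrite powersetE => /finset.setIidPr BA _.
    by rewrite finset.setDDr finset.setDv finset.set0U.
  apply: eq_big => [B|B /andP[_ /eqP->]//].
  rewrite !powersetE finset.subsetDl !inE iA andbT /= finset.subsetD1 andbC.
  congr (_ && _).
  rewrite finset.setDDr finset.setDv finset.set0U; apply/eqP/idP => [<-|].
    exact: finset.subsetIl.
  by move/finset.setIidPr.
by rewrite mulrCA [RHS]mulrCA (cardsD1 i A) iA add1n !exprS -!mulrA injsum_powerset.
Qed.

End InjSum.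

Lemma enlargements_sum a b : b \in enlargements a -> sumn b = (sumn a).+1.
Proof.
elim: a b => [|n a IH] b /=; first by rewrite inE => /eqP->.
rewrite inE => /orP[/eqP->//|/mapP[c /IH cE ->]] /=.
by rewrite cE addnS.
Qed.

Lemma enlargements_gt0 a b : b \in enlargements a ->
  all (leq 1) a -> all (leq 1) b.
Proof.
elim: a b => [|n a IH] b /=; first by rewrite inE => /eqP->.
rewrite inE => /orP[/eqP->/= /andP[]//|/mapP[c /IH cE ->]] /= /andP[->].
exact: cE.
Qed.

Lemma compositionsP n a : a \in compositions n ->
  sumn a = n /\ all (leq 1) a.
Proof.
elim: n a => [|n IH] a /=; first by rewrite inE => /eqP->.
move=> /flatten_mapP[b /IH[<- b1] ba]; split.
  exact: enlargements_sum.
exact: enlargements_gt0 ba b1.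
Qed.

(** * Independence and bounds in L^q *)

Section Independence.
Context d (T : measurableType d) (R : realType) (P : probability T R).

Definition indep2 (F G : T -> R) := forall A B : set R,
  measurable A -> measurable B ->
  P (F @^-1` A `&` G @^-1` B) = (P (F @^-1` A) * P (G @^-1` B))%E.

Lemma indep2_comp F G (f g : R -> R) :
  measurable_fun setT f -> measurable_fun setT g ->
  indep2 F G -> indep2 (f \o F) (g \o G).
Proof.
move=> mf mg FG A B mA mB; apply: (FG (f @^-1` A) (g @^-1` B)).
- by rewrite -[X in measurable X]setTI; exact: mf.
- by rewrite -[X in measurable X]setTI; exact: mg.
Qed.

Definition pair_mfun (F G : {mfun T >-> R}) : {mfun T >-> (R * R)%type} :=
  mfun_Sub (mem_set (measurable_fun_pair (measurable_funPT F)
    (measurable_funPT G))).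

Lemma product_distribution (F G : {mfun T >-> R}) : indep2 F G ->
  forall A : set (R * R), measurable A ->
  (distribution P F \x distribution P G)%E A =
    distribution P (pair_mfun F G) A.
Proof.
move=> FG; apply: product_measure_unique => A B mA mB.
by rewrite /distribution /pushforward -FG.
Qed.

(** The joint law is the product of the two laws, and Tonelli's theorem factors the integral. *)
Lemma ge0_integralM_indep2 (F G : T -> R) (f g : R -> \bar R) :
  measurable_fun setT F -> measurable_fun setT G -> indep2 F G ->
  measurable_fun setT f -> measurable_fun setT g ->
  (forall x, 0 <= f x)%E -> (forall x, 0 <= g x)%E ->
  (\int[P]_w (f (F w) * g (G w)) =
   \int[P]_w f (F w) * \int[P]_w g (G w))%E.
Proof.
move=> mF mG FG mf mg f0 g0.
pose F' : {mfun T >-> R} := mfun_Sub (mem_set mF).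
pose G' : {mfun T >-> R} := mfun_Sub (mem_set mG).
have FG' : indep2 F' G' by [].
have mfg : measurable_fun setT (fun z : R * R => (f z.1 * g z.2)%E).
  by apply: emeasurable_funM; apply: measurableT_comp.
transitivity (\int[distribution P (pair_mfun F' G')]_z (f z.1 * g z.2))%E.
  by rewrite ge0_integral_distribution// => z; rewrite mule_ge0.
rewrite (eq_measure_integral (distribution P F' \x distribution P G')%E); last first.
  by move=> A mA _; apply/esym/product_distribution.
rewrite fubini_tonelli1//=; last by move=> z; rewrite mule_ge0.
rewrite /fubini_F/=.
under eq_integral do rewrite ge0_integralZl//.
rewrite ge0_integralZr//; last exact: integral_ge0.
by congr (_ * _)%E; rewrite ge0_integral_distribution.
Qed.

Lemma integrableM_indep2 (F G : T -> R) : indep2 F G ->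
  P.-integrable setT (EFin \o F) -> P.-integrable setT (EFin \o G) ->
  P.-integrable setT (EFin \o (fun w => F w * G w)).
Proof.
move=> FG /integrableP[mF iF] /integrableP[mG iG].
have {}mF : measurable_fun setT F by exact/measurable_EFinP.
have {}mG : measurable_fun setT G by exact/measurable_EFinP.
apply/integrableP; split.
  by apply/measurable_EFinP; exact: measurable_funM.
under eq_integral do rewrite /= normrM EFinM.
rewrite (@ge0_integralM_indep2 F G (fun x => `|x|%:E) (fun x => `|x|%:E))//.
- by rewrite lte_mul_pinfty// ?integral_ge0// ge0_fin_numE ?integral_ge0.
- exact/measurable_EFinP.
- exact/measurable_EFinP.
Qed.

Lemma integralM_indep2 (F G : T -> R) : indep2 F G ->
  P.-integrable setT (EFin \o F) -> P.-integrable setT (EFin \o G) ->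
  \int[P]_w (F w * G w) = \int[P]_w F w * \int[P]_w G w.
Proof.
move=> FG iF iG; have iFG := integrableM_indep2 FG iF iG.
have mF : measurable_fun setT F by apply/measurable_EFinP/measurable_int/iF.
have mG : measurable_fun setT G by apply/measurable_EFinP/measurable_int/iG.
pose F' : {mfun T >-> R} := mfun_Sub (mem_set mF).
pose G' : {mfun T >-> R} := mfun_Sub (mem_set mG).
have FG' : indep2 F' G' by [].
have mM : measurable_fun setT (fun z : R * R => (z.1 * z.2)%:E).
  by apply/measurable_EFinP; apply: measurable_funM.
have iM : (distribution P (pair_mfun F' G')).-integrable setT
    (fun z : R * R => (z.1 * z.2)%:E).
  by apply: integrable_pushforward.
have iM' : (distribution P F' \x distribution P G')%E.-integrable setT
    (fun z : R * R => (z.1 * z.2)%:E).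
  apply/integrableP; split=> //; move/integrableP : iM => [_].
  congr (_ < _)%E; apply: eq_measure_integral => A mA _.
  by apply/esym/product_distribution.
have iG' : (distribution P G').-integrable setT (EFin \o id).
  by apply: integrable_pushforward => //; exact/measurable_EFinP.
have iF' : (distribution P F').-integrable setT (EFin \o id).
  by apply: integrable_pushforward => //; exact/measurable_EFinP.
rewrite /Rintegral.
transitivity (fine (\int[distribution P (pair_mfun F' G')]_z (z.1 * z.2)%:E))%E.
  by rewrite integral_distribution.
rewrite (eq_measure_integral (distribution P F' \x distribution P G')%E); last first.
  by move=> A mA _; apply/esym/product_distribution.
rewrite -integral12_prod_meas1// /fubini_F/=.
under eq_integral do (under eq_integral do rewrite EFinM; rewrite integralZl//).
rewrite -[X in fine (\int[_]_x (_ * X))%E]fineK; last exact: integrable_fin_num iG'.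
rewrite (integralZr measurableT iF').
rewrite fineM//; last exact: integrable_fin_num iF'.
congr (fine _ * _).
  by rewrite integral_distribution//; exact: EFin_measurable.
by rewrite /= integral_distribution//; exact: EFin_measurable.
Qed.

Section Family.
Variables (I : finType) (X : I -> T -> R).

(** Events are taken over the whole finite type; a subfamily is reached by putting [setT] at the
    other indices. *)
Definition indep_family := forall A : I -> set R, (forall i, measurable (A i)) ->
  P (\bigcap_i (X i @^-1` A i)) = (\prod_i P (X i @^-1` A i))%E.

(** Intersections, and not only preimages under single variables, so that the class is closed under
    intersection and determines finite measures on the sigma-algebra that it generates. *)
Definition cylinders (J : {set I}) : set (set T) :=
  [set C | exists A : I -> set R, [/\ forall i, measurable (A i),
     forall i, i \notin J -> A i = setT & C = \bigcap_i (X i @^-1` A i)]].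

Variant depends_on (J : {set I}) (F : T -> R) : Prop :=
  DependsOn of measurable_fun setT (F : g_sigma_algebraType (cylinders J) -> R).

Hypothesis mX : forall i, measurable_fun setT (X i).

Lemma measurable_cylinders J : cylinders J `<=` measurable.
Proof.
move=> _ [A [mA _ ->]]; apply: fin_bigcap_measurable => // i _.
by rewrite -[X in measurable X]setTI; exact: mX.
Qed.

Lemma measurable_depends_on J F : depends_on J F -> measurable_fun setT F.
Proof.
move=> [mF] _ B mB; have := mF measurableT B mB; rewrite !setTI.
by apply: smallest_sub; [exact: sigma_algebra_measurable|
  exact: measurable_cylinders].
Qed.

Lemma depends_onX (J : {set I}) i : i \in J -> depends_on J (X i).
Proof.
move=> iJ; split=> _ B mB; apply: sub_sigma_algebra => /=.
exists (fun j => if j == i then B else setT); split => [j|j|].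
- by case: ifP.
- by case: eqP => // ->; rewrite iJ.
- rewrite setTI; apply/seteqP; split => [w Bw j _ /=|w /(_ i Logic.I)/=].
    by case: eqP => // ->.
  by rewrite eqxx.
Qed.

Lemma depends_onW (J K : {set I}) F : J \subset K -> depends_on J F -> depends_on K F.
Proof.
move=> /fintype.subsetP JK [mF]; split=> _ B mB; have := mF measurableT B mB; rewrite !setTI.
apply: sub_sigma_algebra2 => _ [A [mA AJ ->]]; exists A; split => // i iK.
by apply: AJ; apply: contra iK; exact: JK.
Qed.

(** The finite measures sending C to P (C, X i in B) and to P (X i in B) P (C) agree on the
    cylinders over [J], hence on the sigma-algebra that these generate. *)
Lemma depends_on_indep2 (J : {set I}) i F : indep_family ->
  i \notin J -> depends_on J F -> indep2 F (X i).
Proof.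
move=> indX iJ [mF] A B mA mB.
have := mF measurableT A mA; rewrite setTI => sA.
have mB' : measurable (X i @^-1` B).
  by rewrite -[X in measurable X]setTI; exact: mX.
have PB : (0 <= fine (P (X i @^-1` B)))%R by rewrite fine_ge0.
pose m1 := mrestr P mB'.
pose m2 := mscale (NngNum PB) P.
have m1E C : m1 C = P (C `&` X i @^-1` B) by [].
have m2E C : m2 C = (P (X i @^-1` B) * P C)%E.
  by rewrite /m2 /mscale/= fineK ?fin_num_measure.
suff : m1 (F @^-1` A) = m2 (F @^-1` A) by rewrite m1E m2E muleC.
apply: (g_sigma_algebra_measure_unique (cylinders J) _ (fun=> setT)) sA => //.
- exact: measurable_cylinders.
- move=> _; exists (fun=> setT); split => //.
  by apply/seteqP; split.
- by rewrite bigcup_const.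
- move=> _ _ [C [mC CJ ->]] [D [mD DJ ->]].
  exists (fun j => C j `&` D j); split => [j|j jJ|].
  + exact: measurableI.
  + by rewrite CJ// DJ// setTI.
  + rewrite -bigcapI; apply: eq_bigcapr => j _; by rewrite preimage_setI.
- move=> _ [C [mC CJ ->]].
  rewrite [LHS]m1E [RHS]m2E.
  (* As [C i] is [setT], the event that [X i] lies in [B] can be inserted into the cylinder at
     position [i]. *)
  pose C' j := if j == i then B else C j.
  have -> : \bigcap_j (X j @^-1` C j) `&` X i @^-1` B =
            \bigcap_j (X j @^-1` C' j).
    apply/seteqP; split => [w [Cw Bw] j _|w Cw]; rewrite /C'.
      by case: eqP => [->//|_]; exact: Cw.
    split => [j _|]; last by have := Cw i Logic.I; rewrite /C' eqxx.
    by have := Cw j Logic.I; rewrite /C'; case: eqP => // -> _; rewrite /= CJ.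
  rewrite !indX//; last by move=> j; rewrite /C'; case: eqP.
  rewrite (bigD1 i)//= [in RHS](bigD1 i)//= {1}/C' eqxx (CJ i)// preimage_setT.
  rewrite probability_setT mul1e; congr (_ * _)%E.
  by apply: eq_bigr => j /negPf ji; rewrite /C' ji.
- by move=> _; rewrite [ltLHS]m1E ltey_eq fin_num_measure//; apply: measurableI.
Qed.

Lemma depends_on_comp J F (f : R -> R) :
  measurable_fun setT f -> depends_on J F -> depends_on J (f \o F).
Proof. by move=> mf [mF]; split; exact: measurableT_comp. Qed.

Lemma depends_on_cst J r : depends_on J (fun=> r).
Proof. by split; exact: measurable_cst. Qed.

Lemma depends_onD J F G : depends_on J F -> depends_on J G ->
  depends_on J (fun w => F w + G w).
Proof. by move=> [mF] [mG]; split; exact: measurable_funD. Qed.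

Lemma depends_onM J F G : depends_on J F -> depends_on J G ->
  depends_on J (fun w => F w * G w).
Proof. by move=> [mF] [mG]; split; exact: measurable_funM. Qed.

Lemma depends_on_sum J (K : Type) (s : seq K) (p : pred K) (F : K -> T -> R) :
  (forall k, p k -> depends_on J (F k)) ->
  depends_on J (fun w => \sum_(k <- s | p k) F k w).
Proof.
move=> mF; elim: s => [|k s IH].
  have -> : (fun w => \sum_(k <- [::] | p k) F k w) = fun=> 0.
    by apply/funext => w; rewrite big_nil.
  exact: depends_on_cst.
have -> : (fun w => \sum_(j <- k :: s | p j) F j w) =
    if p k then fun w => F k w + \sum_(j <- s | p j) F j w
    else fun w => \sum_(j <- s | p j) F j w.
  by apply/funext => w; rewrite big_cons; case: ifP.
by case: ifPn => // pk; apply: depends_onD => //; exact: mF.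
Qed.

End Family.
End Independence.

Lemma measurable_norm_powR d (T : measurableType d) (R : realType) (F : T -> R)
  (q : R) : measurable_fun setT F -> measurable_fun setT (fun w => `|F w| `^ q).
Proof.
move=> mF; apply: (@measurableT_comp _ _ _ _ _ _ (@powR R ^~ q)) => //.
exact: measurableT_comp.
Qed.

Section LpBound.
Context d (T : measurableType d) (R : realType) (P : probability T R).
Implicit Types (F G : T -> R) (a b q r : R).

(** Measurability and the sign of [b] are bundled, so that bounds pass through sums and products
    without side conditions. *)
Definition Lp_le q F b := [/\ measurable_fun setT F, 0 <= b &
  (\int[P]_w (`|F w| `^ q)%:E <= (b `^ q)%:E)%E].

Lemma Lp_leP q F b : 0 < q -> measurable_fun setT F -> 0 <= b ->
  Lp_le q F b <-> ('N[P]_q%:E[EFin \o F] <= b%:E)%E.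
Proof.
move=> q0 mF b0.
have q0' : q != 0 by rewrite gt_eqF.
rewrite /Lp_le.
have -> : (\int[P]_w (`|F w| `^ q)%:E = 'N[P]_q%:E[EFin \o F] `^ q)%E.
  by rewrite poweR_Lnorm//; apply: eq_integral => w _ /=.
split=> [[_ _]|Fb].
  have := Lnorm_ge0 P q%:E (EFin \o F).
  case: ('N[P]_ _ [_])%E => [x||]//.
    rewrite poweR_EFin !lee_fin => x0.
    rewrite leNgt => xb; rewrite leNgt; apply: contra xb => bx.
    by rewrite gt0_ltr_powR// ?nnegrE.
  by rewrite poweRyr// leye_eq.
split=> //.
have := Lnorm_ge0 P q%:E (EFin \o F); move: Fb.
case: ('N[P]_ _ [_])%E => [x||]//; rewrite poweR_EFin !lee_fin => xb x0.
by rewrite ge0_ler_powR ?nnegrE// ltW.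
Qed.

Lemma Lp_leN q F b : 0 < q -> Lp_le q F b -> ('N[P]_q%:E[EFin \o F] <= b%:E)%E.
Proof. by move=> q0 Fb; have [mF b0 _] := Fb; apply/(Lp_leP q0 mF b0). Qed.

Lemma Lp_leW q F a b : 0 < q -> a <= b -> Lp_le q F a -> Lp_le q F b.
Proof.
move=> q0 ab [mF a0 Fa]; split => //; first exact: le_trans ab.
apply: le_trans Fa _; rewrite lee_fin ge0_ler_powR ?nnegrE//; first exact: ltW.
exact: le_trans ab.
Qed.

Lemma Lp_leD q F G a b : 1 <= q -> Lp_le q F a -> Lp_le q G b ->
  Lp_le q (fun w => F w + G w) (a + b).
Proof.
move=> q1 Fa Gb; have q0 : 0 < q by exact: lt_le_trans q1.
have [mF a0 _] := Fa; have [mG b0 _] := Gb.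
apply/Lp_leP => //; [exact: measurable_funD|exact: addr_ge0|].
apply: (le_trans (minkowski_EFin P mF mG q1)).
by rewrite EFinD leeD//; exact: Lp_leN.
Qed.

Lemma Lp_leZ q F b r : 0 < q -> Lp_le q F b ->
  Lp_le q (fun w => r * F w) (`|r| * b).
Proof.
move=> q0 [mF b0 Fb]; split; [exact: measurable_funM|exact: mulr_ge0|].
under eq_integral do rewrite normrM powRM// EFinM.
rewrite ge0_integralZl//.
- by rewrite powRM// EFinM lee_wpmul2l// lee_fin powR_ge0.
- by apply/measurable_EFinP; exact: measurable_norm_powR.
Qed.

Lemma Lp_le_cst q r : Lp_le q (fun=> r) `|r|.
Proof.
split => //.
by rewrite integral_cst//= probability_setT mule1.
Qed.

Lemma Lp_le_sum q (K : eqType) (s : seq K) (p : pred K) (F : K -> T -> R)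
    (b : K -> R) : 1 <= q ->
  (forall k, k \in s -> p k -> Lp_le q (F k) (b k)) ->
  Lp_le q (fun w => \sum_(k <- s | p k) F k w) (\sum_(k <- s | p k) b k).
Proof.
move=> q1; elim: s => [|k s IH] Fb.
  rewrite big_nil (_ : (fun _ => _) = fun=> 0); last first.
    by apply/funext => w; rewrite big_nil.
  by rewrite -[X in Lp_le _ _ X](@normr0 _ R); exact: Lp_le_cst.
have {}IH : Lp_le q (fun w => \sum_(k <- s | p k) F k w) (\sum_(k <- s | p k) b k).
  by apply: IH => j js; apply: Fb; rewrite inE js orbT.
have -> : (fun w => \sum_(j <- k :: s | p j) F j w) =
    if p k then fun w => F k w + \sum_(j <- s | p j) F j w
    else fun w => \sum_(j <- s | p j) F j w.
  by apply/funext => w; rewrite big_cons; case: ifP.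
rewrite big_cons; case: ifPn => // pk; apply: Lp_leD => //.
by apply: Fb => //; rewrite mem_head.
Qed.

Lemma Lp_leM_indep2 q F G a b : 0 < q -> indep2 P F G ->
  Lp_le q F a -> Lp_le q G b -> Lp_le q (fun w => F w * G w) (a * b).
Proof.
move=> q0 FG [mF a0 Fa] [mG b0 Gb]; split; [exact: measurable_funM|exact: mulr_ge0|].
under eq_integral do rewrite normrM powRM// EFinM.
have mq : measurable_fun setT (fun x : R => (`|x| `^ q)%:E).
  by apply/measurable_EFinP; exact: measurable_norm_powR.
rewrite (@ge0_integralM_indep2 _ _ _ P F G (fun x => (`|x| `^ q)%:E) (fun x => (`|x| `^ q)%:E))//.
by rewrite powRM// EFinM lee_pmul// integral_ge0// => *; rewrite lee_fin powR_ge0.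
Qed.

(** Hoelder's inequality against the constant 1, with exponent r / q and its conjugate, on a space
    of mass 1. *)
Lemma Lp_le_exponent q r F b : 1 <= q -> q <= r -> Lp_le r F b -> Lp_le q F b.
Proof.
move=> q1; rewrite le_eqVlt => /predU1P[->//|qr] [mF b0 Fb].
have q0 : 0 < q by exact: lt_le_trans q1.
have r0 : 0 < r by exact: lt_trans qr.
split => //.
pose u := r / q; pose v := (1 - u^-1)^-1.
have u0 : 0 < u by rewrite divr_gt0.
have v0 : 0 < v.
  by rewrite /v invr_gt0 subr_gt0 invf_lt1// /u ltr_pdivlMr// mul1r.
have uv : u^-1 + v^-1 = 1 by rewrite /v invrK addrC subrK.
have mq : measurable_fun setT (fun w => `|F w| `^ q).
  exact: measurable_norm_powR.
have := @hoelder _ _ _ P (fun w => `|F w| `^ q) (cst 1) u v mq (measurable_cst _) u0 v0 uv.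
rewrite Lnorm1 Lnorm_cst1/= probability_setT poweR1r mule1.
have -> : (\int[P]_w `|(EFin \o ((fun w => `|F w| `^ q) \* cst 1)%R) w| =
          \int[P]_w (`|F w| `^ q)%:E)%E.
  by apply: eq_integral => w _ /=; rewrite mulr1 ger0_norm ?powR_ge0.
move/le_trans; apply.
rewrite -(@Lp_leP u (fun w => `|F w| `^ q) (b `^ q))// ?powR_ge0//.
split => //; first exact: powR_ge0.
have uE : q * u = r by rewrite /u mulrCA mulfV ?mulr1// gt_eqF.
by under eq_integral do rewrite ger0_norm ?powR_ge0// -powRrM uE; rewrite -powRrM uE.
Qed.

Lemma Lp_le1P F b : Lp_le 1 F b ->
  P.-integrable setT (EFin \o F) /\ `|\int[P]_w F w| <= b.
Proof.
move=> [mF b0 Fb].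
have {}Fb : (\int[P]_w `|(F w)%:E| <= b%:E)%E.
  rewrite -(powRr1 b0); apply: le_trans Fb; rewrite le_eqVlt; apply/orP; left.
  by apply/eqP/eq_integral => w _ /=; rewrite powRr1.
have iF : P.-integrable setT (EFin \o F).
  by apply/integrableP; split; [exact/measurable_EFinP|rewrite (le_lt_trans Fb)// ltry].
split => //; rewrite -lee_fin EFin_normr_Rintegral//.
by apply: le_trans Fb; apply: le_abse_integral => //; exact/measurable_EFinP.
Qed.

Lemma Lp_le_integrable q F b : 1 <= q -> Lp_le q F b ->
  P.-integrable setT (EFin \o F).
Proof. by move=> q1 /(Lp_le_exponent (lexx 1) q1)/Lp_le1P[]. Qed.

Lemma Lp_le_mean q F b : 1 <= q -> Lp_le q F b -> `|\int[P]_w F w| <= b.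
Proof. by move=> q1 /(Lp_le_exponent (lexx 1) q1)/Lp_le1P[]. Qed.

Lemma Lp_le2P F b : measurable_fun setT F -> 0 <= b ->
  Lp_le 2 F b <-> (\int[P]_w (F w ^+ 2)%:E <= (b ^+ 2)%:E)%E.
Proof.
move=> mF b0.
rewrite /Lp_le.
have -> : (\int[P]_w (F w ^+ 2)%:E = \int[P]_w (`|F w| `^ 2)%:E)%E.
  by apply: eq_integral => w _; rewrite powR_mulrn// -normrX ger0_norm// sqr_ge0.
by rewrite -powR_mulrn//; split => [[]|Fb].
Qed.

Lemma Lp_le_ex q F : 0 < q -> measurable_fun setT F ->
  (\int[P]_w (`|F w| `^ q)%:E < +oo)%E -> exists b, Lp_le q F b.
Proof.
move=> q0 mF Fq; exists (fine (\int[P]_w (`|F w| `^ q)%:E)%E `^ q^-1).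
have F0 : (0 <= \int[P]_w (`|F w| `^ q)%:E)%E.
  by apply: integral_ge0 => w _; rewrite lee_fin powR_ge0.
split => //; first exact: powR_ge0.
rewrite -powRrM mulVf ?gt_eqF// powRr1 ?fine_ge0// fineK//.
by rewrite ge0_fin_numE.
Qed.

End LpBound.

(** * The inequality of von Bahr and Esseen *)

Section VonBahrEsseen.
Variable R : realType.
Implicit Types a b x y q : R.

(** Up to the factor [q], [sgpow (q - 1)] is the derivative of |x| ^ q. *)
Definition sgpow (r x : R) : R := Num.sg x * `|x| `^ r.

Lemma sgpowN r x : sgpow r (- x) = - sgpow r x.
Proof. by rewrite /sgpow sgrN normrN mulNr. Qed.

Lemma sgpow_ge0E r x : 0 < r -> 0 <= x -> sgpow r x = x `^ r.
Proof.
move=> r0; rewrite le_eqVlt => /predU1P[<-|x0].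
  by rewrite /sgpow sgr0 mul0r powR0// gt_eqF.
by rewrite /sgpow gtr0_sg// mul1r gtr0_norm.
Qed.

Lemma normr_sgpow r x : 0 < r -> `|sgpow r x| = `|x| `^ r.
Proof.
move=> r0; wlog x0 : x / 0 <= x => [h|].
  have [/h//|/ltW] := leP 0 x; rewrite -oppr_ge0 => /h.
  by rewrite sgpowN !normrN.
by rewrite sgpow_ge0E// ger0_norm ?powR_ge0// ger0_norm.
Qed.

(** A share t = x / (x + y) in [0, 1] satisfies t <= t ^ r, and the two shares add up to 1. *)
Lemma powRD_le r x y : 0 < r -> r <= 1 -> 0 <= x -> 0 <= y ->
  (x + y) `^ r <= x `^ r + y `^ r.
Proof.
move=> r0 r1 x0 y0; have [->|xn0] := eqVneq x 0.
  by rewrite add0r lerDr powR_ge0.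
have {xn0}x0' : 0 < x by rewrite lt_neqAle eq_sym xn0.
have [->|yn0] := eqVneq y 0; first by rewrite addr0 lerDl powR_ge0.
have {yn0}y0' : 0 < y by rewrite lt_neqAle eq_sym yn0.
have s0 : 0 < x + y by rewrite addr_gt0.
have H z : 0 < z -> z <= x + y -> z / (x + y) <= z `^ r / (x + y) `^ r.
  move=> z0 zs; rewrite ler_pdivlMr ?powR_gt0//.
  have -> : z `^ r = (z / (x + y)) `^ r * (x + y) `^ r.
    by rewrite -powRM ?divfK ?gt_eqF// ?divr_ge0// ltW.
  rewrite ler_wpM2r ?powR_ge0// ger1_powR// divr_gt0//=.
  by rewrite ler_pdivrMr// mul1r.
have := lerD (H x x0' _) (H y y0' _).
rewrite -!mulrDl divff ?gt_eqF// ler_pdivlMr ?powR_gt0// mul1r; apply.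
  by rewrite lerDl.
by rewrite lerDr.
Qed.

(** For equal signs subadditivity gives the constant 1; for opposite signs |x| and |y| are both at
    most |x - y|, whence the 2. *)
Lemma sgpow_hoelder r x y : 0 < r -> r <= 1 ->
  `|sgpow r x - sgpow r y| <= 2 * `|x - y| `^ r.
Proof.
move=> r0 r1; wlog xy : x y / y <= x => [h|].
  have [/h//|/ltW/h] := leP y x.
  by rewrite distrC [X in _ <= _ * X `^ _]distrC.
wlog x0 : x y xy / 0 <= x => [h|].
  have [x0|/ltW x0] := leP 0 x; first exact: h xy x0.
  have := h (- y) (- x); rewrite lerN2 => /(_ xy); rewrite oppr_ge0.
  move=> /(_ (le_trans xy x0)); rewrite !sgpowN !opprK.
  by rewrite addrC [- y + x]addrC.
have xy0 : 0 <= x - y by rewrite subr_ge0.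
rewrite (ger0_norm xy0).
have [y0|/ltW y0] := leP 0 y.
  rewrite !sgpow_ge0E// ger0_norm; last first.
    by rewrite subr_ge0 ge0_ler_powR ?nnegrE// ltW.
  have := powRD_le r0 r1 xy0 y0; rewrite subrK.
  by have := powR_ge0 (x - y) r; lra.
have -> : sgpow r y = - ((- y) `^ r).
  by rewrite -sgpow_ge0E ?oppr_ge0// sgpowN opprK.
rewrite sgpow_ge0E// opprK ger0_norm ?addr_ge0 ?powR_ge0//.
have H z : 0 <= z -> z <= x - y -> z `^ r <= (x - y) `^ r.
  by move=> z0 zx; rewrite ge0_ler_powR ?nnegrE// ltW.
have := H x x0; have := H (- y); rewrite oppr_ge0 => /(_ y0).
rewrite lerDr lerDl oppr_ge0 x0 y0 => /(_ isT) ? /(_ isT) ?; lra.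
Qed.

(** Convexity of the power without derivatives: Young's inequality for |x| ^ (q - 1) and |y|, with
    exponents q / (q - 1) and q. *)
Lemma powR_tangent q x y : 1 < q ->
  `|x| `^ q + q * sgpow (q - 1) x * (y - x) <= `|y| `^ q.
Proof.
move=> q1; have q0 : 0 < q by exact: lt_trans q1.
have r0 : 0 < q - 1 by rewrite subr_gt0.
have E : sgpow (q - 1) x * x = `|x| `^ q.
  by rewrite /sgpow mulrAC -normrEsg mulr_powRB1.
have le1 : sgpow (q - 1) x * y <= `|x| `^ (q - 1) * `|y|.
  by rewrite (le_trans (ler_norm _))// normrM normr_sgpow.
have conj : (q / (q - 1))^-1 + q^-1 = 1.
  by rewrite invf_div; field; rewrite gt_eqF.
have := @conjugate_powR _ (`|x| `^ (q - 1)) `|y| (q / (q - 1)) q.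
rewrite powR_ge0 normr_ge0 => /(_ isT isT); rewrite divr_gt0// q0.
move=> /(_ isT isT conj).
rewrite -powRrM mulrCA divff ?gt_eqF// mulr1 => le2.
have := le_trans le1 le2; rewrite -(ler_pM2l q0).
rewrite [leRHS]mulrDr mulrBr -[q * _ * x]mulrA E mulrA.
have -> : q * (`|x| `^ q / (q / (q - 1))) = (q - 1) * `|x| `^ q.
  by field; rewrite !gt_eqF.
have -> : q * (`|y| `^ q / q) = `|y| `^ q by rewrite mulrC divfK// gt_eqF.
lra.
Qed.

(** The tangent at [a + b], evaluated at [a], gives the bound with the slope at [a + b]. Passing to
    the slope at [a] costs [q] times the Hoelder constant 2, at most 4. *)
Lemma powR_add_le q a b : 1 < q -> q <= 2 ->
  `|a + b| `^ q <= `|a| `^ q + q * sgpow (q - 1) a * b + 4 * `|b| `^ q.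
Proof.
move=> q1 q2; have q0 : 0 < q by exact: lt_trans q1.
have r0 : 0 < q - 1 by rewrite subr_gt0.
have r1 : q - 1 <= 1 by rewrite lerBlDr.
have := powR_tangent (a + b) a q1; rewrite opprD addNKr mulrN.
have H : q * (sgpow (q - 1) (a + b) - sgpow (q - 1) a) * b <= 4 * `|b| `^ q.
  rewrite (le_trans (ler_norm _))// !normrM (gtr0_norm q0).
  have := sgpow_hoelder (a + b) a r0 r1; rewrite addrAC subrr add0r => h.
  rewrite -[in leRHS](mulr_powRB1 (normr_ge0 b) q0).
  rewrite [leRHS]mulrCA [leRHS]mulrC ler_wpM2r//.
  rewrite (_ : 4 = 2 * 2); last by rewrite -natrM.
  by rewrite -mulrA ler_pM// ltW.
by move: H; rewrite mulrBr mulrBl; lra.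
Qed.

Context d (T : measurableType d) (P : probability T R).

Lemma measurable_sgpow (r : R) : measurable_fun setT (sgpow r).
Proof.
apply: measurable_funM; last exact: measurable_norm_powR.
have -> : @Num.sg R = \1_(`]0, +oo[%classic) \- \1_(`]-oo, 0[%classic).
  apply/funext => x; rewrite /= !indicE !mem_setE !in_itv/= andbT.
  by case: sgrP => _; rewrite ?subrr ?subr0 ?sub0r.
by apply: measurable_funB; exact: measurable_indic.
Qed.

(** After integration of [powR_add_le] the first-order term vanishes, because [E] is centred and
    independent of its coefficient. *)
Lemma von_bahr_esseen_step q (F W E : T -> R) : 1 < q -> q <= 2 ->
  measurable_fun setT F -> measurable_fun setT W -> measurable_fun setT E ->
  (\int[P]_w (`|F w| `^ q)%:E < +oo)%E -> (\int[P]_w (`|W w| `^ q)%:E < +oo)%E ->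
  (\int[P]_w (`|E w| `^ q)%:E < +oo)%E -> \int[P]_w E w = 0 ->
  indep2 P (fun w => sgpow (q - 1) (F w) * W w) E -> indep2 P W E ->
  (\int[P]_w (`|F w + W w * E w| `^ q)%:E <= \int[P]_w (`|F w| `^ q)%:E +
    4%:E * (\int[P]_w (`|W w| `^ q)%:E * \int[P]_w (`|E w| `^ q)%:E))%E.
Proof.
move=> q1 q2 mF mW mE iF iW iE E0 ind1 ind2.
have q0 : 0 < q by exact: lt_trans q1.
have r0 : 0 < q - 1 by rewrite subr_gt0.
have mpow (G : T -> R) : measurable_fun setT G -> measurable_fun setT (fun w => (`|G w| `^ q)%:E).
  by move=> mG; apply/measurable_EFinP; exact: measurable_norm_powR.
have intpow (G : T -> R) : measurable_fun setT G -> (\int[P]_w (`|G w| `^ q)%:E < +oo)%E ->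
    P.-integrable setT (fun w => (`|G w| `^ q)%:E).
  move=> mG iG; apply/integrableP; split; first exact: mpow.
  rewrite (le_lt_trans _ iG)// le_eqVlt; apply/orP; left; apply/eqP.
  by apply: eq_integral => w _; rewrite /= ger0_norm ?powR_ge0.
have mS : measurable_fun setT (fun w => sgpow (q - 1) (F w) * W w).
  apply: measurable_funM => //; apply: (measurableT_comp (measurable_sgpow _)) => //.
(* The product |F| ^ (q - 1) |W| is at most the q-th power of the larger of |F| and |W|. *)
have iS : P.-integrable setT (EFin \o (fun w => sgpow (q - 1) (F w) * W w)).
  apply: (@le_integrable _ _ _ _ _ measurableT _
    (fun w => (`|F w| `^ q)%:E + (`|W w| `^ q)%:E)%E).
  - exact/measurable_EFinP.
  - move=> w _ /=; rewrite lee_fin [leRHS]ger0_norm ?addr_ge0 ?powR_ge0//.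
    rewrite normrM normr_sgpow//.
    have [FW|/ltW FW] := leP `|F w| `|W w|.
      apply: (@le_trans _ _ (`|W w| `^ q)); last by rewrite lerDr powR_ge0.
      rewrite -(mulr_powRB1 (normr_ge0 (W w)) q0) mulrC ler_wpM2l//.
      by rewrite ge0_ler_powR ?nnegrE// ltW.
    apply: (@le_trans _ _ (`|F w| `^ q)); last by rewrite lerDl powR_ge0.
    rewrite -(mulr_powRB1 (normr_ge0 (F w)) q0) mulrC.
    by rewrite ler_wpM2r ?powR_ge0.
  - by apply: integrableD => //; exact: intpow.
have q1' : 1 <= q by exact: ltW.
have iE1 : P.-integrable setT (EFin \o E).
  by have [b] := Lp_le_ex q0 mE iE; exact: Lp_le_integrable.
have iSE := integrableM_indep2 ind1 iS iE1.
have mWE : measurable_fun setT (fun w => W w * E w) by exact: measurable_funM.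
have WE : (\int[P]_w (`|W w * E w| `^ q)%:E =
   \int[P]_w (`|W w| `^ q)%:E * \int[P]_w (`|E w| `^ q)%:E)%E.
  under eq_integral do rewrite normrM powRM// EFinM.
  rewrite (@ge0_integralM_indep2 _ _ _ P W E (fun x => (`|x| `^ q)%:E)
    (fun x => (`|x| `^ q)%:E))//; by apply/measurable_EFinP; exact: measurable_norm_powR.
have iWE : P.-integrable setT (fun w => (`|W w * E w| `^ q)%:E).
  have ge0 (G : T -> R) : (0 <= \int[P]_w (`|G w| `^ q)%:E)%E.
    by apply: integral_ge0 => w _; rewrite lee_fin powR_ge0.
  apply: (intpow (fun w => W w * E w) mWE); rewrite WE.
  apply: (lte_mul_pinfty (ge0 W) _ iE).
  by rewrite ge0_fin_numE; [exact: iW|exact: ge0].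
have iSE' : P.-integrable setT (fun w => (q * (sgpow (q - 1) (F w) * W w * E w))%:E).
  exact: (integrableZl measurableT q iSE).
have i4 : P.-integrable setT (fun w => (4 * `|W w * E w| `^ q)%:E).
  exact: (integrableZl measurableT 4 iWE).
have iF' := intpow F mF iF.
apply: (@le_trans _ _ (\int[P]_w ((`|F w| `^ q)%:E +
   (q * (sgpow (q - 1) (F w) * W w * E w))%:E + (4 * `|W w * E w| `^ q)%:E)))%E.
  have ptw w : `|F w + W w * E w| `^ q <= `|F w| `^ q +
     (q * (sgpow (q - 1) (F w) * W w * E w)) + 4 * `|W w * E w| `^ q.
    by have := powR_add_le (F w) (W w * E w) q1 q2; rewrite !mulrA.
  apply: ge0_le_integral => //.
  - exact: (mpow (fun w => F w + W w * E w) (measurable_funD mF mWE)).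
  - apply: emeasurable_funD; last exact: measurable_int i4.
    apply: emeasurable_funD; first exact: measurable_int iF'.
    exact: measurable_int iSE'.
  - by move=> w _; rewrite -!EFinD lee_fin.
rewrite integralD//; last exact: integrableD.
rewrite integralD//.
have -> : (\int[P]_w (q * (sgpow (q - 1) (F w) * W w * E w))%:E = 0)%E.
  have := integralM_indep2 ind1 iS iE1; rewrite E0 mulr0 => h.
  rewrite -[LHS]fineK; last exact: integrable_fin_num iSE'.
  congr (_%:E); have := RintegralZl q measurableT iSE; rewrite h mulr0.
  exact.
rewrite adde0 leeD2l//.
under eq_integral do rewrite EFinM.
by rewrite ge0_integralZl ?WE//; exact: measurable_int iWE.
Qed.

Section Family.
Variables (I : finType) (X : I -> T -> R) (J : {set I}) (q K : R).
Hypotheses (mX : forall i, measurable_fun setT (X i)) (indX : indep_family P X).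
Hypotheses (q1 : 1 < q) (q2 : q <= 2).
Variables (h : R -> R) (W : I -> T -> R) (v : I -> R).
Hypothesis mh : measurable_fun setT h.
Hypothesis hK : forall i, Lp_le P q (h \o X i) K.
Hypothesis h0 : forall i, \int[P]_w h (X i w) = 0.
Hypothesis WJ : forall i, depends_on X J (W i).
Hypothesis Wv : forall i, Lp_le P q (W i) (v i).

(** The sum over the indices already treated depends on these and on [J] only, so the next [h (X i)]
    is centred and independent of that sum and of its own weight. The constant 4 does not compound,
    since each step keeps the previous integral with factor 1. *)
Lemma von_bahr_esseen (s : seq I) : uniq s -> (forall i, i \in s -> i \notin J) ->
  (\int[P]_w (`|\sum_(i <- s) W i w * h (X i w)| `^ q)%:E <=
     (4 * K `^ q * \sum_(i <- s) v i `^ q)%:E)%E.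
Proof.
have q0 : 0 < q by exact: lt_trans q1.
have dep (s' : seq I) : depends_on X (J :|: [set i in s'])%SET
    (fun w => \sum_(i <- s') W i w * h (X i w)).
  have -> : (fun w => \sum_(i <- s') W i w * h (X i w)) =
     (fun w => \sum_(i <- s' | i \in s') W i w * h (X i w)).
    by apply/funext => w; rewrite big_seq.
  apply: (@depends_on_sum _ _ _ _ _ _ _ s' (fun i => i \in s')
    (fun i w => W i w * h (X i w))) => i is'; apply: depends_onM.
    by apply: depends_onW (WJ i); exact: finset.subsetUl.
  apply: (depends_on_comp mh); apply: depends_onX.
  by rewrite !inE is' orbT.
elim: s => [_ _|i s IH /= /andP[iNs us] sJ].
  rewrite big_nil mulr0; under eq_integral do rewrite big_nil normr0 powR0 ?gt_eqF//.
  by rewrite integral0.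
have {}IH := IH us (fun j js => sJ j (mem_behead (s := i :: s) js)).
set F := fun w => \sum_(i <- s) W i w * h (X i w).
have mF : measurable_fun setT F by exact: measurable_depends_on (dep s).
under eq_integral do rewrite big_cons addrC.
have [mW v0 Wvi] := Wv i.
have [mE K0 EK] := hK i.
have iJs : i \notin (J :|: [set j in s])%SET.
  by rewrite !inE negb_or iNs andbT sJ ?mem_head.
have indi G : depends_on X (J :|: [set j in s])%SET G -> indep2 P G (h \o X i).
  move=> dG; apply: (@indep2_comp _ _ _ P G (X i) id h) => //.
  exact: depends_on_indep2 dG.
have dW : depends_on X (J :|: [set j in s])%SET (W i).
  by apply: depends_onW (WJ i); exact: finset.subsetUl.
apply: (le_trans (von_bahr_esseen_step q1 q2 mF mW mE _ _ _ (h0 i) _ _)).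
- by rewrite (le_lt_trans IH) ?ltry.
- by rewrite (le_lt_trans Wvi) ?ltry.
- by rewrite (le_lt_trans EK) ?ltry.
- apply: indi; apply: depends_onM => //.
  exact: (depends_on_comp (measurable_sgpow _) (dep s)).
- exact: indi.
rewrite big_cons mulrDr (addrC (_ * v i `^ q)) [leRHS]EFinD leeD//.
rewrite -mulrA [leRHS]EFinM lee_pmul2l// mulrC [leRHS]EFinM lee_pmul//.
- by apply: integral_ge0 => *; rewrite lee_fin powR_ge0.
- by apply: integral_ge0 => *; rewrite lee_fin powR_ge0.
Qed.

End Family.
End VonBahrEsseen.

(** * Orthogonality *)

Section Gram.
Context d (T : measurableType d) (R : realType) (P : probability T R).

Lemma integrableM_Lp2 (F G : T -> R) a b : Lp_le P 2 F a -> Lp_le P 2 G b ->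
  P.-integrable setT (EFin \o (fun w => F w * G w)).
Proof.
have int2 (H : T -> R) h : Lp_le P 2 H h -> P.-integrable setT (fun w => (H w ^+ 2)%:E).
  move=> [mH h0 Hh]; apply/integrableP; split.
    by apply/measurable_EFinP; exact: measurable_funX.
  apply: le_lt_trans (ltry (h `^ 2)); apply: le_trans Hh.
  rewrite le_eqVlt; apply/orP; left; apply/eqP; apply: eq_integral => w _.
  by rewrite /= powR_mulrn// normrX.
move=> Fa Gb; have [mF _ _] := Fa; have [mG _ _] := Gb.
apply: (@le_integrable _ _ _ _ _ measurableT _
    (fun w => (F w ^+ 2)%:E + (G w ^+ 2)%:E)%E).
- by apply/measurable_EFinP; exact: measurable_funM.
- move=> w _ /=; rewrite lee_fin [leRHS]ger0_norm ?addr_ge0 ?sqr_ge0//.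
  rewrite normrM -[F w ^+ 2]real_normK ?num_real// -[G w ^+ 2]real_normK ?num_real//.
  by have := sqr_ge0 (`|F w| - `|G w|); have := sqr_ge0 `|F w|; have := sqr_ge0 `|G w|; nra.
- by apply: integrableD => //; [exact: int2 Fa|exact: int2 Gb].
Qed.

Lemma integrable_EFin_sum (K : Type) (s : seq K) (p : pred K) (F : K -> T -> R) :
  (forall k, p k -> P.-integrable setT (EFin \o F k)) ->
  P.-integrable setT (EFin \o (fun w => \sum_(k <- s | p k) F k w)).
Proof.
move=> iF; have := integrable_sum measurableT s iF.
by apply: eq_integrable => // w _ /=; rewrite sumEFin.
Qed.

Lemma Rintegral_sum (K : Type) (s : seq K) (p : pred K) (F : K -> T -> R) :
  (forall k, p k -> P.-integrable setT (EFin \o F k)) ->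
  \int[P]_w (\sum_(k <- s | p k) F k w) = \sum_(k <- s | p k) \int[P]_w F k w.
Proof.
move=> iF; elim: s => [|k s IH].
  rewrite big_nil -[RHS](mul0r (fine (P setT))) -Rintegral_cst//.
  by apply: eq_Rintegral => w _; rewrite big_nil.
rewrite big_cons; case: ifPn => pk.
  rewrite -IH -RintegralD//; last 2 first.
  - exact: iF.
  - exact: integrable_EFin_sum.
  by apply: eq_Rintegral => w _; rewrite big_cons pk.
rewrite -IH; apply: eq_Rintegral => w _; by rewrite big_cons (negbTE pk).
Qed.

(** The Gram matrix replaces the triangle inequality; the bounds [b] serve to make the products
    integrable. *)
Lemma Lp2_gram (K : eqType) (s : seq K) (F : K -> T -> R) (b : K -> R)
    (g : K -> K -> R) :
  (forall k, Lp_le P 2 (F k) (b k)) ->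
  (forall j k, `|\int[P]_w (F j w * F k w)| <= g j k) ->
  Lp_le P 2 (fun w => \sum_(k <- s) F k w)
    (Num.sqrt (\sum_(j <- s) \sum_(k <- s) g j k)).
Proof.
move=> Fb Fg.
have g0 j k : 0 <= g j k by apply: le_trans (Fg j k).
have G0 : 0 <= \sum_(j <- s) \sum_(k <- s) g j k.
  by apply: sumr_ge0 => j _; apply: sumr_ge0 => k _.
have [mS _ _] : Lp_le P 2 (fun w => \sum_(k <- s) F k w) (\sum_(k <- s) b k).
  by apply: Lp_le_sum => [|k _ _]; [rewrite ler1n|exact: Fb].
apply/Lp_le2P => //.
rewrite sqr_sqrtr//.
have iFF j k := integrableM_Lp2 (Fb j) (Fb k).
have E w : (\sum_(k <- s) F k w) ^+ 2 = \sum_(j <- s) \sum_(k <- s) (F j w * F k w).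
  by rewrite expr2 mulr_suml; apply: eq_bigr => j _; rewrite mulr_sumr.
under eq_integral do rewrite E.
have iS j : P.-integrable setT (EFin \o (fun w => \sum_(k <- s) (F j w * F k w))).
  by apply: integrable_EFin_sum => k _; exact: iFF.
have iSS : P.-integrable setT
    (EFin \o (fun w => \sum_(j <- s) \sum_(k <- s) (F j w * F k w))).
  by apply: integrable_EFin_sum => j _; exact: iS.
rewrite -[leLHS]fineK; last exact: integrable_fin_num iSS.
rewrite lee_fin -/(Rintegral P setT _).
rewrite (Rintegral_sum s (p := predT) (fun k _ => iS k)).
apply: ler_sum => j _.
rewrite (Rintegral_sum s (p := predT) (fun k _ => iFF j k)).
apply: ler_sum => k _; exact: le_trans (ler_norm _) (Fg j k).
Qed.

End Gram.

(** * Polynomial chaoses in independent variables *)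

Section Chaos.
Context d (T : measurableType d) (R : realType) (P : probability T R).
Variables (I : finType) (X : I -> T -> R).
Hypotheses (mX : forall i, measurable_fun setT (X i)) (indX : indep_family P X).
Implicit Types (A B : {set I}) (f : nat * (R -> R)) (sl : seq (nat * (R -> R)))
  (c : I -> R).

(* A factor [(a, h)] contributes [c i ^+ a * h (X i)] to each monomial. *)
Definition factor c w f i : R := c i ^+ f.1 * f.2 (X i w).

Definition chaos c sl A w : R := injsum [seq factor c w f | f <- sl] A.

Definition measurable_factors sl := {in sl, forall f, measurable_fun setT f.2}.

Lemma chaos_cons c f sl A w : chaos c (f :: sl) A w =
  \sum_(i in A) factor c w f i * chaos c sl (A :\ i)%SET w.
Proof. by []. Qed.

Lemma chaos_mid c sl1 f sl2 A : chaos c (sl1 ++ f :: sl2) A =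
  chaos c (f :: sl1 ++ sl2) A.
Proof. by apply/funext => w; rewrite /chaos !(map_cat, map_cons) injsum_mid. Qed.

Lemma depends_on_chaos c sl A : measurable_factors sl ->
  depends_on X A (chaos c sl A).
Proof.
elim: sl A => [|f sl IH] A mf; first exact: depends_on_cst.
apply: depends_on_sum => i iA; apply: depends_onM.
  apply: depends_onM; first exact: depends_on_cst.
  apply: depends_on_comp; first by apply: mf; rewrite mem_head.
  exact: depends_onX.
apply: depends_onW (IH _ _); first exact: finset.subsetDl.
by move=> g gsl; apply: mf; rewrite inE gsl orbT.
Qed.

Lemma indep2_comp_depends A i (F : T -> R) (h : R -> R) : i \notin A ->
  measurable_fun setT h -> depends_on X A F -> indep2 P F (h \o X i).
Proof.
move=> iA mh dF; apply: (@indep2_comp _ _ _ P F (X i) id h) => //.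
exact: depends_on_indep2 dF.
Qed.

(** Triangle inequality over the index of the front factor; the norm of each term factors because
    the remaining chaos avoids that index. The bound is uniform in the window only when the
    coefficients raised to [f.1] are summable. *)
Lemma Lp_le_chaos_cons q c f sl (K b : R) : 1 <= q ->
  measurable_factors (f :: sl) ->
  (forall i, Lp_le P q (f.2 \o X i) K) ->
  (forall A, Lp_le P q (chaos c sl A) b) ->
  forall A, Lp_le P q (chaos c (f :: sl) A) (\sum_i `|c i| ^+ f.1 * K * b).
Proof.
move=> q1 mf fK slb A; have q0 : 0 < q by exact: lt_le_trans q1.
have mf1 : measurable_fun setT f.2 by apply: mf; rewrite mem_head.
have mf2 : measurable_factors sl by move=> g gsl; apply: mf; rewrite inE gsl orbT.
have b0 : 0 <= b by have [_] := slb A.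
have H : Lp_le P q (chaos c (f :: sl) A) (\sum_(i in A) `|c i| ^+ f.1 * K * b).
  apply: Lp_le_sum => // i _ iA.
  have -> : (fun w => factor c w f i * chaos c sl (A :\ i)%SET w) =
      (fun w => c i ^+ f.1 * (chaos c sl (A :\ i)%SET w * (f.2 \o X i) w)).
    by apply/funext => w; rewrite /factor /=; ring.
  rewrite -normrX -mulrA [K * b]mulrC; apply: Lp_leZ => //.
  apply: Lp_leM_indep2 => //.
  apply: (@indep2_comp_depends (A :\ i)%SET) => //; first by rewrite !inE eqxx.
  exact: depends_on_chaos.
apply: Lp_leW H => //; rewrite [leRHS](bigID (mem A)) /= lerDl sumr_ge0// => i _.
rewrite -normrX !mulr_ge0//.
by have [_] := fK i.
Qed.

Definition power_factor a : nat * (R -> R) := (a, fun x => x ^+ a).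

Lemma linear_form_expr c s w : (\sum_i c i * X i w) ^+ s =
  \sum_(a <- compositions s) chaos c [seq power_factor n | n <- a] [set: I]%SET w.
Proof.
rewrite -[LHS](_ : (\sum_(i in [set: I]%SET) c i * X i w) ^+ s = _); last first.
  by congr (_ ^+ s); apply: eq_bigl => i; rewrite inE.
rewrite expr_injsum; apply: eq_bigr => a _; congr (injsum _ _).
rewrite /powers -map_comp; apply: eq_map => n; apply/funext => i.
by rewrite /factor /= exprMn.
Qed.

Lemma measurable_power_factors (a : seq nat) :
  measurable_factors [seq power_factor n | n <- a].
Proof. by move=> _ /mapP[n _ ->] /=; exact: measurable_funX. Qed.

Lemma measurable_factors_cat sl1 sl2 : measurable_factors sl1 ->
  measurable_factors sl2 -> measurable_factors (sl1 ++ sl2).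
Proof. by move=> m1 m2 f; rewrite mem_cat => /orP[/m1|/m2]. Qed.

Notation lin := (power_factor 1).

Lemma chaos_linD1 c r A i w : i \in A ->
  chaos c (nseq r.+1 lin) A w = chaos c (nseq r.+1 lin) (A :\ i)%SET w +
    r.+1%:R * (c i * X i w * chaos c (nseq r lin) (A :\ i)%SET w).
Proof.
move=> iA; rewrite /chaos !map_nseq (injsum_nseqD1 _ _ iA).
by congr (_ + _ * (_ * _)); rewrite /factor /= !expr1.
Qed.

Lemma measurable_lin r : measurable_factors (nseq r lin).
Proof. by move=> f /nseqP[-> _] /=; exact: measurable_funX. Qed.

Variable v : R.
Hypotheses (X0 : forall i, \int[P]_w X i w = 0) (Xv : forall i, Lp_le P 2 (X i) v).

(** This bound may grow with the window; it only makes products integrable. The uniform bound comes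
    from [chaos_lin_inner]. *)
Lemma Lp2_lin_ex c r : exists b, forall A, Lp_le P 2 (chaos c (nseq r lin) A) b.
Proof.
have one_le2 : (1 : R) <= 2 by rewrite ler1n.
elim: r => [|r [b IH]]; first by exists `|1| => ?; exact: Lp_le_cst.
eexists => B; apply: (Lp_le_chaos_cons one_le2 _ _ IH).
  exact: (@measurable_lin r.+1).
by move=> i; have -> : (lin.2 \o X i) = X i; [apply/funext => w /=; rewrite expr1|exact: Xv].
Qed.

(* Only monomials on the same index set are correlated. *)
Lemma chaos_lin_inner c c' r A B :
  `|\int[P]_w (chaos c (nseq r lin) A w * chaos c' (nseq r lin) B w)| <=
  r`!%:R * (v ^+ 2 * \sum_i `|c i * c' i|) ^+ r.
Proof.
elim: r A B => [|r IH] A B.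
  have -> : \int[P]_w (chaos c (nseq 0 lin) A w * chaos c' (nseq 0 lin) B w) =
      \int[P]_w (1 : R) by apply: eq_Rintegral => w _; rewrite /chaos /= mulr1.
  by rewrite Rintegral_cst// mul1r /= probability_setT/= normr1 expr0 fact0 mulr1.
set S := \sum_i _ in IH *.
have intUU k l D E : P.-integrable setT (EFin \o
    (fun w => chaos c (nseq k lin) D w * chaos c' (nseq l lin) E w)).
  have [b /(_ D) Hb] := Lp2_lin_ex c k; have [b' /(_ E) Hb'] := Lp2_lin_ex c' l.
  exact: integrableM_Lp2 Hb Hb'.
have iX i : P.-integrable setT (EFin \o X i).
  by apply: (@Lp_le_integrable _ _ _ P 2 _ v) => //; rewrite ler1n.
have iX2 i : P.-integrable setT (EFin \o (fun w => X i w ^+ 2)).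
  by under [X in _ \o X]funext do rewrite expr2; exact: integrableM_Lp2 (Xv i) (Xv i).
have X2 i : `|\int[P]_w (X i w ^+ 2)| <= v ^+ 2.
  have [mXi v0 _] := Xv i; have /(Lp_le2P P mXi v0) := Xv i.
  rewrite -[leLHS]fineK ?lee_fin; last exact: integrable_fin_num (iX2 i).
  by rewrite ger0_norm// Rintegral_ge0// => w _; exact: sqr_ge0.
have dU k (D : {set I}) i : depends_on X (D :\ i)%SET (chaos c (nseq k lin) (D :\ i)%SET).
  by apply: depends_on_chaos; exact: measurable_lin.
have dU' k (D : {set I}) i : depends_on X (D :\ i)%SET (chaos c' (nseq k lin) (D :\ i)%SET).
  by apply: depends_on_chaos; exact: measurable_lin.
have dUU k l i : depends_on X [set~ i]%SET (fun w =>
    chaos c (nseq k lin) (A :\ i)%SET w * chaos c' (nseq l lin) (B :\ i)%SET w).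
  by apply: depends_onM; [apply: depends_onW (dU k A i)|apply: depends_onW (dU' l B i)];
     apply/fintype.subsetP => j; rewrite !inE => /andP[].
have ind k l i (h : R -> R) : measurable_fun setT h -> indep2 P (fun w =>
    chaos c (nseq k lin) (A :\ i)%SET w * chaos c' (nseq l lin) (B :\ i)%SET w) (h \o X i).
  by move=> mh; apply: indep2_comp_depends mh (dUU k l i); rewrite !inE eqxx.
(* Either no index of the second chaos equals [i], and the lone centred factor [X i] in [Q] kills
   the integral, or exactly one does, which gives [X i ^+ 2] in [Q']. The [r.+1] positions of that
   index build up the factorial. *)
pose Q i w := c i * (chaos c (nseq r lin) (A :\ i)%SET w *
   chaos c' (nseq r.+1 lin) (B :\ i)%SET w * X i w).
pose Q' i w := (i \in B)%:R * (r.+1%:R * (c i * c' i)) *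
  (chaos c (nseq r lin) (A :\ i)%SET w *
   chaos c' (nseq r lin) (B :\ i)%SET w * X i w ^+ 2).
have E w : chaos c (nseq r.+1 lin) A w * chaos c' (nseq r.+1 lin) B w =
    \sum_(i in A) (Q i w + Q' i w).
  rewrite {1}/nseq -/(nseq r lin) chaos_cons big_distrl /=; apply: eq_bigr => i iA.
  rewrite /Q /Q' /factor /= !expr1; have [iB|iB] := boolP (i \in B).
    by rewrite (chaos_linD1 _ _ _ iB) mulr1n; ring.
  have -> : (B :\ i)%SET = B by apply/finset.setDidPl; rewrite disjoint_sym disjoints1.
  by rewrite mulr0n; ring.
have intQ0 i : P.-integrable setT (EFin \o (fun w => chaos c (nseq r lin) (A :\ i)%SET w *
   chaos c' (nseq r.+1 lin) (B :\ i)%SET w * X i w)).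
  by apply: integrableM_indep2 => //; exact: (ind r r.+1 i id).
have intQ0' i : P.-integrable setT (EFin \o (fun w => chaos c (nseq r lin) (A :\ i)%SET w *
   chaos c' (nseq r lin) (B :\ i)%SET w * X i w ^+ 2)).
  by apply: integrableM_indep2 => //; exact: (ind r r i (fun x => x ^+ 2)).
have intQ i : P.-integrable setT (EFin \o Q i).
  exact: (integrableZl measurableT (c i) (intQ0 i)).
have intQ' i : P.-integrable setT (EFin \o Q' i).
  exact: (integrableZl measurableT _ (intQ0' i)).
under eq_Rintegral do rewrite E.
rewrite Rintegral_sum; last first.
  by move=> i iA; exact: (integrableD measurableT (intQ i) (intQ' i)).
have bQ i : `|\int[P]_w (Q i w + Q' i w)| <=
    `|c i * c' i| * (r.+1%:R * v ^+ 2 * (r`!%:R * (v ^+ 2 * S) ^+ r)).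
  rewrite RintegralD// RintegralZl// integralM_indep2//; last exact: (ind r r.+1 i id).
  rewrite X0 !mulr0 add0r RintegralZl// integralM_indep2//; last first.
    exact: (ind r r i (fun x => x ^+ 2)).
  rewrite !normrM normr_nat -normrM.
  apply: (@le_trans _ _ (1 * (r.+1%:R * `|c i * c' i|) * (r`!%:R * (v ^+ 2 * S) ^+ r * v ^+ 2))).
    by rewrite !ler_pM// ?mulr_ge0// ?normr_nat; case: (i \in B).
  by rewrite le_eqVlt; apply/orP; left; apply/eqP; ring.
apply: (le_trans (ler_norm_sum _ _ _)).
apply: (@le_trans _ _ (\sum_(i in A) `|c i * c' i| * (r.+1%:R * v ^+ 2 * (r`!%:R * (v ^+ 2 * S) ^+ r)))).
  by apply: ler_sum => i _.
rewrite -big_distrl /=.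
have SS : \sum_(i in A) `|c i * c' i| <= S by rewrite /S [leRHS](bigID (mem A)) /= lerDl sumr_ge0.
have v20 : 0 <= v ^+ 2 by exact: sqr_ge0.
have S0 : 0 <= S by exact: sumr_ge0.
rewrite factS natrM [leRHS](_ : _ =
    S * (r.+1%:R * v ^+ 2 * (r`!%:R * (v ^+ 2 * S) ^+ r))); last by rewrite exprS; ring.
rewrite ler_wpM2r//; apply: mulr_ge0; first exact: mulr_ge0.
by apply: mulr_ge0 => //; apply: exprn_ge0; exact: mulr_ge0.
Qed.

End Chaos.

(** * Powers of linear forms in independent variables *)

Section Core.
Context d (T : measurableType d) (R : realType) (P : probability T R).
Variables (q K v C0 : R) (m : nat -> R) (s : nat).
Hypotheses (q1 : 1 < q) (q2 : q <= 2) (K0 : 0 <= K) (C00 : 0 <= C0).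

Definition admissible_block a := (2 <= a <= s)%N.

Hypothesis mK : forall a, admissible_block a -> `|m a| <= K.

(** The array [c] is indexed by time and by innovation, with squares summable in both directions.
    [K], [v] and [C0] are fixed before the index type, and later each constant [C] is chosen before
    [I], [X] and [c]: this is the uniformity in the window. *)
Record admissible (I : finType) (X : I -> T -> R) (c : nat -> I -> R) : Prop :=
  Admissible {
    adm_measurable : forall i, measurable_fun setT (X i);
    adm_indep : indep_family P X;
    adm_mean0 : forall i, \int[P]_w X i w = 0;
    adm_Lp2 : forall i, Lp_le P 2 (X i) v;
    adm_Lp : forall i a, admissible_block a -> Lp_le P q (fun w => X i w ^+ a) K;
    adm_moment : forall i a, admissible_block a -> \int[P]_w (X i w ^+ a) = m a;
    adm_row : forall k, \sum_i c k i ^+ 2 <= C0;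
    adm_col : forall i n0 n1, \sum_(n0 <= k < n1) c k i ^+ 2 <= C0 }.

Definition centered_factor a : nat * (R -> R) := (a, fun x => x ^+ a - m a).
Definition mean_factor a : nat * (R -> R) := (a, fun=> m a).

Let G := (1 + C0) ^+ s.
Let q0 : 0 < q. Proof. exact: lt_trans q1. Qed.
Let q1' : 1 <= q. Proof. exact: ltW. Qed.
Let G0 : 0 <= G. Proof. by rewrite exprn_ge0// addr_ge0. Qed.

(** Each |c i| is at most 1 + C0, which bounds [a - 2] of the [a] factors; [G] serves all block
    sizes up to [s]. *)
Lemma adm_coef_le (I : finType) (c : I -> R) i a : \sum_i c i ^+ 2 <= C0 ->
  admissible_block a -> `|c i| ^+ a <= G * c i ^+ 2.
Proof.
move=> cC /andP[a2 sa]; have ci : c i ^+ 2 <= C0.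
  by apply: le_trans cC; rewrite (bigD1 i)//= lerDl sumr_ge0// => j _; exact: sqr_ge0.
rewrite -(subnK a2) exprD real_normK ?num_real// ler_wpM2r ?sqr_ge0//.
have c1 : `|c i| <= 1 + C0.
  rewrite -real_normK ?num_real// in ci.
  by have := normr_ge0 (c i); have := sqr_ge0 (`|c i| - 1); nra.
apply: (@le_trans _ _ ((1 + C0) ^+ (a - 2))); first by rewrite lerXn2r ?nnegrE// addr_ge0.
by rewrite /G ler_weXn2l ?lerDl// (leq_trans (leq_subr _ _)).
Qed.

Lemma adm_coef_sum_le (I : finType) (c : I -> R) a : \sum_i c i ^+ 2 <= C0 ->
  admissible_block a -> \sum_i `|c i| ^+ a <= G * C0.
Proof.
move=> cC ab; apply: (@le_trans _ _ (\sum_i G * c i ^+ 2)).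
  by apply: ler_sum => i _; exact: adm_coef_le.
by rewrite -mulr_sumr ler_wpM2l.
Qed.

Notation lin := (power_factor R 1).
Notation rho c j k := (\sum_i `|c j i * c k i|).

Lemma measurable_mean_factors ms : measurable_factors [seq mean_factor a | a <- ms].
Proof. by move=> _ /mapP[a _ ->]; exact: measurable_cst. Qed.

Lemma Lp2_mean_lin_ex (I : finType) (X : I -> T -> R) (c : nat -> I -> R) k ms r :
  admissible X c -> exists b, forall A,
    Lp_le P 2 (chaos X (c k) ([seq mean_factor a | a <- ms] ++ nseq r lin) A) b.
Proof.
move=> [mX iX X0 Xv _ _ _ _].
elim: ms => [|a ms [b Hb]]; first exact: Lp2_lin_ex.
eexists => A; apply: (Lp_le_chaos_cons mX iX _ _ (K := `|m a|) _ Hb).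
- by rewrite ler1n.
- apply: (@measurable_factors_cat _ (_ :: _)); last exact: measurable_lin.
  by move=> f; rewrite inE => /orP[/eqP->/=|/measurable_mean_factors].
- by move=> i; exact: Lp_le_cst.
Qed.

(** A mean block is deterministic but still removes its index from those left to the linear factors;
    hence a bound for arbitrary [A] and [B]. Each block costs G * C0 * K once in each of the two
    chaoses, whence the doubled exponent. *)
Lemma chaos_mean_lin_inner ms r : all admissible_block ms ->
  forall I X c, @admissible I X c -> forall j k A B,
  let sl := [seq mean_factor a | a <- ms] ++ nseq r lin in
  `|\int[P]_w (chaos X (c j) sl A w * chaos X (c k) sl B w)| <=
  (G * C0 * K) ^+ (size ms).*2 * (r`!%:R * (v ^+ 2) ^+ r) * rho c j k ^+ r.
Proof.
move=> msP I X c adm j k; have [mX iX X0 Xv _ _ row _] := adm.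
elim: ms msP => [_|a ms IH /= /andP[aP msP]] A B.
  by rewrite /= expr0 mul1r -mulrA -exprMn; exact: chaos_lin_inner.
have {}IH A' B' := IH msP A' B'; move: IH.
set sl := _ ++ _; set b := (G * C0 * K) ^+ (size ms).*2 *
  (r`!%:R * (v ^+ 2) ^+ r) * rho c j k ^+ r => /= IH.
rewrite [X in _ <= X](_ : _ = (G * C0 * K) * ((G * C0 * K) * b)); last first.
  by rewrite /b doubleS (exprS _ (size ms).*2.+1) (exprS _ (size ms).*2) -!mulrA.
have GC : 0 <= G * C0 * K by rewrite !mulr_ge0.
have iSS A' B' : P.-integrable setT
    (EFin \o (fun w => chaos X (c j) sl A' w * chaos X (c k) sl B' w)).
  have [f /(_ A') Hf] := Lp2_mean_lin_ex j ms r adm.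
  have [g /(_ B') Hg] := Lp2_mean_lin_ex k ms r adm.
  exact: integrableM_Lp2 Hf Hg.
have coef k' A' : \sum_(i in A') `|c k' i ^+ a * m a| <= G * C0 * K.
  under eq_bigr do rewrite normrM normrX; rewrite -mulr_suml.
  have ge0 (i : I) : 0 <= `|c k' i| ^+ a by exact: exprn_ge0.
  apply: ler_pM => //; [exact: sumr_ge0| |exact: mK].
  apply: le_trans (adm_coef_sum_le (row k') aP).
  by rewrite [leRHS](bigID (mem A')) /= lerDl sumr_ge0.
pose Q i i' w := (c j i ^+ a * m a) * (c k i' ^+ a * m a) *
  (chaos X (c j) sl (A :\ i)%SET w * chaos X (c k) sl (B :\ i')%SET w).
have E w : chaos X (c j) (mean_factor a :: sl) A w *
    chaos X (c k) (mean_factor a :: sl) B w = \sum_(i in A) \sum_(i' in B) Q i i' w.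
  rewrite !chaos_cons mulr_suml; apply: eq_bigr => i iA.
  rewrite mulr_sumr; apply: eq_bigr => i' iB.
  by rewrite /Q /factor /=; ring.
have iQ i i' : P.-integrable setT (EFin \o Q i i').
  exact: (integrableZl measurableT _ (iSS _ _)).
under eq_Rintegral do rewrite E.
rewrite Rintegral_sum; last first.
  by move=> i iA; apply: integrable_EFin_sum => i' _; exact: iQ.
apply: (le_trans (ler_norm_sum _ _ _)).
apply: (@le_trans _ _ (\sum_(i in A) `|c j i ^+ a * m a| *
    \sum_(i' in B) `|c k i' ^+ a * m a| * b)).
  apply: ler_sum => i iA; rewrite Rintegral_sum//.
  apply: (le_trans (ler_norm_sum _ _ _)); rewrite mulr_sumr.
  apply: ler_sum => i' _; rewrite RintegralZl// 2!normrM -mulrA.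
  by rewrite !ler_wpM2l.
have b0 : 0 <= b by apply: le_trans (IH A B).
rewrite -!mulr_suml; apply: ler_pM; [exact: sumr_ge0| |exact: coef|].
  by apply: mulr_ge0 => //; exact: sumr_ge0.
by apply: ler_wpM2r => //; exact: coef.
Qed.

Lemma rho_ge0 (I : finType) (c : nat -> I -> R) j k : 0 <= rho c j k.
Proof. by rewrite sumr_ge0. Qed.

Lemma rho_le (I : finType) (c : nat -> I -> R) j k :
  (forall k, \sum_i c k i ^+ 2 <= C0) -> rho c j k <= C0.
Proof.
move=> row; have := lerD (row j) (row k); rewrite -big_split /= => h.
have : \sum_i 2 * `|c j i * c k i| <= C0 + C0.
  apply: le_trans h; apply: ler_sum => i _; rewrite normrM.
  rewrite -[c j i ^+ 2]real_normK ?num_real// -[c k i ^+ 2]real_normK ?num_real//.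
  by have := sqr_ge0 (`|c j i| - `|c k i|); nra.
by rewrite -mulr_sumr; lra.
Qed.

Lemma Lp_le_mean_lin ms r : all admissible_block ms ->
  exists2 C, 0 <= C & forall I X c, @admissible I X c -> forall (ks : seq nat) A,
  Lp_le P 2 (fun w => \sum_(k <- ks) chaos X (c k)
      ([seq mean_factor a | a <- ms] ++ nseq r lin) A w)
    (C * Num.sqrt (\sum_(j <- ks) \sum_(k <- ks) rho c j k ^+ r)).
Proof.
move=> msP; set D := (G * C0 * K) ^+ (size ms).*2 * (r`!%:R * (v ^+ 2) ^+ r).
have D0 : 0 <= D by rewrite !mulr_ge0// exprn_ge0// ?sqr_ge0// !mulr_ge0.
exists (Num.sqrt D) => // I X c adm ks A.
have [mX iX X0 Xv _ _ row _] := adm.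
rewrite -sqrtrM// mulr_sumr.
under eq_bigr do rewrite mulr_sumr.
have [b Hb] : exists b, forall k, Lp_le P 2 (chaos X (c k)
      ([seq mean_factor a | a <- ms] ++ nseq r lin) A) (b k).
  suff H k : {b | Lp_le P 2 (chaos X (c k) ([seq mean_factor a | a <- ms] ++ nseq r lin) A) b}.
    by exists (fun k => sval (H k)) => k; exact: svalP (H k).
  by apply: cid; have [b /(_ A)] := Lp2_mean_lin_ex k ms r adm; exists b.
apply: Lp2_gram Hb _ => j k.
exact: chaos_mean_lin_inner.
Qed.

(* The [L^2] norm of the linear factors is finite by orthogonality; the others
   have absolutely summable coefficients. *)
Lemma Lp_le_chaos_ex ms r b : all admissible_block ms ->
  all (fun a => (0 < a <= s)%N) b ->
  exists2 C, 0 <= C & forall I X c, @admissible I X c -> forall k A,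
    Lp_le P q (chaos X (c k) ([seq mean_factor a | a <- ms] ++ nseq r lin ++
      [seq power_factor R a | a <- b]) A) C.
Proof.
move=> msP; elim: b r => [r _|a b IH r /= /andP[aP bP]].
  have [C C_ge0 HC] := Lp_le_mean_lin r msP.
  (* For a single time the Gram sum reduces to [rho c k k ^+ r], at most C0 ^ r. *)
  exists (C * Num.sqrt (C0 ^+ r)); first by rewrite mulr_ge0.
  move=> I X c adm k A; have := HC I X c adm [:: k] A.
  rewrite !big_seq1 cats0; under [X in Lp_le _ _ X]funext do rewrite big_seq1.
  move/(Lp_le_exponent q1' q2); apply: Lp_leW => //.
  rewrite ler_wpM2l// ler_wsqrtr// lerXn2r// ?nnegrE ?rho_ge0//.
  by apply: rho_le; case: adm.
have [a1|a1] := eqVneq a 1%N.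
  have [C C_ge0 HC] := IH r.+1 bP; exists C; first exact: C_ge0.
  move=> I X c adm k A.
  have -> l : nseq r lin ++ power_factor R a :: l = nseq r.+1 lin ++ l.
    by rewrite a1; elim: (r) => //= n ->.
  exact: HC.
have ab : admissible_block a.
  by move: aP a1; rewrite /admissible_block; case: (a) => [|[|]].
have [C C_ge0 HC] := IH r bP; exists (G * C0 * (K * C)); first by rewrite !mulr_ge0.
move=> I X c adm k A; have [mX iX X0 Xv XK _ row _] := adm.
rewrite catA chaos_mid -catA.
have mf : measurable_factors (power_factor R a :: [seq mean_factor a | a <- ms] ++ nseq r lin ++
      [seq power_factor R a | a <- b]).
  apply: (@measurable_factors_cat _ [:: _]).
    by move=> f; rewrite inE => /eqP->; exact: measurable_funX.
  apply: measurable_factors_cat; first exact: measurable_mean_factors.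
  apply: measurable_factors_cat; first exact: measurable_lin.
  exact: measurable_power_factors.
have := Lp_le_chaos_cons mX iX q1' mf (fun i => XK i a ab) (HC I X c adm k) A.
apply: Lp_leW => //; under eq_bigr do rewrite -mulrA.
by rewrite -mulr_suml ler_wpM2r ?mulr_ge0// adm_coef_sum_le.
Qed.

(** For fixed [B] the centred factor takes its index in [B] and the others theirs in [A :\: B].
    Summing over time first gives weights that depend on [A :\: B] only, so [von_bahr_esseen]
    applies. Averaging over [B] costs only 2 ^ (size rest).+1. *)
Lemma Lp_le_centered_ex a ms r b : admissible_block a -> all admissible_block ms ->
  all (fun a => (0 < a <= s)%N) b ->
  exists2 C, 0 <= C & forall I X c, @admissible I X c -> forall n0 n1 A,
    Lp_le P q (fun w => \sum_(n0 <= k < n1) chaos X (c k)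
        (centered_factor a :: [seq mean_factor a | a <- ms] ++ nseq r lin ++
          [seq power_factor R a | a <- b]) A w)
      (C * (n1 - n0)%:R `^ q^-1).
Proof.
move=> ab msP bP; have [C1 C1_ge0 HC1] := Lp_le_chaos_ex r msP bP.
set rest := [seq mean_factor a | a <- ms] ++ _ in HC1 *.
pose D := G * C0 * C1; have D0 : 0 <= D by rewrite !mulr_ge0.
pose C2 := 4 `^ q^-1 * (K + K) * D.
have C2_ge0 : 0 <= C2 by rewrite !mulr_ge0 ?powR_ge0// addr_ge0.
exists (2 ^+ (size rest).+1 * C2); first by rewrite mulr_ge0// exprn_ge0.
move=> I X c adm n0 n1 A; have [mX iX X0 Xv XK Xm row col] := adm.
set n := (n1 - n0)%N.
have mrest : measurable_factors rest.
  apply: measurable_factors_cat; first exact: measurable_mean_factors.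
  apply: measurable_factors_cat; first exact: measurable_lin.
  exact: measurable_power_factors.
pose h (x : R) := x ^+ a - m a.
have mh : measurable_fun setT h.
  by apply: measurable_funB; [exact: measurable_funX|exact: measurable_cst].
pose W (B : {set I}) i w := \sum_(n0 <= k < n1) c k i ^+ a * chaos X (c k) rest (A :\: B)%SET w.
pose z i := \sum_(n0 <= k < n1) `|c k i| ^+ a * C1.
have hK i : Lp_le P q (h \o X i) (K + K).
  apply: (Lp_leD q1' (XK i a ab)); apply: Lp_leW (Lp_le_cst P q (- m a)) => //.
  by rewrite normrN mK.
have h0 i : \int[P]_w h (X i w) = 0.
  have iXa : P.-integrable setT (EFin \o (fun w => X i w ^+ a)).
    exact: Lp_le_integrable (XK i a ab).
  have im : P.-integrable setT (EFin \o (fun _ : T => m a)).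
    exact: Lp_le_integrable q1' (Lp_le_cst P q (m a)).
  by rewrite RintegralB// Xm// Rintegral_cst//= probability_setT mulr1 subrr.
have WJ B i : depends_on X (A :\: B)%SET (W B i).
  apply: depends_on_sum => k _; apply: depends_onM; first exact: depends_on_cst.
  exact: depends_on_chaos.
have Wz B i : Lp_le P q (W B i) (z i).
  apply: Lp_le_sum => // k _ _; rewrite -normrX; apply: Lp_leZ => //.
  exact: HC1.
have z0 i : 0 <= z i by rewrite sumr_ge0// => k _; rewrite mulr_ge0// exprn_ge0.
(* Column sums bound each weight and row sums bound their total; together they bound the sum of the
   q-th powers linearly in [n]. *)
have zD i : z i <= D.
  rewrite /z -mulr_suml ler_wpM2r//.
  apply: (@le_trans _ _ (\sum_(n0 <= k < n1) G * c k i ^+ 2)).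
    by apply: ler_sum => k _; exact: (adm_coef_le i (row k) ab).
  by rewrite -mulr_sumr ler_wpM2l.
have zn : \sum_i z i <= D * n%:R.
  rewrite exchange_big /=.
  apply: (@le_trans _ _ (\sum_(n0 <= k < n1) D)); last first.
    by rewrite sumr_const_nat mulr_natr.
  by apply: ler_sum => k _; rewrite -mulr_suml ler_wpM2r// adm_coef_sum_le.
have zq (B : {set I}) : \sum_(i <- enum B) z i `^ q <= D `^ q * n%:R.
  rewrite big_enum /=.
  apply: (@le_trans _ _ (\sum_i z i * D `^ (q - 1))).
    rewrite [leRHS](bigID (mem B)) /= ler_wpDr//.
      by rewrite sumr_ge0// => i _; rewrite mulr_ge0// powR_ge0.
    apply: ler_sum => i _; rewrite -(mulr_powRB1 (z0 i) q0) ler_wpM2l//.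
    by rewrite ge0_ler_powR ?nnegrE// subr_ge0.
  rewrite -mulr_suml -(mulr_powRB1 D0 q0) [leRHS]mulrAC.
  by rewrite ler_wpM2r// powR_ge0.
have n0' : 0 <= (n%:R : R) by [].
have QB (B : {set I}) : Lp_le P q (fun w => \sum_(i in B) W B i w * h (X i w))
    (C2 * n%:R `^ q^-1).
  have vbe := @von_bahr_esseen _ _ _ P I X (A :\: B)%SET q (K + K) mX iX q1 q2 h
    (W B) z mh hK h0 (WJ B) (Wz B) (enum B) (enum_uniq _).
  have -> : (fun w => \sum_(i in B) W B i w * h (X i w)) =
      (fun w => \sum_(i <- enum B) W B i w * h (X i w)).
    by apply/funext => w; rewrite big_enum.
  split.
  - apply: measurable_sum => i; apply: measurable_funM.
      exact: (measurable_depends_on mX (WJ B i)).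
    exact: measurableT_comp.
  - by rewrite mulr_ge0// powR_ge0.
  apply: le_trans (vbe _) _; first by move=> i; rewrite mem_enum !inE => ->.
  rewrite lee_fin /C2; do 3 rewrite powRM ?mulr_ge0 ?powR_ge0 ?addr_ge0//.
  rewrite -!powRrM mulVf ?gt_eqF// !powRr1// -!mulrA.
  by rewrite ler_pM2l// ler_wpM2l ?powR_ge0//; exact: zq.
have E w : \sum_(n0 <= k < n1) chaos X (c k) (centered_factor a :: rest) A w =
    (2 ^+ (size rest).+1 / 2 ^+ #|A|) *
    \sum_(B in powerset A) \sum_(i in B) W B i w * h (X i w).
  have two0 : (2 : R) ^+ #|A| != 0 by rewrite expf_neq0.
  apply: (mulfI two0); rewrite [RHS]mulrA [2 ^+ #|A| * (_ / _)]mulrC divfK// mulr_sumr.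
  under eq_bigr do rewrite /chaos map_cons -injsum_decouple size_map.
  rewrite -mulr_sumr exchange_big /=; congr (_ * _); apply: eq_bigr => B _.
  rewrite exchange_big /=; apply: eq_bigr => i _; rewrite mulr_suml.
  by apply: eq_bigr => k _; rewrite /factor /h /chaos /=; ring.
rewrite (_ : (fun w => _) = (fun w => (2 ^+ (size rest).+1 / 2 ^+ #|A|) *
    \sum_(B in powerset A) \sum_(i in B) W B i w * h (X i w))); last first.
  by apply/funext => w; exact: E.
have := Lp_leZ (2 ^+ (size rest).+1 / 2 ^+ #|A|) q0
  (Lp_le_sum q1' (fun B _ (_ : B \in powerset A) => QB B)).
move=> /(_ (index_enum _)); apply: Lp_leW => //.
rewrite sumr_const card_powerset -[_ *+ (2 ^ _)]mulr_natr natrX.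
rewrite ger0_norm ?divr_ge0 ?exprn_ge0//.
rewrite le_eqVlt; apply/orP; left; apply/eqP; field.
by rewrite expf_neq0.
Qed.

(* A lower bound for the number of linear factors of the monomials without power
   factor: a single one would come with blocks of sizes >= 2 and of sum s - 1,
   which is impossible for s = 2, and leaves an odd block for s even. *)
Variable r0 : nat.
Hypothesis r0P : r0 = 1%N \/ r0 = 2 /\
  (s = 2 \/ ~~ odd s /\ forall a, odd a -> admissible_block a -> m a = 0).

(** Induction on the unprocessed powers [b]: an exponent 1 joins the linear factors, any other power
    is written as centred part plus mean, and the mean joins [ms]. Only monomials consisting of
    means alone contribute to the centering [e]. *)
Lemma Lp_le_block_ex ms r b : all admissible_block ms ->
  all (fun a => (0 < a <= s)%N) b -> (sumn ms + r + sumn b = s)%N ->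
  exists2 C, 0 <= C & forall I X c, @admissible I X c -> forall n0 n1 A,
    exists e, Lp_le P q (fun w => \sum_(n0 <= k < n1) chaos X (c k)
        ([seq mean_factor a | a <- ms] ++ nseq r lin ++
          [seq power_factor R a | a <- b]) A w - e)
      (C * ((n1 - n0)%:R `^ q^-1 + Num.sqrt
         (\sum_(n0 <= j < n1) \sum_(n0 <= k < n1) rho c j k ^+ r0))).
Proof.
elim: b ms r => [|a b IH] ms r msP /=; last first.
  move=> /andP[aP bP] sumE; have [a1|a1] := eqVneq a 1%N.
    have [|C C_ge0 HC] := IH ms r.+1 msP bP.
      by rewrite -sumE a1 addnS addnA addn1 addSn.
    exists C; first exact: C_ge0.
    move=> I X c adm n0 n1 A; have := HC I X c adm n0 n1 A.
    have E l : nseq r lin ++ power_factor R a :: l = nseq r.+1 lin ++ l.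
      by rewrite a1; elim: (r) => //= n ->.
    by rewrite E.
  have ab : admissible_block a.
    by move: aP a1; rewrite /admissible_block; case: (a) => [|[|]].
  have [C1 C1_ge0 HC1] := Lp_le_centered_ex r ab msP bP.
  have [||C2 C2_ge0 HC2] := IH (a :: ms) r _ bP; first by rewrite /= ab.
    by rewrite /= -sumE [(a + sumn ms)%N]addnC -!addnA; congr addn; rewrite addnCA.
  exists (C1 + C2); first exact: addr_ge0.
  move=> I X c adm n0 n1 A; have [e He] := HC2 I X c adm n0 n1 A; exists e.
  have H1 := HC1 I X c adm n0 n1 A.
  have := Lp_leD q1' H1 He; set F := (X in Lp_le _ _ X _ -> _); set H := (X in _ -> Lp_le _ _ X _).
  have -> : F = H.
    apply/funext => w; rewrite /F /H addrA -big_split /=; congr (_ - _).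
    apply: eq_bigr => k _; rewrite [in RHS]catA chaos_mid -catA.
    rewrite /chaos /= -big_split /=; apply: eq_bigr => i _.
    by rewrite /factor /=; ring.
  apply: Lp_leW => //; rewrite mulrDl lerD2r ler_wpM2l// lerDl.
  exact: sqrtr_ge0.
rewrite addn0 => _ sumE.
have [r_eq0|r_gt0] := posnP r.
  exists 0; first exact: lexx.
  move=> I X c adm n0 n1 A.
  (* Without linear factors the sum does not depend on the outcome, so its value at [point] is the
     centering. *)
  exists (\sum_(n0 <= k < n1) chaos X (c k)
    ([seq mean_factor a | a <- ms] ++ nseq r lin ++ [::]) A point).
  rewrite mul0r -(@normr0 _ R) (_ : (fun w => _) = fun=> 0); first exact: Lp_le_cst.
  apply/funext => w; apply/eqP; rewrite subr_eq0; apply/eqP/eq_bigr => k _.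
  rewrite r_eq0 /= cats0; elim: (ms) A => // a ms' IHm A.
  by rewrite /= !chaos_cons; apply: eq_bigr => i _; rewrite IHm.
have [r0r|rr0] := leqP r0 r.
  have [C C_ge0 HC] := Lp_le_mean_lin r msP.
  (* The surplus powers of the correlation are bounded by those of [C0]. *)
  exists (C * Num.sqrt (C0 ^+ (r - r0))); first by rewrite mulr_ge0.
  move=> I X c adm n0 n1 A; exists 0.
  have := HC I X c adm (index_iota n0 n1) A.
  move/(Lp_le_exponent q1' q2); set F := (X in Lp_le _ _ X _ -> _).
  rewrite (_ : (fun w => _) = F); last first.
    by apply/funext => w; rewrite /F subr0 cats0.
  apply: Lp_leW => //; rewrite -mulrA ler_wpM2l// mulrDr.
  rewrite ler_wpDl ?mulr_ge0 ?powR_ge0//.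
  rewrite -sqrtrM ?exprn_ge0// ler_wsqrtr// mulr_sumr.
  apply: ler_sum => j _; rewrite mulr_sumr; apply: ler_sum => k _.
  rewrite -{1}(subnK r0r) exprD ler_wpM2r ?exprn_ge0 ?rho_ge0//.
  rewrite lerXn2r// ?nnegrE ?rho_ge0//.
  by apply: rho_le; case: adm.
have r1 : r = 1%N.
  have r2 : (r < 2)%N by case: r0P rr0 => [-> /ltnW|[-> _]].
  by apply/eqP; rewrite eqn_leq -ltnS r2.
have [a ams ma0] : exists2 a, a \in ms & m a = 0.
  case: r0P => [r01|[_ [s2|[s_even odd0]]]]; first by rewrite r01 r1 in rr0.
    case: (ms) msP sumE => [|a ms' /= /andP[/andP[a2 _] _]]; rewrite s2 r1//.
    by move=> /= aE; exfalso; move: a2 aE; clear; lia.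
  have : odd (sumn ms) by move: s_even; rewrite -sumE r1 addn1 /= negbK.
  elim: (ms) msP => //= a ms' IHm /andP[ab ms'b]; rewrite oddD.
  have [aodd _|_ /(IHm ms'b)[a' a'ms ?]] := boolP (odd a).
    by exists a; [rewrite mem_head|exact: odd0].
  by exists a' => //; rewrite inE a'ms orbT.
exists 0; first exact: lexx.
move=> I X c adm n0 n1 A; exists 0.
rewrite mul0r -(@normr0 _ R) (_ : (fun w => _) = fun=> 0); first exact: Lp_le_cst.
apply/funext => w; rewrite normr0 subr0; apply: big1 => k _.
elim: (ms) ams A => //= a' ms' IHm; rewrite inE => aa' A.
rewrite chaos_cons big1// => i _; move: aa' => /orP[/eqP <-|/IHm ->].
  by rewrite /factor /= ma0 mulr0 mul0r.
by rewrite mulr0.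
Qed.

Theorem Lp_le_linear_form_power : (0 < s)%N ->
  exists2 C, 0 <= C & forall I X c, @admissible I X c -> forall n0 n1,
    exists e, Lp_le P q
      (fun w => \sum_(n0 <= k < n1) (\sum_i c k i * X i w) ^+ s - e)
      (C * ((n1 - n0)%:R `^ q^-1 + Num.sqrt
         (\sum_(n0 <= j < n1) \sum_(n0 <= k < n1) rho c j k ^+ r0))).
Proof.
move=> s0.
have : exists2 C, 0 <= C & forall I X c, @admissible I X c -> forall n0 n1,
    exists e, Lp_le P q
      (fun w => \sum_(n0 <= k < n1) \sum_(a <- compositions s)
         chaos X (c k) [seq power_factor R n | n <- a] [set: I]%SET w - e)
      (C * ((n1 - n0)%:R `^ q^-1 + Num.sqrt
         (\sum_(n0 <= j < n1) \sum_(n0 <= k < n1) rho c j k ^+ r0))).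
  have : {in compositions s, forall a, sumn a = s /\ all (leq 1) a}.
    by move=> a; exact: compositionsP.
  elim: (compositions s) => [_|a l IH lP].
    exists 0 => // I X c _ n0 n1; exists 0; rewrite mul0r -(@normr0 _ R).
    rewrite (_ : (fun w => _) = fun=> 0); first exact: Lp_le_cst.
    by apply/funext => w; rewrite normr0 subr0 big1// => k _; rewrite big_nil.
  have [|C C_ge0 HC] := IH; first by move=> b bl; apply: lP; rewrite inE bl orbT.
  have [asum apos] := lP a (mem_head _ _).
  have aP : all (fun a => (0 < a <= s)%N) a.
    rewrite -asum; elim: a apos {asum lP} => //= n a IHa /andP[n1 apos].
    rewrite n1 leq_addr/=; apply: sub_all (IHa apos) => n' /andP[-> /=] n'a.
    exact: leq_trans (leq_addl _ _).
  have [C' C'_ge0 HC'] := Lp_le_block_ex (ms := [::]) (r := 0) isT aP asum.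
  exists (C' + C); first exact: addr_ge0.
  move=> I X c adm n0 n1; have [e He] := HC I X c adm n0 n1.
  have [e' He'] := HC' I X c adm n0 n1 [set: I]%SET.
  exists (e' + e); have := Lp_leD q1' He' He; rewrite mulrDl.
  set F := (X in Lp_le _ _ X _ -> _); set H := (X in _ -> Lp_le _ _ X _).
  suff -> : F = H by [].
  apply/funext => w; rewrite /F /H addrACA -opprD; congr (_ - _).
  by rewrite -big_split; apply: eq_bigr => k _; rewrite big_cons.
move=> [C C_ge0 HC]; exists C; first exact: C_ge0.
move=> I X c adm n0 n1.
have [e He] := HC I X c adm n0 n1; exists e.
rewrite (_ : (fun w => _) = (fun w => \sum_(n0 <= k < n1) \sum_(a <- compositions s)
         chaos X (c k) [seq power_factor R n | n <- a] [set: I]%SET w - e))//.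
by apply/funext => w; congr (_ - _); apply: eq_bigr => k _; rewrite linear_form_expr.
Qed.

End Core.

(** * Deterministic sums *)

Section PowerSums.
Variable R : realType.
Implicit Types (b x u : R) (n : nat).

(** The tangent at 1 of a concave power, from Young's inequality for u ^ b and 1 with exponents 1 /
    b and 1 / (1 - b). *)
Lemma powR_bernoulli b u : 0 < b -> b <= 1 -> 0 <= u -> u `^ b <= 1 - b + b * u.
Proof.
move=> b0; rewrite le_eqVlt => /predU1P[->|b1] u0.
  by rewrite powRr1// subrr add0r mul1r.
have b1' : 0 < 1 - b by rewrite subr_gt0.
have := @conjugate_powR _ (u `^ b) 1 b^-1 (1 - b)^-1.
rewrite powR_ge0 ler01 !invr_gt0 b0 b1' !invrK => /(_ isT isT isT isT).
rewrite addrC subrK => /(_ erefl); rewrite mulr1 -powRrM mulfV ?gt_eqF//.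
by rewrite powRr1// powR1 mul1r mulrC addrC.
Qed.

Lemma powR_telescope_concave b n : 0 < b -> b <= 1 ->
  b * n.+1%:R `^ (b - 1) <= (n.+1%:R : R) `^ b - n%:R `^ b.
Proof.
move=> b0 b1; have x0 : 0 < (n.+1%:R : R) by rewrite ltr0n.
have u0 : 0 <= (n%:R / n.+1%:R : R) by rewrite divr_ge0.
have := powR_bernoulli b0 b1 u0.
have E : n.+1%:R `^ b * (n%:R / n.+1%:R) `^ b = (n%:R : R) `^ b.
  by rewrite -powRM// mulrCA mulfV ?gt_eqF// mulr1.
rewrite -(ler_pM2l (powR_gt0 b x0)) E => h.
rewrite lerBrDr -lerBrDl (le_trans h)//.
rewrite -(mulr_powRB1 (ltW x0) b0).
rewrite le_eqVlt; apply/orP; left; apply/eqP; rewrite -natr1; field.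
by rewrite natr1 pnatr_eq0.
Qed.

(** With t = b / (n + 1), Bernoulli's inequality gives (n / (n + 1)) ^ b <= 1 - t, and inversion
    uses 1 + t <= 1 / (1 - t). *)
Lemma powR_telescope_convex b n : 0 < b -> b <= 1 -> (0 < n)%N ->
  b * n.+1%:R `^ (- b - 1) <= (n%:R : R) `^ (- b) - n.+1%:R `^ (- b).
Proof.
move=> b0 b1 n0; have x0 : 0 < (n.+1%:R : R) by rewrite ltr0n.
have y0 : 0 < (n%:R : R) by rewrite ltr0n.
have u0 : 0 <= (n%:R / n.+1%:R : R) by rewrite divr_ge0.
have bern := powR_bernoulli b0 b1 u0.
pose t : R := b / n.+1%:R.
have tE : 1 - b + b * (n%:R / n.+1%:R) = 1 - t.
  by rewrite /t -natr1; field; rewrite natr1 pnatr_eq0.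
have t0 : 0 < t by rewrite divr_gt0.
have u1 : 0 < (n%:R / n.+1%:R : R) `^ b by rewrite powR_gt0// divr_gt0.
have t1 : t < 1 by rewrite -subr_gt0 -tE (lt_le_trans u1).
have h : 1 + t <= (n%:R / n.+1%:R : R) `^ (- b).
  rewrite powRN -[leLHS]invrK lef_pV2 ?posrE ?invr_gt0 ?addr_gt0//.
  rewrite (le_trans bern)// tE -[leRHS]mul1r ler_pdivlMr ?addr_gt0//.
  by nra.
have E : (n%:R : R) `^ (- b) = n.+1%:R `^ (- b) * (n%:R / n.+1%:R) `^ (- b).
  by rewrite -powRM// mulrCA mulfV ?gt_eqF// mulr1.
rewrite E lerBrDr.
apply: (@le_trans _ _ (n.+1%:R `^ (- b) * (1 + t))); last first.
  by rewrite ler_wpM2l// powR_ge0.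
have -> : (n.+1%:R : R) `^ (- b - 1) = n.+1%:R `^ (- b) / n.+1%:R.
  by rewrite powRB ?(gt_eqF x0) ?implybT// powRr1// ltW.
rewrite /t le_eqVlt; apply/orP; left; apply/eqP.
by rewrite mulrDr mulr1 addrC mulrCA.
Qed.

Lemma sum_powR_le b N : 0 < b -> b < 1 ->
  \sum_(n < N) n.+1%:R `^ (- b) <= (1 - b)^-1 * (N%:R : R) `^ (1 - b).
Proof.
move=> b0 b1; have c0 : 0 < 1 - b by rewrite subr_gt0.
elim: N => [|N IH]; first by rewrite big_ord0 mulr_ge0 ?powR_ge0// invr_ge0 ltW.
rewrite big_ord_recr /= (le_trans (lerD IH (lexx _)))//.
have := @powR_telescope_concave (1 - b) N c0.
rewrite lerBlDr lerDl => /(_ (ltW b0)).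
rewrite -[X in _ `^ X](_ : - b = _) => [h|]; last by ring.
by rewrite -lerBrDl -mulrBr ler_pdivlMl.
Qed.

Lemma sum_powR_tail_le b h N : 0 < b -> b <= 1 ->
  \sum_(h.+1 <= n < N) n.+1%:R `^ (- b - 1) <= b^-1 * (h.+1%:R : R) `^ (- b).
Proof.
move=> b0 b1.
have H : b * \sum_(h.+1 <= n < N) n.+1%:R `^ (- b - 1) <= h.+1%:R `^ (- b).
  have [hN|Nh] := leqP h.+1 N; last by rewrite big_geq ?mulr0 ?powR_ge0// ltnW.
  rewrite mulr_sumr.
  apply: (@le_trans _ _ (\sum_(h.+1 <= n < N) ((n%:R : R) `^ (- b) - n.+1%:R `^ (- b)))).
    apply: ler_sum_nat => n /andP[hn _].
    by apply: powR_telescope_convex => //; exact: leq_ltn_trans hn.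
  under eq_bigr do rewrite -opprB.
  rewrite sumrN telescope_sumr// opprB gerBl powR_ge0//.
by rewrite ler_pdivlMl.
Qed.

Lemma sumr_uniq_le (f : nat -> R) (s : seq nat) N : (forall n, 0 <= f n) ->
  uniq s -> (forall n, n \in s -> (n < N)%N) ->
  \sum_(n <- s) f n <= \sum_(n < N) f n.
Proof.
move=> f0 us sN.
have -> : \sum_(n <- s) f n = \sum_(n <- iota 0 N | n \in s) f n.
  rewrite -[RHS]big_filter; apply: perm_big; apply: uniq_perm => //.
    by rewrite filter_uniq// iota_uniq.
  move=> n; rewrite mem_filter mem_iota add0n /=.
  by case: (boolP (n \in s)) => // /sN ->.
rewrite -(big_mkord predT f) /index_iota subn0.
by rewrite [leRHS](bigID (mem s)) /= lerDl sumr_ge0.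
Qed.

(** An absolute value is taken by at most one nonnegative and one negative integer. *)
Lemma sumr_absz_le (f : nat -> R) (s : seq int) N : (forall n, 0 <= f n) ->
  uniq s -> (forall l, l \in s -> (`|l| < N)%N) ->
  \sum_(l <- s) f `|l|%N <= 2 * \sum_(n < N) f n.
Proof.
move=> f0 us sN; rewrite (bigID (fun l : int => 0 <= l)) /=.
have H (p : pred int) : {in p &, injective absz} ->
    \sum_(l <- s | p l) f `|l|%N <= \sum_(n < N) f n.
  move=> pinj; rewrite -big_filter -(big_map absz predT f).
  apply: sumr_uniq_le => //.
    rewrite map_inj_in_uniq ?filter_uniq// => x y; rewrite !mem_filter.
    by move=> /andP[px _] /andP[py _]; exact: pinj.
  by move=> n /mapP[l]; rewrite mem_filter => /andP[_ ls] ->; exact: sN.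
rewrite -[2]/(1 + 1) mulrDl mul1r lerD// H// => x y; rewrite !unfold_in.
  by case: x => x //; case: y => y // _ _ /= ->.
by case: x => x //; case: y => y // _ _ /= [->].
Qed.

(** * Autocorrelation of a power kernel *)

Section Kernel.
Variable g0 : R.
Hypotheses (g_gt : 2^-1 < g0) (g_lt : g0 < 1).

(** With [n] in place of [n.+1] the value at 0 would be 0, and the kernel could not dominate
    [c 0]. *)
Definition decay_kernel (n : nat) : R := n.+1%:R `^ (- g0).
Notation g := decay_kernel.

Let g00 : 0 < g0. Proof. by rewrite (lt_trans _ g_gt)// invr_gt0. Qed.
Let b := 2 * g0 - 1.
Let b0 : 0 < b. Proof. by rewrite /b subr_gt0 mulrC -ltr_pdivrMr// mul1r. Qed.
Let b1 : b <= 1. Proof. by rewrite /b; move: g_lt => g1; lra. Qed.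

Lemma decay_kernel_ge0 n : 0 <= g n. Proof. exact: powR_ge0. Qed.

Lemma decay_kernel_le m n : (m <= n)%N -> g n <= g m.
Proof.
move=> mn; rewrite /g !powRN lef_pV2 ?posrE ?powR_gt0 ?ltr0n//.
by rewrite ge0_ler_powR ?nnegrE ?ler_nat// ltW.
Qed.

Lemma decay_kernel_sqr n : g n ^+ 2 = n.+1%:R `^ (- b - 1).
Proof.
rewrite /g -powR_mulrn ?powR_ge0// -powRrM; congr (_ `^ _); rewrite /b; ring.
Qed.

Lemma sum_decay_kernel_sqr N : \sum_(n < N) g n ^+ 2 <= 1 + b^-1.
Proof.
case: N => [|N]; first by rewrite big_ord0 addr_ge0// invr_ge0 ltW.
rewrite -(big_mkord predT (fun n => g n ^+ 2)) big_ltn// lerD//.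
  by rewrite /g powR1 expr1n.
under eq_bigr do rewrite decay_kernel_sqr.
by have := @sum_powR_tail_le b 0 N.+1 b0 b1; rewrite powR1 mulr1.
Qed.

Definition kernel_const : R := 2 `^ g0 * (1 - g0)^-1 * 2 + b^-1.

(** Up to [h] the second entry of the minimum is used, and the kernel sums to order h ^ (1 - g0);
    beyond [h] the first entry leaves the tail of the squared kernel. Both parts have order h ^ (1 -
    2 g0), and [kernel_const] adds their constants. *)
Lemma sum_kernel_min h N :
  \sum_(n < N) g n * Num.min (g n) (2 `^ g0 * g h) <= kernel_const * h.+1%:R `^ (- b).
Proof.
have t0 n : 0 <= g n * Num.min (g n) (2 `^ g0 * g h).
  by rewrite mulr_ge0 ?decay_kernel_ge0// le_min decay_kernel_ge0 mulr_ge0 ?powR_ge0 ?decay_kernel_ge0.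
have h0 : 0 < (h.+1%:R : R) by rewrite ltr0n.
apply: (@le_trans _ _ (\sum_(0 <= n < maxn N h.+1) g n * Num.min (g n) (2 `^ g0 * g h))).
  rewrite -(big_mkord predT (fun n => g n * Num.min (g n) (2 `^ g0 * g h))).
  by rewrite (@big_cat_nat _ _ _ N _ (maxn N h.+1)) ?leq_maxl//= lerDl sumr_ge0.
rewrite (@big_cat_nat _ _ _ h.+1) ?leq_maxr//= mulrDl lerD//.
  apply: (@le_trans _ _ (\sum_(0 <= n < h.+1) g n * (2 `^ g0 * g h))).
    by apply: ler_sum => n _; rewrite ler_wpM2l ?decay_kernel_ge0// ge_min lexx orbT.
  rewrite -mulr_suml big_mkord.
  have := @sum_powR_le g0 h.+1 g00 g_lt => hs.
  apply: (@le_trans _ _ ((1 - g0)^-1 * h.+1%:R `^ (1 - g0) * (2 `^ g0 * g h))).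
    by rewrite ler_wpM2r// mulr_ge0 ?powR_ge0 ?decay_kernel_ge0.
  have -> : h.+1%:R `^ (- b) = h.+1%:R `^ (1 - g0) * g h.
    by rewrite /g -powRD ?pnatr_eq0 ?implybT//; congr (_ `^ _); rewrite /b; ring.
  have c0 : 0 <= (1 - g0)^-1 * 2 `^ g0 * (h.+1%:R `^ (1 - g0) * g h).
    by rewrite !mulr_ge0 ?powR_ge0 ?decay_kernel_ge0// invr_ge0 subr_ge0 ltW.
  by nra.
apply: (@le_trans _ _ (\sum_(h.+1 <= n < maxn N h.+1) g n ^+ 2)).
  by apply: ler_sum => n _; rewrite expr2 ler_wpM2l ?decay_kernel_ge0// ge_min lexx.
under eq_bigr do rewrite decay_kernel_sqr.
exact: sum_powR_tail_le.
Qed.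

(** The hypotheses force h <= 2 c, hence g c <= 2 ^ g0 * g h. *)
Lemma kernel_mul_le (a c h : nat) : (h <= a + c)%N -> (a <= c)%N ->
  g a * g c <= g a * Num.min (g a) (2 `^ g0 * g h).
Proof.
move=> hac ac; rewrite ler_wpM2l ?decay_kernel_ge0// le_min decay_kernel_le//=.
have -> : g c = 2 `^ g0 * (2 * c.+1%:R) `^ (- g0).
  by rewrite powRM// mulrA -powRD ?pnatr_eq0 ?implybT// subrr powRr0 mul1r.
rewrite ler_wpM2l ?powR_ge0// /g !powRN lef_pV2 ?posrE ?powR_gt0 ?mulr_gt0 ?ltr0n//.
apply: ge0_ler_powR; rewrite ?nnegrE ?mulr_ge0//; first exact: ltW.
rewrite -natrM ler_nat.
by rewrite mul2n -addnn (leq_trans (n:=(a + c).+1))// addSn ltnS leq_add// leqW.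
Qed.

(** The distances |l| and |l + h| add up to at least |h|, and [F] at the smaller one dominates the
    product. The 4 counts which of the two is smaller, and the two signs. *)
Lemma sum_kernel_shift (s : seq int) (h : int) : uniq s ->
  \sum_(l <- s) g `|l|%N * g `|(l + h)%R|%N <= 4 * kernel_const * `|h|%N.+1%:R `^ (- b).
Proof.
move=> us; pose F n := g n * Num.min (g n) (2 `^ g0 * g `|h|%N).
have F0 n : 0 <= F n.
  by rewrite mulr_ge0 ?decay_kernel_ge0// le_min decay_kernel_ge0 mulr_ge0 ?powR_ge0 ?decay_kernel_ge0.
have S (s' : seq int) : uniq s' ->
    \sum_(l <- s') F `|l|%N <= 2 * (kernel_const * `|h|%N.+1%:R `^ (- b)).
  move=> us'; pose N := (\max_(l <- s') `|l|%N).+1.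
  apply: (le_trans (sumr_absz_le (N := N) F0 us' _)).
    by move=> l ls; rewrite /N ltnS; exact: leq_bigmax_seq.
  by rewrite ler_wpM2l// sum_kernel_min.
apply: (@le_trans _ _ (\sum_(l <- s) (F `|l|%N + F `|(l + h)%R|%N))).
  apply: ler_sum => l _; have hl : (`|h| <= `|l| + `|(l + h)%R|)%N by lia.
  have [lc|/ltnW cl] := leqP `|l|%N `|(l + h)%R|%N.
    by rewrite (le_trans (kernel_mul_le hl lc))// lerDl.
  rewrite mulrC addnC in hl *.
  by rewrite (le_trans (kernel_mul_le hl cl))// lerDr.
rewrite big_split /= -(big_map (fun l => l + h) predT (fun l => F `|l|%N)).
have us' : uniq [seq l + h | l <- s] by rewrite map_inj_uniq//; exact: addIr.
have := lerD (S s us) (S _ us'); rewrite -mulrA; lra.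
Qed.

End Kernel.

Lemma sum_block_powR_le e n0 n1 : 0 < e -> e < 1 ->
  \sum_(n0 <= j < n1) \sum_(n0 <= k < n1) (`|(j%:Z - k%:Z)%R|%N.+1%:R : R) `^ (- e) <=
  2 * (1 - e)^-1 * (n1 - n0)%:R `^ (2 - e).
Proof.
move=> e0 e1; set n := (n1 - n0)%N.
have n_ge0 : 0 <= (n%:R : R) by [].
have [n_eq0|n_gt0] := posnP n.
  rewrite big_geq; last by rewrite -subn_eq0 -/n n_eq0.
  rewrite !mulr_ge0 ?powR_ge0//.
  by rewrite invr_ge0 subr_ge0 ltW.
have n_gt0' : 0 < (n%:R : R) by rewrite ltr0n.
apply: (@le_trans _ _ (\sum_(n0 <= j < n1) 2 * ((1 - e)^-1 * n%:R `^ (1 - e)))).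
  apply: ler_sum_nat => j /andP[n0j jn1].
  have := @sumr_absz_le (fun m => m.+1%:R `^ (- e))
    [seq j%:Z - k%:Z | k <- index_iota n0 n1] n.
  rewrite big_map; move/(_ _ _ _)/le_trans; apply.
  - by move=> m; exact: powR_ge0.
  - by rewrite map_inj_uniq ?iota_uniq// => x y /addrI /oppr_inj [].
  - move=> m /mapP[k]; rewrite mem_index_iota => /andP[n0k kn1] ->.
    by rewrite /n; lia.
  - by rewrite ler_wpM2l// sum_powR_le.
rewrite sumr_const_nat -/n -[_ *+ n]mulr_natr.
have -> : (n%:R : R) `^ (2 - e) = n%:R `^ (1 - e) * n%:R.
  rewrite -[X in _ * X]powRr1// -powRD ?(gt_eqF n_gt0') ?implybT//.
  by congr (_ `^ _); ring.
by rewrite !mulrA.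
Qed.

End PowerSums.

(** * Dyadic chaining *)

Section DyadicChaining.
Variable R : realType.

(** An initial segment splits into at most [r.+1] dyadic blocks: if it exceeds half of the range, it
    is the left half followed by an initial segment of the shifted sequence. *)
Lemma dyadic_chaining (a : nat -> R) M r : 0 <= M ->
  (forall v b, (v <= r)%N -> (b < 2 ^ (r - v))%N ->
    `|\sum_(b * 2 ^ v <= k < b.+1 * 2 ^ v) a k| <= M) ->
  forall n, (n <= 2 ^ r)%N -> `|\sum_(0 <= k < n) a k| <= r.+1%:R * M.
Proof.
move=> M0; elim: r a => [|r IH] a aM n.
  rewrite expn0 mul1r; case: n => [|[|//]] _; first by rewrite big_geq// normr0.
  by have := aM 0%N 0%N isT isT; rewrite expn0 muln1.
have IHa := IH a; have IHs := IH (fun k => a (k + 2 ^ r)%N).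
have [nr _|rn nr] := leqP n (2 ^ r)%N.
  apply: (@le_trans _ _ (r.+1%:R * M)); last by rewrite ler_wpM2r// ler_nat.
  apply: IHa nr => v b vr br; apply: aM; first exact: leqW.
  by rewrite (leq_trans br)// leq_exp2l// leq_sub2r.
rewrite (@big_cat_nat _ _ _ (2 ^ r)%N)//=; last exact: ltnW.
rewrite (le_trans (ler_normD _ _))// -[r.+2%:R]natr1 mulrDl mul1r addrC lerD//.
  rewrite -{1}[(2 ^ r)%N]add0n big_addn.
  apply: IHs.
    move=> v b vr br; have := aM v (b + 2 ^ (r - v))%N (leqW vr).
    rewrite subSn// expnS mul2n -addnn ltn_add2r => /(_ br).
    have -> : ((b + 2 ^ (r - v)) * 2 ^ v = b * 2 ^ v + 2 ^ r)%N.
      by rewrite mulnDl -expnD subnK.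
    have -> : ((b + 2 ^ (r - v)).+1 * 2 ^ v = b.+1 * 2 ^ v + 2 ^ r)%N.
      by rewrite -addSn mulnDl -expnD subnK.
    by rewrite big_addn addnK.
  by rewrite leq_subLR addnn -mul2n -expnS.
by have := aM r 0%N (leqnSn r); rewrite subSn// subnn expn1 mul0n mul1n; exact.
Qed.

Lemma powR2_gt1 (e : R) : 0 < e -> 1 < (2 : R) `^ e.
Proof.
move=> e0; rewrite /powR pnatr_eq0 /= -[ltLHS]expR0 ltr_expR mulr_gt0//.
by rewrite ln_gt0// ltr1n.
Qed.

(** Powers of 1 + h dominate h * (r + 1); the cap of [h] at 1 settles r = 0. *)
Lemma natr_le_powR2 (e : R) : 0 < e ->
  exists2 K, 0 <= K & forall r, r.+1%:R <= K * (2 : R) `^ (r%:R * e).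
Proof.
move=> e0; pose h : R := Num.min 1 (2 `^ e - 1).
have p1 := powR2_gt1 e0.
have h0 : 0 < h by rewrite lt_min ltr01 subr_gt0.
have h1 : h <= 1 by rewrite ge_min lexx.
have h2 : 1 + h <= 2 `^ e by rewrite addrC -lerBrDr ge_min lexx orbT.
exists h^-1; first by rewrite invr_ge0 ltW.
move=> r; rewrite ler_pdivlMl//.
apply: (@le_trans _ _ ((1 + h) ^+ r)).
  elim: r => [|r IH]; first by rewrite mulr1 expr0.
  rewrite exprS -[r.+2%:R]natr1.
  have : 1 <= (1 + h) ^+ r by rewrite exprn_ege1// lerDl ltW.
  nra.
rewrite mulrC powRrM powR_mulrn ?powR_ge0//.
by apply: lerXn2r => //; rewrite nnegrE ?powR_ge0// addr_ge0// ltW.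
Qed.

Context d (T : measurableType d) (P : probability T R).

(** The q-th powers of all dyadic blocks in [0, 2 ^ r) are collected in [Z r], weighted so that the
    expectations are summable over [r]. Almost surely all [Z r] then have a common bound, and
    chaining carries it over to every partial sum. *)
Lemma partial_sums_growth (Y : nat -> T -> R) (q C g b : R) : 1 <= q -> 1 <= g * q ->
  g < b ->
  (forall i j, (i <= j)%N -> Lp_le P q (fun w => \sum_(i <= k < j) Y k w)
     (C * (j - i)%:R `^ g)) ->
  {ae P, forall w, exists K, forall n,
    `|\sum_(0 <= k < n) Y k w| <= K * n%:R `^ b}.
Proof.
move=> q1 gq gb YC; have q0 : 0 < q by exact: lt_le_trans q1.
have [mC C0 _] := YC 0%N 1%N isT; rewrite subn0 powR1 mulr1 in C0.
pose blk r v w := \sum_(c < 2 ^ (r - v)) `|\sum_(c * 2 ^ v <= k < c.+1 * 2 ^ v) Y k w| `^ q.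
(* The power of [r.+1] compensates the number of blocks in the chaining, the power of 2 the target
   growth 2 ^ (r b). *)
pose wt r : R := r.+1%:R `^ q * 2 `^ (- (r%:R * b * q)).
have wt0 r : 0 <= wt r by rewrite mulr_ge0 ?powR_ge0.
pose Z r w := wt r * \sum_(v < r.+1) blk r v w.
have blk0 r v w : 0 <= blk r v w by rewrite sumr_ge0// => i _; exact: powR_ge0.
have Z0 r w : 0 <= Z r w by rewrite mulr_ge0// sumr_ge0.
have mb i j : (i <= j)%N -> measurable_fun setT (fun w => `|\sum_(i <= k < j) Y k w| `^ q).
  by move=> ij; have [mY _ _] := YC i j ij; exact: measurable_norm_powR.
have le2 c v : (c * 2 ^ v <= c.+1 * 2 ^ v)%N by rewrite leq_mul.
have mblk r v : measurable_fun setT (blk r v).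
  by apply: measurable_sum => c; apply: mb.
have mZ r : measurable_fun setT (Z r).
  apply: measurable_funM; first exact: measurable_cst.
  by apply: measurable_sum => v.
have Eblk r v : (v <= r)%N ->
    (\int[P]_w (blk r v w)%:E <= (C `^ q * 2 `^ (r%:R * g * q))%:E)%E.
  move=> vr; under eq_integral do rewrite /blk -sumEFin.
  rewrite ge0_integral_sum//; last first.
    by move=> c; apply/measurable_EFinP; exact: mb.
  apply: (@le_trans _ _ (\sum_(c < 2 ^ (r - v)) (C `^ q * 2 `^ (v%:R * g * q))%:E)%E).
    apply: lee_sum => c _; have [_ _ H] := YC _ _ (le2 c v).
    apply: (le_trans H); rewrite -mulnBl subSnn mul1n powRM ?powR_ge0//.
    by rewrite lee_fin natrX -powR_mulrn// -!powRrM mulrA.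
  rewrite sumEFin sumr_const card_ord lee_fin -[_ *+ (2 ^ _)]mulr_natr -[leLHS]mulrA ler_wpM2l ?powR_ge0//.
  rewrite natrX -powR_mulrn// -powRD ?pnatr_eq0 ?implybT//.
  (* There are 2 ^ (r - v) blocks of length 2 ^ v; by 1 <= g q the scale v = r has the largest
     bound. *)
  rewrite ler_powR ?ler1n// natrB//.
  rewrite -!mulrA; have : (v%:R : R) <= r%:R by rewrite ler_nat.
  by nra.
have EZ r : (\int[P]_w (Z r w)%:E <=
    (C `^ q * r.+1%:R `^ (q + 1) * 2 `^ (- (r%:R * ((b - g) * q))))%:E)%E.
  under eq_integral do rewrite /Z EFinM.
  rewrite ge0_integralZl//; last 3 first.
    by apply/measurable_EFinP; apply: measurable_sum => v.
    by move=> w _; rewrite lee_fin sumr_ge0.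
    by rewrite lee_fin.
  under eq_integral do rewrite -sumEFin.
  rewrite ge0_integral_sum; last 3 first.
    by [].
    by move=> v; apply/measurable_EFinP.
    by move=> v w _; rewrite lee_fin.
  apply: (@le_trans _ _ ((wt r)%:E * (r.+1%:R * (C `^ q * 2 `^ (r%:R * g * q)))%:E)%E).
    rewrite lee_wpmul2l ?lee_fin//.
    apply: (@le_trans _ _ (\sum_(v < r.+1) (C `^ q * 2 `^ (r%:R * g * q))%:E)%E).
      by apply: lee_sum => v _; apply: Eblk; rewrite -ltnS.
    by rewrite sumEFin sumr_const card_ord [r.+1%:R * _]mulr_natl.
  rewrite -EFinM lee_fin /wt powRD ?pnatr_eq0 ?implybT// powRr1//.
  rewrite [- (r%:R * _)](_ : _ = - (r%:R * b * q) + r%:R * g * q); last by ring.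
  rewrite powRD ?pnatr_eq0 ?implybT//.
  by rewrite le_eqVlt; apply/orP; left; apply/eqP; ring.
(* Half of this exponent absorbs the factor (r + 1) ^ (q + 1); the other half is the geometric decay
   [th]. *)
pose e := (b - g) * q; have e0 : 0 < e by rewrite mulr_gt0// subr_gt0.
have q2 : 0 < q + 1 by rewrite addr_gt0.
have e1 : 0 < e / (2 * (q + 1)) by rewrite divr_gt0// mulr_gt0.
have [K K0 HK] := natr_le_powR2 e1.
pose th : R := 2 `^ (- (e / 2)).
have th1 : `|th| < 1.
  rewrite ger0_norm ?powR_ge0// /th powRN invf_lt1 ?powR_gt0//.
  by apply: powR2_gt1; rewrite divr_gt0.
have EZ' r : (\int[P]_w (Z r w)%:E <= (C `^ q * K `^ (q + 1) * th ^+ r)%:E)%E.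
  apply: (le_trans (EZ r)); rewrite lee_fin -!mulrA ler_wpM2l ?powR_ge0//.
  have h : (r.+1%:R : R) `^ (q + 1) <= K `^ (q + 1) * 2 `^ (r%:R * (e / 2)).
    apply: (@le_trans _ _ ((K * 2 `^ (r%:R * (e / (2 * (q + 1))))) `^ (q + 1))).
      by rewrite ge0_ler_powR ?nnegrE ?mulr_ge0 ?powR_ge0// ltW.
    rewrite powRM ?powR_ge0// -powRrM le_eqVlt; apply/orP; left; apply/eqP.
    by congr (_ * _ `^ _); field; rewrite gt_eqF.
  apply: (le_trans (ler_wpM2r (powR_ge0 _ _) h)).
  rewrite -mulrA ler_wpM2l ?powR_ge0// -powRD ?pnatr_eq0 ?implybT//.
  rewrite /th -powR_mulrn ?powR_ge0// -powRrM le_eqVlt; apply/orP; left; apply/eqP.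
  by congr (_ `^ _); rewrite /e; field.
have sumE : (\int[P]_w (\sum_(r <oo) (Z r w)%:E) < +oo)%E.
  rewrite integral_nneseries//; last 2 first.
    by move=> r; apply/measurable_EFinP.
    by move=> r w _; rewrite lee_fin.
  apply: (@le_lt_trans _ _ (\sum_(r <oo) (C `^ q * K `^ (q + 1) * th ^+ r)%:E)%E).
    by apply: lee_nneseries => r _ //; rewrite integral_ge0// => w _; rewrite lee_fin.
  have := @cvg_geometric_series _ (C `^ q * K `^ (q + 1)) _ th1.
  have -> : (fun n => \sum_(0 <= r < n) (C `^ q * K `^ (q + 1) * th ^+ r)%:E)%E =
     EFin \o (series (geometric (C `^ q * K `^ (q + 1)) th)).
    by apply/funext => n; rewrite /= /series /= sumEFin.
  by move=> H; rewrite EFin_lim ?ltry//; apply/cvg_ex; eexists; exact: H.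
have mS : measurable_fun setT (fun w => (\sum_(r <oo) (Z r w)%:E)%E).
  apply: ge0_emeasurable_sum => [r w _ _|r _]; first by rewrite lee_fin.
  exact/measurable_EFinP.
have iS : P.-integrable setT (fun w => (\sum_(r <oo) (Z r w)%:E)%E).
  apply/integrableP; split => //.
  rewrite (le_lt_trans _ sumE)// le_eqVlt; apply/orP; left; apply/eqP.
  apply: eq_integral => w _; rewrite gee0_abs// nneseries_ge0// => r _ _.
  by rewrite lee_fin.
have := integrable_ae measurableT iS; apply: filterS => w /(_ Logic.I) Sfin.
pose M := fine (\sum_(r <oo) (Z r w)%:E)%E.
have ZM r : Z r w <= M.
  rewrite -lee_fin /M fineK// (nneseries_split _ r.+1)//; last by move=> k _; rewrite lee_fin.
  rewrite add0n big_nat_recr//= -addeA addeC -addeA leeDl//.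
  rewrite adde_ge0//; last by rewrite sumEFin lee_fin sumr_ge0.
  by rewrite nneseries_ge0// => k _ _; rewrite lee_fin.
have M0 : 0 <= M := le_trans (Z0 0%N w) (ZM 0%N).
have b_gt0 : 0 < b.
  by apply: lt_trans gb; have := lt_le_trans ltr01 gq; rewrite pmulr_lgt0.
exists (M `^ q^-1 * 2 `^ b) => n; have [->|n0] := posnP n.
  by rewrite big_geq// normr0 !mulr_ge0 ?powR_ge0.
pose r := (trunc_log 2 n).+1.
have nr : (n <= 2 ^ r)%N by apply: ltnW; exact: trunc_log_ltn.
have rn : (2 ^ r <= 2 * n)%N by rewrite /r expnS leq_mul2l/= trunc_logP.
pose m := (\sum_(v < r.+1) blk r v w) `^ q^-1.
have m0 : 0 <= m by exact: powR_ge0.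
have A v c : (v <= r)%N -> (c < 2 ^ (r - v))%N ->
    `|\sum_(c * 2 ^ v <= k < c.+1 * 2 ^ v) Y k w| <= m.
  move=> vr cr; rewrite /m -[leLHS]powRr1// -[X in _ `^ X](mulfV (lt0r_neq0 q0)) powRrM.
  apply: ge0_ler_powR; rewrite ?nnegrE ?powR_ge0 ?sumr_ge0//.
    by rewrite invr_ge0 ltW.
  have vr1 : (v < r.+1)%N by [].
  rewrite (bigD1 (Ordinal vr1))//= {1}/blk (bigD1 (Ordinal cr))//= -addrA lerDl addr_ge0// ?sumr_ge0//.
apply: (le_trans (dyadic_chaining m0 A nr)).
have H : r.+1%:R * m <= M `^ q^-1 * 2 `^ (r%:R * b).
  have E : r.+1%:R * m = (Z r w) `^ q^-1 * 2 `^ (r%:R * b).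
    rewrite /Z /wt !powRM ?mulr_ge0 ?powR_ge0 ?sumr_ge0//.
    rewrite -!powRrM mulfV ?gt_eqF// powRr1// -/m.
    have -> : - (r%:R * b * q) * q^-1 = - (r%:R * b) by field; rewrite gt_eqF.
    have : (2 : R) `^ (- (r%:R * b)) * 2 `^ (r%:R * b) = 1.
      by rewrite -powRD ?pnatr_eq0 ?implybT// addNr powRr0.
    by move=> h; rewrite mulrAC -(mulrA r.+1%:R) h mulr1.
  by rewrite E ler_wpM2r ?powR_ge0// ge0_ler_powR ?nnegrE// invr_ge0 ltW.
apply: (le_trans H); rewrite -mulrA ler_wpM2l ?powR_ge0//.
rewrite powRrM powR_mulrn// -powRM//.
apply: ge0_ler_powR; rewrite ?nnegrE ?exprn_ge0 ?mulr_ge0//; first exact: ltW.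
by rewrite -natrX -natrM ler_nat.
Qed.

End DyadicChaining.

(** * Identically distributed innovations *)

Section IID.
Context d (T : measurableType d) (R : realType) (P : probability T R).
Variable xi : int -> {RV P >-> R}.

Lemma indep_family_reindex (I : finType) (f : I -> int) : injective f ->
  mutually_independent P (fun l => xi l : T -> R) ->
  indep_family P (fun i => xi (f i) : T -> R).
Proof.
move=> finj ind A mA.
pose B l := if [pick i | f i == l] is Some i then A i else setT.
have BE i : B (f i) = A i.
  by rewrite /B; case: pickP => [j /eqP/finj->//|/(_ i)]; rewrite eqxx.
have mB l : measurable (B l) by rewrite /B; case: pickP => [i _|_].
pose J := [fset x in [seq f i | i <- enum I]]%fset.
have := ind J B mB.
have -> : \bigcap_(l in [set` J]) (xi l @^-1` B l) = \bigcap_i (xi (f i) @^-1` A i).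
  apply/seteqP; split => w Hw => [i _|l].
    have /Hw : [set` J] (f i).
      by rewrite /= !inE; apply: map_f; rewrite mem_enum.
    by rewrite BE.
  by rewrite /= !inE => /mapP[i _ ->]; rewrite BE; exact: Hw.
move=> ->.
rewrite (perm_big [seq f i | i <- enum I]); last first.
  apply: uniq_perm; [exact: fset_uniq|by rewrite map_inj_uniq// enum_uniq|].
  by move=> l; rewrite !inE.
by rewrite big_map big_enum /=; apply: eq_bigr => i _; rewrite BE.
Qed.

Hypothesis xi_id : identically_distributed P (fun l => xi l : T -> R).

Let dist_eq l l' (A : set R) : measurable A ->
  distribution P (xi l) A = distribution P (xi l') A.
Proof. by move=> mA; rewrite /distribution /pushforward; exact: xi_id. Qed.

Lemma ge0_integral_id l l' (f : R -> \bar R) : measurable_fun setT f ->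
  (forall x, 0 <= f x)%E ->
  (\int[P]_w f (xi l w) = \int[P]_w f (xi l' w))%E.
Proof.
move=> mf f0; rewrite -(ge0_integral_distribution (xi l) mf f0).
rewrite -(ge0_integral_distribution (xi l') mf f0).
by apply: eq_measure_integral => A mA _; exact: dist_eq.
Qed.

Lemma Lp_le_id l l' q b (f : R -> R) : measurable_fun setT f ->
  Lp_le P q (f \o xi l) b -> Lp_le P q (f \o xi l') b.
Proof.
move=> mf [_ b0 h]; split; [exact: measurableT_comp|exact: b0|].
apply: le_trans h; rewrite le_eqVlt; apply/orP; left; apply/eqP.
apply: (@ge0_integral_id l' l (fun x => (`|f x| `^ q)%:E)).
  by apply/measurable_EFinP; exact: measurable_norm_powR.
by move=> x; rewrite lee_fin powR_ge0.
Qed.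

Lemma Rintegral_id l l' (f : R -> R) : measurable_fun setT f ->
  P.-integrable setT (EFin \o (f \o xi l)) ->
  \int[P]_w f (xi l w) = \int[P]_w f (xi l' w).
Proof.
move=> mf il; have mf' : measurable_fun setT (EFin \o f) by exact/measurable_EFinP.
have il' : P.-integrable setT (EFin \o (f \o xi l')).
  move/integrableP : il => [_ il]; apply/integrableP; split.
    by apply/measurable_EFinP; exact: measurableT_comp.
  rewrite (@ge0_integral_id l' l (fun x => `|f x|%:E))//.
  by apply/measurable_EFinP; exact: measurableT_comp.
rewrite /Rintegral; congr fine.
rewrite -[LHS](integral_distribution (X := xi l) mf' il).
rewrite -[RHS](integral_distribution (X := xi l') mf' il').
by apply: eq_measure_integral => A mA _; exact: dist_eq.
Qed.

End IID.

Section TailMoment.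
Context d (T : measurableType d) (R : realType) (P : probability T R).

Lemma exists_pow2_ge (y : R) : 1 < y ->
  exists n : nat, (2 : R) ^+ n < y /\ y <= 2 ^+ n.+1.
Proof.
move=> y1; have ex : exists n, y <= (2 : R) ^+ n.
  exists (Num.trunc y).+1; apply: ltW.
  have y0 : 0 <= y by rewrite ltW// (lt_trans ltr01).
  apply: (lt_trans (truncnS_gt y)).
  by rewrite -natrX ltr_nat ltn_expl.
have := ex_minnP ex; case: ex_minnP => -[|n] yn nmin _.
  by move: yn; rewrite expr0 leNgt y1.
exists n; split => //; rewrite ltNge; apply/negP => /nmin.
by rewrite ltnn.
Qed.

(** Dyadic layers: if Y lies in (2 ^ n, 2 ^ (n + 1)], the n-th layer alone dominates Y ^ q. By the
    tail bound the expected layers decay geometrically with ratio 2 ^ (q - a). *)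
Lemma moment_of_tail (Y : T -> R) (a q K : R) : measurable_fun setT Y ->
  (forall w, 0 <= Y w) -> 0 < q -> q < a ->
  (forall t, 1 <= t -> ((t `^ a)%:E * P [set w | (t < Y w)%R] <= K%:E)%E) ->
  (\int[P]_w (Y w `^ q)%:E < +oo)%E.
Proof.
move=> mY Y0 q0 qa tailK.
have K0 : 0 <= K.
  by rewrite -lee_fin; apply: le_trans (tailK 1 (lexx _)); rewrite mule_ge0// lee_fin powR_ge0.
pose E n := [set w | (2 ^+ n < Y w)%R].
have mE n : measurable (E n).
  rewrite (_ : E n = Y @^-1` `]2 ^+ n, +oo[%classic).
    by rewrite -[X in measurable X]setTI; exact: mY.
  by apply/seteqP; split => w; rewrite /E /= in_itv/= andbT.
pose Z n w : \bar R := ((2 `^ (n.+1%:R * q))%:E * (\1_(E n) w)%:E)%E.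
have Z0 n w : (0 <= Z n w)%E by rewrite mule_ge0 ?lee_fin ?powR_ge0.
have mZ n : measurable_fun setT (Z n).
  apply: emeasurable_funM; first exact: measurable_cst.
  by apply/measurable_EFinP; exact: measurable_indic.
have ptw w : ((Y w `^ q)%:E <= 1 + \sum_(n <oo) Z n w)%E.
  have S0 n : (0 <= \sum_(n <= k <oo) Z k w)%E by apply: nneseries_ge0.
  have [Y1|Y1] := leP (Y w) 1.
    apply: (@le_trans _ _ 1%E); last by rewrite leeDl.
    rewrite lee_fin; apply: (@le_trans _ _ (1 `^ q)); last by rewrite powR1.
    by rewrite ge0_ler_powR ?nnegrE//; exact: ltW.
  have [n [nY Yn]] := exists_pow2_ge Y1.
  apply: (@le_trans _ _ (Z n w)).
    rewrite /Z indicE mem_set// mule1 lee_fin powRrM powR_mulrn//.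
    by rewrite ge0_ler_powR ?nnegrE ?exprn_ge0// ltW.
  apply: (@le_trans _ _ (\sum_(k <oo) Z k w)%E); last by rewrite leeDr.
  rewrite (nneseries_split _ n.+1)//.
  rewrite add0n big_nat_recr//= -addeA addeC -addeA leeDl// adde_ge0//.
  by apply: sume_ge0.
have S0 w : (0 <= \sum_(n <oo) Z n w)%E by apply: nneseries_ge0.
have mS : measurable_fun setT (fun w => \sum_(n <oo) Z n w)%E.
  by apply: ge0_emeasurable_sum => // n _; exact: mZ.
apply: (@le_lt_trans _ _ (\int[P]_w (1 + \sum_(n <oo) Z n w))%E).
  apply: ge0_le_integral => //.
  - by move=> w _; rewrite lee_fin powR_ge0.
  - apply/measurable_EFinP; apply: (@measurableT_comp _ _ _ _ _ _ (@powR R ^~ q)) => //.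
  - by apply: emeasurable_funD.
rewrite ge0_integralD//.
rewrite integral_cst//= probability_setT mule1 lte_add_pinfty ?ltry//.
rewrite integral_nneseries//.
pose th : R := 2 `^ (- (a - q)).
have th1 : `|th| < 1.
  rewrite ger0_norm ?powR_ge0// /th powRN invf_lt1 ?powR_gt0//.
  by apply: powR2_gt1; rewrite subr_gt0.
apply: (@le_lt_trans _ _ (\sum_(n <oo) (2 `^ q * K * th ^+ n)%:E)%E).
  apply: lee_nneseries => n _; first by rewrite integral_ge0.
  rewrite /Z ge0_integralZl//; last first.
    by apply/measurable_EFinP; exact: measurable_indic.
  rewrite integral_indic// setIT /=.
  have n1 : 1 <= (2 : R) ^+ n by rewrite exprn_ege1// ler1n.
  have := tailK _ n1; rewrite -/(E n).
  have tE : ((2 : R) ^+ n) `^ a = 2 `^ (n%:R * a) by rewrite -powR_mulrn// -powRrM.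
  rewrite tE => h; rewrite -[P (E n)]fineK ?fin_num_measure// in h *.
  rewrite -!EFinM !lee_fin in h *.
  have -> : (2 : R) `^ (n.+1%:R * q) = 2 `^ q * th ^+ n * 2 `^ (n%:R * a).
    rewrite /th -powR_mulrn ?powR_ge0// -powRrM -!powRD ?pnatr_eq0 ?implybT//.
    by congr (_ `^ _); rewrite -natr1; ring.
  rewrite -[leLHS]mulrA [leRHS]mulrAC.
  by rewrite ler_wpM2l// mulr_ge0 ?exprn_ge0 ?powR_ge0.
have := @cvg_geometric_series _ (2 `^ q * K) _ th1.
have -> : (fun n => \sum_(0 <= r < n) (2 `^ q * K * th ^+ r)%:E)%E =
   EFin \o (series (geometric (2 `^ q * K) th)).
  by apply/funext => n; rewrite /= /series /= sumEFin.
by move=> H; rewrite EFin_lim ?ltry//; apply/cvg_ex; eexists; exact: H.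
Qed.

End TailMoment.

(** * Limits *)

Section AbelSummation.
Variable R : realType.

Lemma cvg_natr_powRN (e : R) : 0 < e -> (n%:R : R) `^ (- e) @[n --> \oo] --> (0 : R).
Proof.
move=> e0; apply/cvgr0Pnorm_lt => eps eps0.
near=> n; rewrite ger0_norm ?powR_ge0//.
have Mn : eps `^ (- e^-1) < n%:R by near: n; exact: nbhs_infty_gtr.
have M0 : 0 < eps `^ (- e^-1) by exact: powR_gt0.
have n0 : 0 < (n%:R : R) by exact: lt_trans Mn.
rewrite powRN -[ltRHS]invrK ltf_pV2 ?posrE ?invr_gt0 ?powR_gt0//.
have -> : eps^-1 = (eps `^ (- e^-1)) `^ e.
  by rewrite -powRrM mulNr mulVf ?gt_eqF// powRN powRr1// ltW.
by rewrite gt0_ltr_powR ?nnegrE// ltW.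
Unshelve. all: by end_near. Qed.

Lemma cvg_partial_sums_growth (S : nat -> R) K b c : b < c ->
  (forall n, `|S n| <= K * n%:R `^ b) ->
  n%:R `^ (- c) * S n @[n --> \oo] --> (0 : R).
Proof.
move=> bc SK; have e0 : 0 < c - b by rewrite subr_gt0.
have h : K * (n%:R : R) `^ (- (c - b)) @[n --> \oo] --> (0 : R).
  by rewrite -(mulr0 K); apply: cvgM; [exact: cvg_cst|exact: cvg_natr_powRN].
apply/cvgr0Pnorm_lt => eps eps0; move/cvgr0Pnorm_lt : h => /(_ _ eps0).
apply: filter_app; near=> n.
have n0 : 0 < (n%:R : R) by near: n; exact: nbhs_infty_gtr.
apply: le_lt_trans; rewrite normrM ger0_norm ?powR_ge0//.
rewrite (le_trans _ (ler_norm _))//.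
apply: (@le_trans _ _ (n%:R `^ (- c) * (K * n%:R `^ b))).
  by rewrite ler_wpM2l ?powR_ge0.
rewrite mulrCA -powRD ?(gt_eqF n0) ?implybT// [- (c - b)](_ : _ = - c + b)//.
by ring.
Unshelve. all: by end_near. Qed.

Lemma abel_identity (u y : nat -> R) N :
  \sum_(0 <= n < N) u n * y n = u N * (\sum_(0 <= k < N) y k) +
    \sum_(0 <= n < N) (u n - u n.+1) * \sum_(0 <= k < n.+1) y k.
Proof.
elim: N => [|N IH]; first by rewrite !big_geq// mulr0 addr0.
by rewrite !big_nat_recr//= IH; ring.
Qed.

(** Abel summation: the boundary term is of order N ^ (b - g), and the remaining series converges
    absolutely. *)
Lemma cvg_abel_powR (y : nat -> R) K b g : 0 < b -> b < g ->
  (forall n, `|\sum_(0 <= k < n) y k| <= K * n%:R `^ b) ->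
  cvgn (fun N => \sum_(0 <= n < N) n.+1%:R `^ (- g) * y n).
Proof.
move=> b0 bg SK; have g0 : 0 < g := lt_trans b0 bg.
have K0 : 0 <= K.
  by have := SK 1%N; rewrite powR1 mulr1; apply: le_trans.
pose e := g - b; have e0 : 0 < e by rewrite subr_gt0.
pose u n : R := n.+1%:R `^ (- g).
have n0 n : 0 < (n.+1%:R : R) by [].
have u_dec n : 0 <= u n - u n.+1.
  rewrite subr_ge0 /u !powRN lef_pV2 ?posrE ?powR_gt0//.
  by rewrite ge0_ler_powR ?nnegrE ?ler_nat// ltW.
pose D n : R := n.+1%:R `^ (- e).
have D_dec n : 0 <= D n - D n.+1.
  rewrite subr_ge0 /D !powRN lef_pV2 ?posrE ?powR_gt0//.
  by rewrite ge0_ler_powR ?nnegrE ?ler_nat// ltW.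
(* Bernoulli's inequality with exponent e / g, at U = (x / z) ^ g, compares the decrements of the
   two powers; the Abel series is thereby dominated by a telescoping one. *)
have key n : n.+1%:R `^ b * (u n - u n.+1) <= g / e * (D n - D n.+1).
  pose x : R := n.+1%:R; pose z : R := n.+2%:R.
  pose U := (x / z) `^ g.
  have U0 : 0 <= U by exact: powR_ge0.
  have eg : e / g <= 1 by rewrite ler_pdivrMr// mul1r /e lerBlDr lerDl ltW.
  have := powR_bernoulli (divr_gt0 e0 g0) eg U0.
  rewrite /U -powRrM mulrCA mulfV ?gt_eqF// mulr1 -/U => bern.
  have -> : u n - u n.+1 = x `^ (- g) * (1 - U).
    rewrite mulrBr mulr1 /U powRM ?invr_ge0// -powR_inv1// -powRrM mulN1r.
    by rewrite mulrA -powRD ?pnatr_eq0 ?implybT// addNr powRr0 mul1r.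
  have -> : D n - D n.+1 = x `^ (- e) * (1 - (x / z) `^ e).
    rewrite mulrBr mulr1 powRM ?invr_ge0// -powR_inv1// -powRrM mulN1r.
    by rewrite mulrA -powRD ?pnatr_eq0 ?implybT// addNr powRr0 mul1r.
  rewrite mulrA -powRD ?pnatr_eq0 ?implybT//.
  have -> : b - g = - e by rewrite /e opprB.
  rewrite mulrCA ler_wpM2l ?powR_ge0// -(ler_pM2l (divr_gt0 e0 g0)) mulrA.
  have -> : e / g * (g / e) = 1 by field; rewrite !gt_eqF.
  by rewrite mul1r; move: bern; lra.
have ge0 : 0 <= K * (g / e) by rewrite mulr_ge0// divr_ge0// ltW.
under eq_fun do rewrite abel_identity.
apply: is_cvgD.
  apply/cvg_ex; exists 0.
  have h : K * (n.+1%:R : R) `^ (- e) @[n --> \oo] --> (0 : R).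
    rewrite -(mulr0 K); apply: cvgM; first exact: cvg_cst.
    by rewrite (cvg_shiftS (fun n => n%:R `^ (- e))); exact: cvg_natr_powRN.
  apply/cvgr0Pnorm_lt => eps eps0; move/cvgr0Pnorm_lt : h => /(_ _ eps0).
  apply: filterS => n; apply: le_lt_trans.
  rewrite normrM ger0_norm ?powR_ge0// (le_trans _ (ler_norm _))//.
  apply: (@le_trans _ _ (u n * (K * n.+1%:R `^ b))).
    rewrite ler_wpM2l ?powR_ge0// (le_trans (SK n))// ler_wpM2l//.
    by rewrite ge0_ler_powR ?nnegrE ?ler_nat// ltW.
  by rewrite mulrCA /u -powRD ?pnatr_eq0 ?implybT// [- e](_ : _ = - g + b)// /e; ring.
apply: (@normed_cvg _ R^o (fun n => (u n - u n.+1) * \sum_(0 <= k < n.+1) y k)).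
apply: (@series_le_cvg _ _ (fun n => K * (g / e) * (D n - D n.+1))) => [n|n|n|].
- exact: normr_ge0.
- exact: mulr_ge0.
- rewrite /= normrM (ger0_norm (u_dec n)) -mulrA.
  apply: (@le_trans _ _ ((u n - u n.+1) * (K * n.+1%:R `^ b))).
    by rewrite ler_wpM2l.
  by rewrite mulrCA ler_wpM2l// mulrC.
apply: nondecreasing_is_cvgn.
  by apply: nondecreasing_series => n _ _; exact: mulr_ge0.
exists (K * (g / e)) => _ [n _ <-]; rewrite /series /= -mulr_sumr.
under eq_bigr do rewrite -opprB.
rewrite sumrN telescope_sumr// opprB -[leRHS]mulr1 ler_wpM2l//.
by rewrite /D powR1 gerBl powR_ge0.
Qed.

End AbelSummation.

(** * Measurability of pointwise limits *)

Section MeasurableLimit.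
Context d (T : measurableType d) (R : realType).

(** Cauchy's criterion with countable quantifiers only, so that the set of convergence can be read
    off as measurable. *)
Lemma cvgn_cauchyP (u : nat -> R) : cvgn u <->
  forall m : nat, exists N, forall n, (N <= n)%N -> `|u N - u n| < m.+1%:R^-1.
Proof.
split => [/cvg_ex[l ul] m|uP].
  have e0 : 0 < (m.+1%:R^-1 / 2 : R) by rewrite divr_gt0.
  have /cvgrPdist_lt/(_ _ e0)[N _ NP] := ul.
  exists N => n Nn; have /= h1 := NP N (leqnn N); have /= h2 := NP n Nn.
  rewrite [X in `|X|](_ : _ = (u N - l) + (l - u n)); last by ring.
  rewrite (le_lt_trans (ler_normD _ _))// [ltRHS](splitr m.+1%:R^-1) ltrD//.
  by rewrite distrC.
apply/cauchy_cvgP/cauchy_exP => e e0.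
have [m me] : exists m : nat, m.+1%:R^-1 < e.
  exists (Num.trunc e^-1); rewrite -[ltRHS]invrK ltf_pV2 ?posrE ?invr_gt0//.
  exact: truncnS_gt.
have [N NP] := uP m; exists (u N); exists N => // n Nn /=.
by apply: lt_trans me; exact: NP.
Qed.

Lemma measurable_cvgn (f : nat -> T -> R) : (forall n, measurable_fun setT (f n)) ->
  measurable [set w | cvgn (f ^~ w)].
Proof.
move=> mf.
have -> : [set w | cvgn (f ^~ w)] = \bigcap_m \bigcup_N \bigcap_(n in [set n | (N <= n)%N])
    ((fun w => `|f N w - f n w|) @^-1` `]-oo, m.+1%:R^-1[%classic).
  apply/seteqP; split => w /=.
    move/cvgn_cauchyP => H m _; have [N NP] := H m; exists N => // n /= Nn.
  move=> H; apply/cvgn_cauchyP => m; have [N _ NP] := H m Logic.I.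
  by exists N => n Nn; have := NP n Nn; rewrite /= in_itv.
apply: bigcap_measurable => // m _; apply: bigcup_measurable => // N _.
apply: bigcap_measurable; first by exists N => /=.
move=> n _; rewrite -[X in measurable X]setTI.
apply: (measurableT_comp _ (measurable_funB (mf N) (mf n))) => //.
Qed.

(** Where the sequence diverges, [limn] takes the constant value [point], so the total function is
    measurable on both pieces. *)
Lemma measurable_fun_limn (f : nat -> T -> R) :
  (forall n, measurable_fun setT (f n)) ->
  measurable_fun setT (fun w => limn (f ^~ w)).
Proof.
move=> mf; set D := [set w | cvgn (f ^~ w)].
have mD : measurable D by exact: measurable_cvgn.
have mh : measurable_fun setT (fun w => \1_D w * limn (f ^~ w)).
  apply: (@measurable_fun_cvg _ _ _ _ (fun n w => \1_D w * f n w)) => [n|w _].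
    by apply: measurable_funM => //; exact: measurable_indic.
  have [wD|wD] := pselect (D w).
    by rewrite indicE mem_set// mul1r; under eq_fun do rewrite mul1r; exact: wD.
  rewrite indicE memNset// mul0r; under eq_fun do rewrite mul0r.
  exact: cvg_cst.
have -> : (fun w => limn (f ^~ w)) = (fun w => \1_D w * limn (f ^~ w) +
    \1_(~` D) w * (point : R)).
  apply/funext => w; rewrite !indicE in_setC.
  have [wD|wD] := pselect (D w).
    by rewrite mem_set//= mul1r mul0r addr0.
  by rewrite memNset//= mul0r mul1r add0r dvgP.
apply: measurable_funD => //; apply: measurable_funM => //.
by apply: measurable_indic; exact: measurableC.
Qed.

End MeasurableLimit.

(** * Centred bounds under almost sure convergence *)

Section Limits.
Context d (T : measurableType d) (R : realType) (P : probability T R).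

Lemma limn_einf_ge (h H : nat -> \bar R) l : h n @[n --> \oo] --> l ->
  (forall n, h n <= H n)%E -> (l <= limn_einf H)%E.
Proof.
move=> hl hH; have [<- _] := cvg_limn_einf_sup hl; rewrite !limn_einf_lim.
apply: lee_lim; [exact: is_cvg_einfs|exact: is_cvg_einfs|].
apply: nearW => n; apply: le_ereal_inf_tmp => _ [m nm <-].
by apply: le_trans (hH m); apply: ereal_inf_lbound; exists m.
Qed.

(** Convergence is asked of the minorants [h n] and not of the integrands [H n], whose lower limit
    is then at least [G]. *)
Lemma fatou_le (H : nat -> T -> \bar R) (h : nat -> T -> \bar R) (G : T -> \bar R)
    (B : \bar R) :
  (forall n, measurable_fun setT (H n)) -> (forall n w, 0 <= H n w)%E ->
  (forall n w, h n w <= H n w)%E -> measurable_fun setT G -> (forall w, 0 <= G w)%E ->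
  {ae P, forall w, h n w @[n --> \oo] --> G w} ->
  (forall n, \int[P]_w H n w <= B)%E -> (\int[P]_w G w <= B)%E.
Proof.
move=> mH H0 hH mG G0 hG HB.
apply: (@le_trans _ _ (\int[P]_w limn_einf (H^~ w))%E).
  apply: ae_ge0_le_integral => //.
  - move=> w _; apply: (@limn_einf_ge (fun=> 0%E)) => //; exact: cvg_cst.
  - rewrite /limn_einf; apply: measurableT_comp => //.
    by apply: measurable_fun_limn_esup => n; apply: measurableT_comp.
  - by apply: filterS hG => w hw _; exact: limn_einf_ge hw (fun n => hH n w).
apply: (le_trans (fatou P measurableT mH (fun n w _ => H0 n w))).
rewrite limn_einf_lim; apply: lime_le; first exact: is_cvg_einfs.
apply: nearW => n; apply: (@le_trans _ _ (\int[P]_w H n w)%E); last exact: HB.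
by apply: ereal_inf_lbound; exists n => /=.
Qed.

Lemma bounded_cluster (e : nat -> R) M : (forall n, `|e n| <= M) ->
  exists l : R, forall n eps, 0 < eps -> exists m, (n <= m)%N /\ `|l - e m| < eps.
Proof.
move=> eM; have [|l [_ lc]] := @segment_compact R (- M) M (e @ \oo) _.
  by exists 0%N => // n _ /=; rewrite in_itv/= -ler_norml.
exists l => n eps eps0.
have [||x [[m nm <-] lm]] := lc [set e m | m in [set m | (n <= m)%N]] (ball l eps).
- by exists n => // m nm /=; exists m.
- exact: nbhsx_ballx.
by exists m.
Qed.

Variables (F : nat -> T -> R) (G : T -> R) (q b : R).
Hypotheses (q1 : 1 < q) (q2 : q <= 2) (mG : measurable_fun setT G).
Hypothesis FG : {ae P, forall w, F n w @[n --> \oo] --> G w}.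
Hypothesis Fb : forall n, exists e, Lp_le P q (fun w => F n w - e) b.

Let q0 : 0 < q. Proof. exact: lt_trans q1. Qed.

Let cvg_subseq (u : nat -> R) (l : R) (f : nat -> nat) : (forall n, (n <= f n)%N) ->
  u n @[n --> \oo] --> l -> u (f n) @[n --> \oo] --> l.
Proof.
move=> fn ul; apply: (cvg_comp _ _ _ ul) => A [N _ NA].
by exists N => // n Nn /=; apply: NA => /=; exact: leq_trans (fn n).
Qed.

(** Otherwise, along a subsequence, |F - e| tends to infinity almost surely, since [F] converges,
    while its q-th moments stay below b ^ q: this contradicts Fatou's lemma. *)
Lemma centering_bounded (e : nat -> R) :
  (forall n, Lp_le P q (fun w => F n w - e n) b) ->
  exists M, forall n, `|e n| <= M.
Proof.
move=> eb; apply: contrapT => unb.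
have /choice[f Hf] : forall n : nat, exists m, (n <= m)%N /\ n%:R <= `|e m|.
  move=> n; apply: contrapT => nex; apply: unb.
  exists (n%:R + \sum_(0 <= k < n) `|e k|) => m.
  have [mn|nm] := ltnP m n.
    rewrite big_mkord (bigD1 (Ordinal mn))//= addrCA lerDl addr_ge0//.
    by rewrite sumr_ge0.
  rewrite ler_wpDr ?sumr_ge0// leNgt; apply/negP => /ltW ne.
  by apply: nex; exists m.
have mH n : measurable_fun setT (fun w => `|F (f n) w - e (f n)| `^ q).
  by have [mF _ _] := eb (f n); exact: measurable_norm_powR.
have : (\int[P]_w (+oo : \bar R) <= (b `^ q)%:E)%E.
  apply: (@fatou_le (fun n w => (`|F (f n) w - e (f n)| `^ q)%:E)
    (fun n w => (n%:R - (`|F (f n) w| + 1))%:E)) => //.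
  - by move=> n; apply/measurable_EFinP.
  - move=> n w; rewrite lee_fin.
    set u := `|_ - _|.
    (* A linear minorant of the power is enough: u ^ q >= u - 1 >= |e| - |F| - 1. *)
    have uq : u <= u `^ q + 1.
      have [u1|/ltW u1] := leP u 1; first by rewrite ler_wpDl ?powR_ge0.
      by rewrite ler_wpDr// le1r_powR// ltW.
    have [_ ne] := Hf n.
    have : `|e (f n)| <= u + `|F (f n) w|.
      rewrite /u distrC; apply: le_trans (ler_normD _ _).
      by rewrite subrK.
    lra.
  - apply: filterS FG => w Fw.
    have Fw' := cvg_subseq (fun n => (Hf n).1) Fw.
    apply/cvgeyPge => A.
    have [M [_ FM]] := cvg_seq_bounded (cvgP _ Fw').
    have FM' n : `|F (f n) w| <= M + 1 by apply: FM => //; rewrite ltrDl.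
    have h : \forall n \near \oo, A + (M + 1 + 1) < n%:R by exact: nbhs_infty_gtr.
    apply: filterS h => n h; rewrite lee_fin.
    have := FM' n; lra.
  - by move=> n; have [_ _ h] := eb (f n).
by rewrite integral_cst//= probability_setT mule1 leye_eq.
Qed.

(* Along a subsequence the unknown centerings converge to some l, which is within
   b of the mean of the limit. The integrands of Fatou's lemma are replaced by
   the tangents of |.|^q at the limit, which avoids the continuity of powers. *)
Lemma Lp_le_limit : Lp_le P q (fun w => G w - \int[P]_w G w) (b + b).
Proof.
have [e eb] := choice Fb.
have [M eM] := centering_bounded eb.
have [l lP] := bounded_cluster eM.
have /choice[f Hf] : forall n : nat, exists m, (n <= m)%N /\ `|l - e m| < n.+1%:R^-1.
  by move=> n; apply: lP.
have [_ b0 _] := eb 0%N.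
have el : e (f n) @[n --> \oo] --> l.
  apply/cvgrPdist_lt => eps eps0.
  have [N NP] : exists N, N.+1%:R^-1 < eps.
    exists (Num.trunc eps^-1); rewrite -[ltRHS]invrK ltf_pV2 ?posrE ?invr_gt0//.
    exact: truncnS_gt.
  exists N => // n /= Nn; have [_ h] := Hf n; apply: (lt_trans h).
  by apply: le_lt_trans NP; rewrite lef_pV2 ?posrE// ler_nat.
have Gl : Lp_le P q (fun w => G w - l) b.
  have mGl : measurable_fun setT (fun w => G w - l).
    by apply: measurable_funB => //; exact: measurable_cst.
  split => //.
  apply: (@fatou_le (fun n w => (`|F (f n) w - e (f n)| `^ q)%:E)
    (fun n w => (`|G w - l| `^ q + q * sgpow (q - 1) (G w - l) *
       ((F (f n) w - e (f n)) - (G w - l)))%:E)) => //.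
  - by move=> n; apply/measurable_EFinP; have [mF _ _] := eb (f n); exact: measurable_norm_powR.
  - by move=> n w; rewrite lee_fin powR_tangent.
  - by apply/measurable_EFinP; exact: measurable_norm_powR.
  - apply: filterS FG => w Fw; have Fw' := cvg_subseq (fun n => (Hf n).1) Fw.
    apply: cvg_EFin; first exact: nearW.
    rewrite /= -[X in _ --> X]addr0; apply: cvgD; first exact: cvg_cst.
    rewrite -(mulr0 (q * sgpow (q - 1) (G w - l))).
    apply: cvgM; first exact: cvg_cst.
    rewrite -(subrr (G w - l)); apply: cvgB; last exact: cvg_cst.
    exact: cvgB.
  - by move=> n; have [_ _ h] := eb (f n).
have q1' : 1 <= q by exact: ltW.
have iGl := Lp_le_integrable q1' Gl.
have il : P.-integrable setT (EFin \o (fun _ : T => l)).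
  exact: Lp_le_integrable q1' (Lp_le_cst P q l).
have iG : P.-integrable setT (EFin \o G).
  have := integrableD measurableT iGl il; apply: eq_integrable => // w _ /=.
  by rewrite -EFinD subrK.
have mean : `|l - \int[P]_w G w| <= b.
  have := Lp_le_mean q1' Gl; rewrite RintegralB// Rintegral_cst//=.
  by rewrite probability_setT mulr1 distrC.
have := Lp_leD q1' Gl (Lp_leW q0 mean (Lp_le_cst P q _)).
rewrite (_ : (fun w => _ + _) = (fun w => G w - \int[P]_w G w))//.
by apply/funext => w; ring.
Qed.

End Limits.

(** * Series of pairwise independent variables *)

Section SeriesConvergence.
Context d (T : measurableType d) (R : realType) (P : probability T R).

(** The rescaled coefficients (n + 1) ^ g a_n are bounded, so by orthogonality the rescaled block
    sums have order N ^ (1 / 2) in L^2. Chaining gives almost sure growth with an exponent midway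
    between 1 / 2 and [g], and Abel summation with weights (n + 1) ^ (- g) gives convergence. *)
Lemma ae_cvg_series (X : nat -> T -> R) (a : nat -> R) v C g : 2^-1 < g ->
  (forall n m, n != m -> indep2 P (X n) (X m)) ->
  (forall n, \int[P]_w X n w = 0) -> (forall n, Lp_le P 2 (X n) v) ->
  (forall n, `|a n| <= C * n.+1%:R `^ (- g)) ->
  {ae P, forall w, cvgn (fun N => \sum_(0 <= n < N) a n * X n w)}.
Proof.
move=> g2 indX X0 Xv aC.
have one2 : 1 <= (2 : R) by rewrite ler1n.
have v0 : 0 <= v by have [] := Xv 0%N.
have C0 : 0 <= C by have := aC 0%N; rewrite powR1 mulr1; apply: le_trans.
pose bb n := n.+1%:R `^ g * a n.
have bC n : `|bb n| <= C.
  rewrite /bb normrM (ger0_norm (powR_ge0 _ _)) mulrC.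
  have := aC n; rewrite powRN ler_pdivlMr ?powR_gt0//.
pose Y n w := bb n * X n w.
have Yv n : Lp_le P 2 (Y n) (C * v).
  by apply: Lp_leW (Lp_leZ (bb n) _ (Xv n)) => //; rewrite ler_wpM2r.
have iX n : P.-integrable setT (EFin \o X n) := Lp_le_integrable one2 (Xv n).
have gram i j : `|\int[P]_w (Y i w * Y j w)| <= (i == j)%:R * (C * v) ^+ 2.
  have [<-|ij] := eqVneq i j.
    rewrite mul1r; have [mY Cv0 _] := Yv i; have /(Lp_le2P P mY Cv0) Y2 := Yv i.
    under eq_Rintegral do rewrite -expr2.
    rewrite ger0_norm; last by rewrite Rintegral_ge0// => w _; rewrite sqr_ge0.
    rewrite -lee_fin (le_trans _ Y2)// /Rintegral fineK//.
    have := integrableM_Lp2 (Yv i) (Yv i).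
    by under [X in _ \o X]funext do rewrite -expr2; exact: integrable_fin_num.
  have E w : Y i w * Y j w = bb i * bb j * (X i w * X j w) by rewrite /Y; ring.
  under eq_Rintegral do rewrite E.
  rewrite RintegralZl//; last exact: integrableM_indep2 (indX i j ij) (iX i) (iX j).
  by rewrite (integralM_indep2 (indX i j ij) (iX i) (iX j)) X0 mul0r mulr0 normr0 mul0r.
have Sb i j : (i <= j)%N -> Lp_le P 2 (fun w => \sum_(i <= k < j) Y k w)
    (C * v * (j - i)%:R `^ 2^-1).
  move=> ij; have := Lp2_gram (index_iota i j) Yv gram.
  set S := Num.sqrt _; suff -> : S = C * v * (j - i)%:R `^ 2^-1 by [].
  rewrite /S powR12_sqrt//.
  have -> : \sum_(j0 <- index_iota i j) \sum_(k <- index_iota i j)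
      (j0 == k)%:R * (C * v) ^+ 2 = (C * v) ^+ 2 * (j - i)%:R.
    under eq_big_seq => k kij.
      rewrite -mulr_suml (bigD1_seq k)//= ?iota_uniq// eqxx big1 ?addr0 ?mul1r; last first.
        by move=> k'; rewrite eq_sym => /negPf ->.
      over.
    by rewrite sumr_const_nat mulr_natr.
  by rewrite sqrtrM ?sqr_ge0// sqrtr_sqr ger0_norm// mulr_ge0.
have h1 : 1 <= (2^-1 : R) * 2 by rewrite mulVf.
have hb : 2^-1 < (2^-1 + g) / 2 by lra.
have hg : (2^-1 + g) / 2 < g by lra.
have := partial_sums_growth one2 h1 hb Sb; apply: filterS => w [K HK].
have b0 : 0 < (2^-1 + g) / 2 by lra.
suff E : (fun N => \sum_(0 <= n < N) a n * X n w) =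
    (fun N => \sum_(0 <= n < N) n.+1%:R `^ (- g) * Y n w).
  by rewrite E; exact: cvg_abel_powR b0 hg HK.
apply/funext => N; apply: eq_bigr => n _.
by rewrite /Y /bb !mulrA -powRD ?pnatr_eq0 ?implybT// addNr powRr0 mul1r.
Qed.

End SeriesConvergence.

(** * Linear processes *)

Lemma succ_absz_le (k l : int) : (`|l|%N.+1 <= `|(k - l)%R|%N.+1 * `|k|%N.+1)%N.
Proof.
have h : (`|l| <= `|(k - l)%R|%N + `|k|)%N by lia.
rewrite mulSn mulnS addnA; apply: leq_trans (leq_addr _ _).
by rewrite addSn ltnS addnC.
Qed.

Section LinearProcess.
Context d (T : measurableType d) (R : realType) (P : probability T R).
Variables (xi : int -> {RV P >-> R}) (c : int -> R) (s : nat).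
Variables (q K v Cc g0 : R) (m : nat -> R).
Hypotheses (q1 : 1 < q) (q2 : q <= 2) (K0 : 0 <= K) (s_gt0 : (0 < s)%N).
Hypotheses (g_gt : 2^-1 < g0) (g_lt : g0 < 1).
Hypothesis xi_ind : mutually_independent P (fun l : int => xi l : T -> R).
Hypothesis xi0 : forall l, \int[P]_w xi l w = 0.
Hypothesis xiv : forall l, Lp_le P 2 (xi l) v.
Hypothesis xiK : forall l a, admissible_block s a -> Lp_le P q (fun w => xi l w ^+ a) K.
Hypothesis xim : forall l a, admissible_block s a -> \int[P]_w (xi l w ^+ a) = m a.
Hypothesis cg : forall l : int, `|c l| <= Cc * decay_kernel g0 `|l|%N.
Notation g := (decay_kernel g0).

Let Cc0 : 0 <= Cc.
Proof. by have := cg 0; rewrite /decay_kernel powR1 mulr1; apply: le_trans. Qed.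

(** The two summands match the two halves of [two_sided_sum], cut at the same length. *)
Definition window L (i : 'I_L + 'I_L) : int :=
  match i with inl n => (n : nat)%:Z | inr n => - n.+1%:Z end.

Lemma window_inj L : injective (@window L).
Proof.
move=> [i|i] [j|j] /= ij; [congr inl| | |congr inr]; try apply/val_inj => /=.
- by case: ij.
- by lia.
- by lia.
- by lia.
Qed.

Let C0 := Cc ^+ 2 * (2 * (1 + (2 * g0 - 1)^-1)).

Let C00 : 0 <= C0.
Proof.
rewrite mulr_ge0 ?sqr_ge0// mulr_ge0// addr_ge0// invr_ge0.
by move: g_gt; lra.
Qed.

Lemma sum_coef_sqr (t : seq int) : uniq t -> \sum_(l <- t) c l ^+ 2 <= C0.
Proof.
move=> ut; apply: (@le_trans _ _ (Cc ^+ 2 * \sum_(l <- t) g `|l|%N ^+ 2)).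
  rewrite mulr_sumr; apply: ler_sum => l _.
  by rewrite -exprMn -[leLHS]real_normK ?num_real// lerXn2r ?nnegrE ?mulr_ge0 ?powR_ge0.
rewrite ler_wpM2l ?sqr_ge0//.
pose N := (\max_(l <- t) `|l|%N).+1.
have tN l : l \in t -> (`|l| < N)%N.
  by move=> lt; rewrite ltnS (bigD1_seq l)//= leq_maxl.
apply: (le_trans (sumr_absz_le (f := fun n => g n ^+ 2) (fun n => sqr_ge0 _) ut tN)).
by rewrite ler_wpM2l// sum_decay_kernel_sqr.
Qed.

(** Row [k] is time [k.+1]: blocks are counted from 0, while the sums of the theorem start at time
    1. *)
Let cw L (k : nat) (i : 'I_L + 'I_L) := c (k.+1%:Z - window i).
Let Xw L (i : 'I_L + 'I_L) : T -> R := xi (window i).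

Lemma window_admissible L : admissible P q K v C0 m s (@Xw L) (@cw L).
Proof.
split.
- by move=> i; exact: measurable_funPT.
- exact: indep_family_reindex (@window_inj L) xi_ind.
- by move=> i; exact: xi0.
- by move=> i; exact: xiv.
- by move=> i a; exact: xiK.
- by move=> i a; exact: xim.
- move=> k; rewrite -(big_map (fun i => k.+1%:Z - @window L i) predT (fun l => c l ^+ 2)).
  apply: sum_coef_sqr; rewrite map_inj_uniq ?index_enum_uniq//.
  by move=> i j /addrI/oppr_inj/window_inj.
- move=> i n0 n1; rewrite -(big_map (fun k => k.+1%:Z - @window L i) predT (fun l => c l ^+ 2)).
  apply: sum_coef_sqr; rewrite map_inj_uniq ?iota_uniq// => j k.
  by move=> /addIr[].
Qed.

Lemma window_correlation L j k :
  \sum_i `|@cw L j i * @cw L k i| <=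
  Cc ^+ 2 * (4 * kernel_const g0) * `|(j%:Z - k%:Z)%R|%N.+1%:R `^ (- (2 * g0 - 1)).
Proof.
apply: (@le_trans _ _ (Cc ^+ 2 *
    \sum_i g `|(j.+1%:Z - @window L i)%R|%N * g `|(j.+1%:Z - @window L i + (k%:Z - j%:Z))%R|%N)).
  rewrite mulr_sumr; apply: ler_sum => i _; rewrite normrM expr2 mulrACA.
  have -> : j.+1%:Z - window i + (k%:Z - j%:Z) = k.+1%:Z - window i by lia.
  by apply: ler_pM => //; exact: cg.
rewrite -[leRHS]mulrA ler_wpM2l ?sqr_ge0//.
rewrite -(big_map (fun i => j.+1%:Z - @window L i) predT
  (fun l => g `|l|%N * g `|(l + (k%:Z - j%:Z))%R|%N)).
rewrite -(abszN (j%:Z - k%:Z)) opprB.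
apply: sum_kernel_shift => //; rewrite map_inj_uniq ?index_enum_uniq//.
by move=> i i' /addrI/oppr_inj/window_inj.
Qed.

Variables (r0 : nat) (e : R).
Hypothesis r0P : r0 = 1%N \/ r0 = 2 /\
  (s = 2 \/ ~~ odd s /\ forall a, odd a -> admissible_block s a -> m a = 0).
Hypotheses (e0 : 0 < e) (e1 : e < 1) (e_le : e <= (2 * g0 - 1) * r0%:R).

(** The growth exponent of a block: 1 / q comes from the centred terms, 1 - e / 2 from the
    correlated ones. *)
Let gam := Num.max q^-1 (1 - e / 2).

Let powR_gam (N : nat) b : 0 < b -> b <= gam -> (N%:R : R) `^ b <= N%:R `^ gam.
Proof.
move=> b0 bg; case: N => [|N]; last by rewrite ler_powR// ler1n.
by rewrite !powR0// gt_eqF//; exact: lt_le_trans bg.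
Qed.

Lemma window_block_bound : exists2 C, 0 <= C & forall L n0 n1, exists e',
  Lp_le P q (fun w => \sum_(n0 <= k < n1)
    (\sum_(i : 'I_L + 'I_L) c (k.+1%:Z - window i) * xi (window i) w) ^+ s - e')
  (C * (n1 - n0)%:R `^ gam).
Proof.
have mK a : admissible_block s a -> `|m a| <= K.
  by move=> sa; rewrite -(xim 0 sa); apply: Lp_le_mean (xiK 0 sa); exact: ltW.
have [C C_ge0 HC] := Lp_le_linear_form_power P v q1 q2 K0 C00 mK r0P s_gt0.
set D := (Cc ^+ 2 * (4 * kernel_const g0)).
have kc0 : 0 <= D.
  have := window_correlation 0%N 0%N 0%N; rewrite subrr/= powR1 mulr1.
  by apply: le_trans; exact: sumr_ge0.
pose D' := D ^+ r0 * (2 / (1 - e)).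
have D'0 : 0 <= D' by rewrite mulr_ge0 ?exprn_ge0// divr_ge0// subr_ge0 ltW.
have q0 : 0 < q by exact: lt_trans q1.
exists (C * (1 + Num.sqrt D')); first by rewrite mulr_ge0// addr_ge0.
move=> L n0 n1; have [e' He'] := HC _ _ _ (window_admissible L) n0 n1; exists e'.
apply: Lp_leW He' => //; rewrite -mulrA ler_wpM2l// mulrDl mul1r lerD//.
  by rewrite powR_gam ?invr_gt0// /gam le_max lexx.
have Ne : 0 < 1 - e / 2 by move: e1; lra.
apply: (@le_trans _ _ (Num.sqrt D' * (n1 - n0)%:R `^ (1 - e / 2))); last first.
  by rewrite ler_wpM2l// powR_gam// /gam le_max lexx orbT.
rewrite -[X in _ * X](@ger0_norm R) ?powR_ge0// -sqrtr_sqr -sqrtrM//.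
apply: ler_wsqrtr; rewrite -powR_mulrn ?powR_ge0// -powRrM.
have -> : (1 - e / 2) * 2 = 2 - e by field.
rewrite /D' -[leRHS]mulrA.
apply: le_trans (ler_wpM2l (exprn_ge0 r0 kc0) (sum_block_powR_le n0 n1 e0 e1)).
rewrite mulr_sumr; apply: ler_sum => j _; rewrite mulr_sumr; apply: ler_sum => k _.
apply: (@le_trans _ _ ((D * `|(j%:Z - k%:Z)%R|%N.+1%:R `^ (- (2 * g0 - 1))) ^+ r0)).
  apply: lerXn2r; rewrite ?nnegrE; [exact: sumr_ge0|exact: mulr_ge0 kc0 (powR_ge0 _ _)|].
  exact: window_correlation.
(* The base is at least 1, so [e_le] allows the exponent -(2 g0 - 1) r0 to be replaced by -e. *)
rewrite exprMn ler_wpM2l ?exprn_ge0// -powR_mulrn ?powR_ge0// -powRrM.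
by rewrite ler_powR ?ler1n// mulNr lerN2.
Qed.

(** With [succ_absz_le], translating the kernel by [k] costs only the constant (|k| + 1) ^ g0. *)
Lemma decay_kernel_shift a h n : (n.+1 <= a.+1 * h.+1)%N -> g a <= h.+1%:R `^ g0 * g n.
Proof.
move=> nah; have -> : g a = h.+1%:R `^ g0 * (a.+1%:R * h.+1%:R) `^ (- g0).
  by rewrite powRM// mulrCA -powRD ?pnatr_eq0 ?implybT// subrr powRr0 mulr1.
rewrite ler_wpM2l ?powR_ge0// -natrM.
have := @decay_kernel_le R g0 g_gt n (a.+1 * h.+1).-1 nah.
by rewrite /decay_kernel prednK.
Qed.

Lemma xi_indep2 l l' : l != l' -> indep2 P (xi l) (xi l').
Proof.
move=> ll'; pose f (b : bool) := if b then l else l'.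
have finj : injective f by case=> -[]//= E; rewrite E eqxx in ll'.
have ind := indep_family_reindex finj xi_ind.
have mX b : measurable_fun setT (xi (f b) : T -> R) by exact: measurable_funPT.
apply: (@depends_on_indep2 _ T R P bool (fun b => xi (f b) : T -> R) mX [set true]%SET false).
- exact: ind.
- by rewrite !inE.
- by apply: (depends_onX (fun b => xi (f b) : T -> R) (i := true)); rewrite inE.
Qed.

Let x := linear_process c (fun l : int => xi l : T -> R).

Lemma measurable_linear_process k : measurable_fun setT (x k).
Proof.
apply: measurable_funD; apply: measurable_fun_limn => N;
  by apply: measurable_sum => n; apply: measurable_funM => //; exact: measurable_cst.
Qed.

Lemma ae_cvg_half_process k (f : nat -> int) : injective f ->
  (forall n, (n <= `|f n|)%N) ->
  {ae P, forall w, cvgn (fun N => \sum_(0 <= n < N) c (k - f n) * xi (f n) w)}.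
Proof.
move=> finj fh.
apply: (@ae_cvg_series _ T R P (fun n => xi (f n) : T -> R) _ v (Cc * `|k|%N.+1%:R `^ g0) _ g_gt).
- by move=> n n' nn'; apply: xi_indep2; rewrite (inj_eq finj).
- by move=> n; exact: xi0.
- by move=> n; exact: xiv.
- move=> n; apply: (le_trans (cg _)); rewrite -mulrA ler_wpM2l//.
  apply: decay_kernel_shift; apply: leq_trans (succ_absz_le k (f n)).
  by rewrite ltnS fh.
Qed.

Lemma ae_cvg_linear_process k : {ae P, forall w,
  (\sum_(i : 'I_L + 'I_L) c (k - window i) * xi (window i) w) @[L --> \oo] --> x k w}.
Proof.
have posinj : injective (fun n : nat => n%:Z) by move=> ? ? [].
have neginj : injective (fun n : nat => - n.+1%:Z) by move=> i j /oppr_inj[].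
have H1 := @ae_cvg_half_process k (fun n => n%:Z) posinj.
have H2 := @ae_cvg_half_process k (fun n => - n.+1%:Z) neginj.
apply: filterS2 (H1 _) (H2 _) => [w /= c1 c2|n|n]; last 2 first.
- by [].
- by rewrite abszN.
rewrite /x /linear_process /two_sided_sum.
have -> : (fun L => \sum_(i : 'I_L + 'I_L) c (k - window i) * xi (window i) w) =
  (fun L => \sum_(0 <= n < L) c (k - n%:Z) * xi n%:Z w) \+
  (fun L => \sum_(0 <= n < L) c (k - - n.+1%:Z) * xi (- n.+1%:Z) w).
  by apply/funext => L /=; rewrite big_sumType /= !big_mkord.
exact: cvgD.
Qed.

Let q1' : 1 <= q. Proof. exact: ltW. Qed.

Let block_limit : exists2 C, 0 <= C & forall n0 n1,
  Lp_le P q (fun w => \sum_(n0 <= k < n1) x k.+1%:Z w ^+ s -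
      \int[P]_w (\sum_(n0 <= k < n1) x k.+1%:Z w ^+ s))
    (C * (n1 - n0)%:R `^ gam).
Proof.
have [C C_ge0 HC] := window_block_bound; exists (C + C); first exact: addr_ge0.
move=> n0 n1; rewrite mulrDl.
apply: (Lp_le_limit q1 _ _ (fun L => HC L n0 n1)).
  by apply: measurable_sum => k; apply: measurable_funX; exact: measurable_linear_process.
(* The times are countably many, so one null set serves all of them. *)
have /ae_foralln : forall k : nat, {ae P, forall w,
    (\sum_(i : 'I_L + 'I_L) c (k.+1%:Z - window i) * xi (window i) w) @[L --> \oo] -->
    x k.+1%:Z w} by move=> k; exact: ae_cvg_linear_process.
apply: filterS => w xw; elim: (index_iota n0 n1) => [|k t IH].
  by under eq_fun do rewrite big_nil; rewrite big_nil; exact: cvg_cst.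
under eq_fun do rewrite big_cons; rewrite big_cons; apply: cvgD => //.
by have := cvg_comp _ _ (xw k) (@exprn_continuous R s (x k.+1%:Z w)).
Qed.

(** [block_limit] for a block of one time puts the power minus some real constant in L^q. Whatever
    value [Rintegral] has there, adding the constant back gives integrability. *)
Lemma integrable_linear_process_power (k : nat) :
  P.-integrable setT (EFin \o (fun w => x k.+1%:Z w ^+ s)).
Proof.
have [C _ /(_ k k.+1)] := block_limit; set a := Rintegral _ _ _.
under [X in Lp_le _ _ X _]funext do rewrite big_nat1.
move=> /(Lp_le_integrable q1') i1.
have i2 := Lp_le_integrable q1' (Lp_le_cst P q a).
have := integrableD measurableT i1 i2; apply: eq_integrable => // w _ /=.
by rewrite -EFinD subrK.
Qed.

Lemma centered_block_bound : exists2 C, 0 <= C & forall n0 n1,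
  Lp_le P q (fun w => \sum_(n0 <= k < n1)
      (x k.+1%:Z w ^+ s - \int[P]_w (x k.+1%:Z w ^+ s)))
    (C * (n1 - n0)%:R `^ gam).
Proof.
have [C C_ge0 HC] := block_limit; exists C; first exact: C_ge0.
move=> n0 n1.
have := HC n0 n1; rewrite Rintegral_sum; last first.
  by move=> k _; exact: integrable_linear_process_power.
by under [X in Lp_le _ _ X _ -> _]funext do rewrite -sumrB.
Qed.

Lemma power_slln_linear_process p : 0 < p -> q^-1 < p^-1 -> 1 - e / 2 < p^-1 ->
  power_slln P x s p.
Proof.
move=> p0 qp ep.
have gp : gam < p^-1 by rewrite /gam gt_max qp ep.
have q0 : 0 < q by exact: lt_trans q1.
have gq : 1 <= gam * q.
  by rewrite -(mulVf (lt0r_neq0 q0)) ler_wpM2r ?(ltW q0)// /gam le_max lexx.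
(* The midpoint leaves room below for the chaining and above for the convergence to 0. *)
have gb : gam < (gam + p^-1) / 2 by lra.
have bp : (gam + p^-1) / 2 < p^-1 by lra.
have [C C_ge0 HC] := centered_block_bound.
have := partial_sums_growth q1' gq gb (fun i j _ => HC i j).
apply: filterS => w [M HM].
rewrite (_ : (fun n => _) = EFin \o (fun n : nat => n%:R `^ (- p^-1) *
  \sum_(0 <= k < n) (x k.+1%:Z w ^+ s - \int[P]_w (x k.+1%:Z w ^+ s)))).
  by apply: cvg_EFin (cvg_partial_sums_growth bp HM); exact: nearW.
apply/funext => n /=; rewrite EFinM; congr (_ * _)%E.
rewrite big_add1 /= -sumEFin; apply: eq_bigr => k _; rewrite EFinB; congr (_ - _)%E.
rewrite unlock /Rintegral fineK//.
exact: integrable_fin_num (integrable_linear_process_power k).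
Qed.

End LinearProcess.

(** * From the hypotheses of the theorem to kernel, exponents and moments *)

Lemma ereal_sup_lt_pinfty (R : realType) (A : set (\bar R)) : (ereal_sup A < +oo)%E ->
  exists M : R, forall y, A y -> (y <= M%:E)%E.
Proof.
move=> supA; exists (fine (ereal_sup A)) => y Ay.
have yA : (y <= ereal_sup A)%E by exact: ereal_sup_ubound.
move: supA yA; case: (ereal_sup A) => [r|//|] // _.
by rewrite leeNy_eq => /eqP ->; rewrite leNye.
Qed.

(** The factor 2 comes from n + 1 <= 2 n for n >= 1. At l = 0 the weight is 0 and the supremum says
    nothing about [c 0], which is therefore added to the constant. *)
Lemma decay_kernel_bound (R : realType) (c : int -> R) (sigma g0 : R) : 0 <= g0 -> g0 <= 1 ->
  g0 <= sigma ->
  (ereal_sup [set ((`|l|%N%:R `^ sigma) * `|c l|)%:E | l in [set: int]] < +oo)%E ->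
  exists C, forall l : int, `|c l| <= C * decay_kernel g0 `|l|%N.
Proof.
move=> g00 g01 gs /ereal_sup_lt_pinfty[M HM]; exists (2 * M + `|c 0|) => l.
have lM (l' : int) : (`|l'|%N%:R `^ sigma) * `|c l'| <= M.
  by rewrite -lee_fin; apply: HM; exists l'.
have M0 : 0 <= M by apply: le_trans (lM 0); rewrite mulr_ge0 ?powR_ge0.
rewrite /decay_kernel powRN ler_pdivlMr ?powR_gt0//.
have [->|l0] := eqVneq l 0; first by rewrite powR1 mulr1 lerDr mulr_ge0.
have n0 : (0 < `|l|)%N by rewrite absz_gt0.
set n := `|l|%N in n0 *.
apply: (@le_trans _ _ (2 * (n%:R `^ sigma * `|c l|))); last first.
  by rewrite (le_trans (ler_wpM2l _ (lM l)))// lerDl.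
rewrite mulrA mulrC ler_wpM2r//.
apply: (@le_trans _ _ ((2 * n%:R) `^ g0)).
  apply: ge0_ler_powR; rewrite ?nnegrE ?mulr_ge0//.
  by rewrite -natrM ler_nat; lia.
rewrite powRM//; apply: ler_pM; rewrite ?powR_ge0//.
  by rewrite -[leRHS]powRr1// ler_powR// ler1n.
by rewrite ler_powR// ler1n.
Qed.

(** Here [u] stands for 1 / p. Lowering [sigma] by [dl], at most a quarter of each strict gap, keeps
    both inequalities strict, since r0 <= 2. *)
Lemma exponents_ex (R : realType) (sigma u : R) (r0 : nat) : (r0 == 1)%N || (r0 == 2)%N ->
  2^-1 < sigma -> sigma <= 1 -> 2^-1 < u -> 1 - (2 * sigma - 1) * r0%:R / 2 < u ->
  exists g0 e, [/\ 2^-1 < g0, g0 < 1 & g0 <= sigma] /\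
    [/\ 0 < e, e < 1, e <= (2 * g0 - 1) * r0%:R & 1 - e / 2 < u].
Proof.
move=> r0P s2 s1 u2 su.
pose dl := Num.min ((2 * sigma - 1) / 4) ((u - (1 - (2 * sigma - 1) * r0%:R / 2)) / 4).
have dl0 : 0 < dl by rewrite lt_min; apply/andP; split; lra.
have dl1 : dl <= (2 * sigma - 1) / 4 by rewrite ge_min lexx.
have dl2 : dl <= (u - (1 - (2 * sigma - 1) * r0%:R / 2)) / 4 by rewrite ge_min lexx orbT.
have rE : (2 * (sigma - dl) - 1) * r0%:R = (2 * sigma - 1) * r0%:R - 2 * (dl * r0%:R) by ring.
have dr : dl <= dl * r0%:R <= 2 * dl by case/orP: r0P => /eqP ->; lra.
have sr : 2 * sigma - 1 <= (2 * sigma - 1) * r0%:R by case/orP: r0P => /eqP ->; lra.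
exists (sigma - dl).
have E0 : 0 < (2 * (sigma - dl) - 1) * r0%:R.
  by rewrite mulr_gt0//; [lra|case/orP: r0P => /eqP ->].
(* The midpoint of max (0, 2 - 2 u) and 1, an interval that is nonempty because u > 1 / 2; it serves
   as [e] when the available exponent is at least as large. *)
pose e1 := (Num.max 0 (2 - 2 * u) + 1) / 2.
have h1 : 0 <= Num.max 0 (2 - 2 * u) by rewrite le_max lexx.
have h2 : 2 - 2 * u <= Num.max 0 (2 - 2 * u) by rewrite le_max lexx orbT.
have h3 : Num.max 0 (2 - 2 * u) < 1 by rewrite gt_max; apply/andP; split; lra.
have e10 : 0 < e1 by rewrite /e1; lra.
have e11 : e1 < 1 by rewrite /e1; lra.
have e1u : 1 - e1 / 2 < u by rewrite /e1; lra.
have Eu : 1 - (2 * (sigma - dl) - 1) * r0%:R / 2 < u by rewrite rE; lra.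
have [le1|/ltW le1] := leP ((2 * (sigma - dl) - 1) * r0%:R) e1.
  exists ((2 * (sigma - dl) - 1) * r0%:R); do !split => //; try lra.
by exists e1; do !split => //; lra.
Qed.

Section Moments.
Context d (T : measurableType d) (R : realType) (P : probability T R).

Lemma Lp_le_dominated q (F G : T -> R) b : 0 < q -> measurable_fun setT G ->
  (forall w, `|G w| <= `|F w|) -> Lp_le P q F b -> Lp_le P q G b.
Proof.
move=> q0 mG GF [mF b0 Fb]; split; [exact: mG|exact: b0|]; apply: le_trans Fb.
apply: ge0_le_integral => //.
- by apply/measurable_EFinP; exact: measurable_norm_powR.
- by apply/measurable_EFinP; exact: measurable_norm_powR.
- by move=> w _; rewrite lee_fin; apply: ge0_ler_powR; rewrite ?nnegrE// ltW.
Qed.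

(** All lower powers are dominated by 1 + |X| ^ s, whose q-th moment is finite by the tail
    condition. *)
Lemma Lp_le_powers (X : T -> R) (s : nat) (alpha q : R) : measurable_fun setT X ->
  1 <= q -> q < alpha ->
  (ereal_sup [set (t `^ alpha)%:E * P [set w | (t < `|X w| ^+ s)%R]
             | t in [set t : R | (1 <= t)%R]] < +oo)%E ->
  exists2 K, 0 <= K & forall a, (a <= s)%N -> Lp_le P q (fun w => X w ^+ a) K.
Proof.
move=> mX q1 qa /ereal_sup_lt_pinfty[M HM].
have q0 : 0 < q by exact: lt_le_trans q1.
have mXs : measurable_fun setT (fun w => `|X w| ^+ s).
  by apply: measurable_funX; exact: measurableT_comp mX.
have fin : (\int[P]_w ((`|X w| ^+ s) `^ q)%:E < +oo)%E.
  apply: (moment_of_tail (K := M) mXs _ q0 qa) => [w|t t1]; first exact: exprn_ge0.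
  by apply: HM; exists t.
have [|K HK] := @Lp_le_ex _ T R P q (fun w => `|X w| ^+ s) q0 mXs.
  by under eq_integral do rewrite ger0_norm ?exprn_ge0//.
have H := Lp_leD q1 (Lp_le_cst P q 1) HK.
exists (`|1| + K) => [|a sa]; first by have [_ + _] := H.
apply: Lp_le_dominated H => //; first exact: measurable_funX.
move=> w; rewrite normrX [leRHS]ger0_norm ?addr_ge0 ?exprn_ge0//.
have [x1|/ltW x1] := leP `|X w| 1.
  by rewrite (@le_trans _ _ 1) ?exprn_ile1 ?lerDl ?exprn_ge0.
by rewrite (le_trans (ler_weXn2l x1 sa))// lerDr.
Qed.

(** Symmetry makes X and -X members of one identically distributed family [Y], so the moment equals
    its own opposite. *)
Lemma symmetric_odd_moment (X : {RV P >-> R}) a : symmetric_rv P X -> odd a ->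
  P.-integrable setT (EFin \o (fun w => X w ^+ a)) -> \int[P]_w (X w ^+ a) = 0.
Proof.
move=> symX aodd iX.
pose Y (l : int) : {RV P >-> R} := if l == 0 then X else - X.
have idY : identically_distributed P (fun l => Y l : T -> R).
  move=> i j A mA; rewrite /Y.
  by case: ifP; case: ifP => _ _ //; rewrite (symX A mA).
have := @Rintegral_id _ T R P Y idY 0 1 (fun y => y ^+ a) (@exprn_measurable R setT a) iX.
have E w : Y 1 w ^+ a = -1 * X w ^+ a.
  by rewrite /Y /= exprNn -signr_odd aodd expr1.
under [X in _ = X -> _]eq_Rintegral do rewrite E.
by rewrite RintegralZl// /Y/= => ?; lra.
Qed.

End Moments.

Section IIDPowers.
Context d (T : measurableType d) (R : realType) (P : probability T R).
Variables (s : nat) (xi : int -> {RV P >-> R}) (c : int -> R) (alpha sigma : R).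
Hypotheses (s_gt0 : (0 < s)%N)
  (xi_iid : iid P (fun l : int => xi l : T -> R))
  (xi_mean0 : forall l : int, ('E_P[xi l] = 0)%E)
  (reg : ('E_P[fun w => (`|xi 1 w| ^+ 2)%R] < +oo)%E)
  (alpha_gt1 : 1 < alpha)
  (tail : (ereal_sup [set (t `^ alpha)%:E * P [set w | (t < `|xi 1 w| ^+ s)%R]
                     | t in [set t : R | (1 <= t)%R]] < +oo)%E)
  (sigma_gt : 2^-1 < sigma) (sigma_le : sigma <= 1)
  (decay : (ereal_sup [set ((`|l|%N%:R `^ sigma) * `|c l|)%:E
                      | l in [set: int]] < +oo)%E).

(** The cases of the theorem differ only in [r0]. The condition involving [alpha] concerns powers of
    exponent at least 2, which occur only if s > 1. *)
Lemma power_slln_iid (r0 : nat) p :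
  r0 = 1%N \/ r0 = 2 /\ (s = 2 \/ ~~ odd s /\ symmetric_rv P (xi 1)) ->
  0 < p -> p < 2 -> ((1 < s)%N -> p < alpha) ->
  1 - (2 * sigma - 1) * r0%:R / 2 < p^-1 ->
  power_slln P (linear_process c (fun l : int => xi l : T -> R)) s p.
Proof.
move=> r0P p0 p2 pa rp; have [xi_ind xi_id] := xi_iid.
have u2 : 2^-1 < p^-1 by rewrite ltf_pV2 ?posrE.
have r012 : (r0 == 1)%N || (r0 == 2)%N by case: r0P => [->|[->]].
have [g0 [e [[g_gt g_lt gs] [e0 e1 e_le eu]]]] := exponents_ex r012 sigma_gt sigma_le u2 rp.
have g00 : 0 <= g0 by rewrite (le_trans _ (ltW g_gt))// invr_ge0.
have [Cc cg] := decay_kernel_bound g00 (ltW g_lt) gs decay.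
(* For s > 1, [q] is the midpoint of max (p, 1) and min (alpha, 2); for s = 1 it is 2. *)
have [q [q1 q2 pq qa]] : exists q, [/\ 1 < q, q <= 2, q^-1 < p^-1 & ((1 < s)%N -> q < alpha)].
  case: (ltnP 1 s) pa => [s1 /(_ isT) pa|s1 _]; last first.
    by exists 2; split; rewrite ?ltr1n.
  have h1 : 1 <= Num.max p 1 by rewrite le_max lexx orbT.
  have h2 : p <= Num.max p 1 by rewrite le_max lexx.
  have h3 : Num.min alpha 2 <= alpha by rewrite ge_min lexx.
  have h4 : Num.min alpha 2 <= 2 by rewrite ge_min lexx orbT.
  have h5 : Num.max p 1 < Num.min alpha 2.
    by rewrite lt_min !gt_max pa alpha_gt1 p2 ltr1n.
  exists ((Num.max p 1 + Num.min alpha 2) / 2); split; [lra|lra| |by move=> _; lra].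
  by rewrite ltf_pV2 ?posrE//; lra.
have xi0 l : \int[P]_w xi l w = 0.
  by rewrite /Rintegral; have := xi_mean0 l; rewrite unlock => ->.
have mxi l : measurable_fun setT (xi l : T -> R) by exact: measurable_funPT.
have fin2 : (\int[P]_w (`|xi 1 w| `^ 2)%:E < +oo)%E.
  by move: reg; rewrite unlock; under eq_integral do rewrite -powR_mulrn//.
have [//|v xi1v] := Lp_le_ex _ (mxi 1) fin2.
have xiv l : Lp_le P 2 (xi l) v.
  by apply: (Lp_le_id xi_id (l := 1) l (f := id)) => //; exact: measurable_id.
have [K [K0 xiK]] : exists K, 0 <= K /\ forall l a, admissible_block s a ->
    Lp_le P q (fun w => xi l w ^+ a) K.
  case: (ltnP 1 s) qa => [s1 /(_ isT) qa|s1 _]; last first.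
    (* For s = 1 there is no block size between 2 and [s], so the bound is vacuous. *)
    exists 0; split; first exact: lexx.
    by move=> l a /andP[a2 /(leq_trans a2)]; rewrite ltnNge s1.
  have [K K0 HK] := Lp_le_powers (mxi 1) (ltW q1) qa tail.
  exists K; split; first exact: K0.
  move=> l a /andP[_ sa].
  apply: (Lp_le_id xi_id (l := 1) l (f := fun y => y ^+ a)); last exact: HK.
  exact: exprn_measurable.
pose m a := \int[P]_w (xi 1 w ^+ a).
have xia l a : admissible_block s a -> P.-integrable setT (EFin \o (fun w => xi l w ^+ a)).
  by move=> sa; exact: Lp_le_integrable (ltW q1) (xiK l a sa).
have xim l a : admissible_block s a -> \int[P]_w (xi l w ^+ a) = m a.
  move=> sa; apply: (@Rintegral_id _ T R P xi xi_id l 1 (fun y => y ^+ a)); last exact: xia.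
  exact: exprn_measurable.
apply: (power_slln_linear_process (v := v) q1 q2 K0 s_gt0 g_gt g_lt xi_ind xi0 xiv xiK xim cg
  _ e0 e1 e_le p0 pq eu).
case: r0P => [->|[-> [->|[s_even sym]]]]; [by left|by right; split => //; left|].
right; split => //; right; split => // a aodd ab.
exact: symmetric_odd_moment sym aodd (xia 1 a ab).
Qed.

End IIDPowers.

Theorem proposition1 (d : measure_display) (T : measurableType d)
  (R : realType) (P : probability T R) (s : nat)
  (xi : int -> {RV P >-> R}) (c : int -> R) (alpha sigma : R)
  (s_gt0 : (0 < s)%N)
  (xi_iid : iid P (fun l : int => xi l : T -> R))
  (xi_mean0 : forall l : int, ('E_P[xi l] = 0)%E)
  (reg : ('E_P[fun w => (`|xi 1 w| ^+ 2)%R] < +oo)%E)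
  (alpha_gt1 : 1 < alpha)
  (tail : (ereal_sup [set (t `^ alpha)%:E * P [set w | (t < `|xi 1 w| ^+ s)%R]
                     | t in [set t : R | (1 <= t)%R]] < +oo)%E)
  (sigma_range : 2^-1 < sigma <= 1)
  (decay : (ereal_sup [set ((`|l|%N%:R `^ sigma) * `|c l|)%:E
                      | l in [set: int]] < +oo)%E) :
  let x : int -> T -> R := linear_process c (fun l : int => xi l : T -> R) in
  (forall p : R, 0 < p -> (p%:E < rate_bound s alpha sigma)%E ->
     power_slln P x s p) /\
  (symmetric_rv P (xi 1) -> ~~ odd s ->
     forall p : R, 0 < p -> (p%:E < rate_bound2 alpha sigma)%E ->
       power_slln P x s p).
Proof.
have [s2 s1] := andP sigma_range => x.
have slln := power_slln_iid s_gt0 xi_iid xi_mean0 reg alpha_gt1 tail s2 s1 decay.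
(* With r0 = 1 the exponent 1 - (2 sigma - 1) / 2 equals (3 - 2 sigma) / 2; and p < 2 follows from
   sigma <= 1. *)
have rate1 p : 0 < p -> p < 2 / (3 - 2 * sigma) ->
    p < 2 /\ 1 - (2 * sigma - 1) * 1%:R / 2 < p^-1.
  move=> p0 ps; have h : 0 < 3 - 2 * sigma by lra.
  have : (3 - 2 * sigma) / 2 < p^-1 by rewrite -invf_div ltf_pV2 ?posrE ?divr_gt0.
  move=> hp; split; last by rewrite mulr1; lra.
  by rewrite (lt_le_trans ps)// ler_pdivrMr//; lra.
have rate2 p : 0 < p -> (p%:E < rate_bound2 alpha sigma)%E ->
    [/\ p < 2, p < alpha & 1 - (2 * sigma - 1) * 2%:R / 2 < p^-1].
  move=> p0; rewrite /rate_bound2 !lt_min !lte_fin inver => /andP[/andP[-> ->]].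
  (* With r0 = 2 the exponent is 2 - 2 sigma. At sigma = 1 it is 0, below every 1 / p, in accordance
     with the infinite inverse. *)
  case: eqP => [s0 _|s0]; first by split => //; rewrite (_ : 1 - _ = 0) ?invr_gt0//; lra.
  rewrite lte_fin => ps; split => //.
  have h : 0 < 2 - 2 * sigma by lra.
  have : 2 - 2 * sigma < p^-1 by rewrite -[ltLHS]invrK ltf_pV2 ?posrE ?invr_gt0.
  lra.
split=> [p p0|sym s_even p p0 /(rate2 p p0)[p2 pa pr]]; last first.
  by apply: (slln 2 p) => //; right; split => //; right.
rewrite /rate_bound; case: eqP => [s_eq1|_].
  rewrite lte_fin => /(rate1 p p0)[p2 pr].
  by apply: (slln 1%N p) => //; [left|rewrite s_eq1].
case: eqP => [s_eq2 /(rate2 p p0)[p2 pa pr]|_].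
  by apply: (slln 2 p) => //; right; split => //; left.
(* For s > 2 without symmetry a monomial with a single linear factor may remain, hence r0 = 1. *)
rewrite lt_min !lte_fin => /andP[pa /(rate1 p p0)[p2 pr]].
by apply: (slln 1%N p) => //; left.
Qed.
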